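(* Let $X=\{X(t)\}_{t\in\mathbb{R}^N}$ be a real-valued centered Gaussian random field with continuous sample functions and let $I\subset\mathbb{R}^N$ be a compact $N$-dimensional interval. Suppose $(\mathbb{E}[(X(t)-X(s))^2])^{1/2}\asymp\varphi(|t-s|)$ for all $t,s\in I$, where $\varphi:[0,\infty)\to[0,\infty)$ is non-decreasing, continuous and regularly varying at $0$ of index $\theta\in[0,1]$ with $$\int_0^h\frac{\varphi(r)\,dr}{r\sqrt{\log(1/r)}}\lesssim\varphi(h)\sqrt{\log(1/h)}=o(1)\quad\text{as }h\to0^+.$$ Suppose there exist $C_0>0$, $\rho>0$, $a_0>0$ and $h_0\in(0,1]$ such that $$\mathrm{Var}(X(t)-X(s)\mid X(t')-X(s'))\ge C_0\,\mathrm{Var}(X(t)-X(s))$$ for all $h\in(0,h_0]$ and all $t,s,t',s'\in I$ with $|t-s|\le h$, $|t'-s'|\le h$ and $|s-s'|\ge a_0h^\rho$. Then there is a constant $K_1$ with $0<K_1<\infty$ such that $$\lim_{h\to0^+}\ \sup_{t,s\in I:\,0<|t-s|\le h}\frac{|X(t)-X(s)|}{\varphi(|t-s|)\sqrt{\log(1/|t-s|)}}=K_1\quad\text{a.s.}$$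
   Context: $|\cdot|$ is the Euclidean norm. $f\lesssim g$ means there is a constant $C\in(0,\infty)$ with $f\le Cg$ throughout the indicated range (for statements ''as $h\to0^+$'': for all sufficiently small $h>0$); $f\asymp g$ means $f\lesssim g$ and $g\lesssim f$. A function $\varphi$ is regularly varying at $0$ of index $\theta$ if $\lim_{r\to0^+}\varphi(\lambda r)/\varphi(r)=\lambda^\theta$ for all $\lambda>0$. $\mathrm{Var}(Y\mid Z)$ is the conditional variance of $Y$ given $Z$, a non-random number for jointly Gaussian variables. The field $X$ is defined on a complete probability space. *)

(* Defs.v *)
From HB Require Import structures.
From mathcomp Require Import all_boot all_order all_algebra.
From mathcomp Require Import all_classical all_reals all_analysis.
Set Implicit Arguments.
Unset Strict Implicit.
Unset Printing Implicit Defensive.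
Import Order.TTheory GRing.Theory Num.Theory.
Import numFieldNormedType.Exports.
Local Open Scope classical_set_scope.
Local Open Scope ring_scope.

(* The norm `|x| that the library puts on 'rV[R]_N is the sup norm. *)
Definition enorm (R : realType) (N : nat) (x : 'rV[R]_N) : R :=
  Num.sqrt (\sum_(i < N) x 0 i ^+ 2).

Definition box (R : realType) (N : nat) (a b : 'rV[R]_N) : set 'rV[R]_N :=
  [set t | forall i, a 0 i <= t 0 i <= b 0 i].

Definition lesssim (R : realType) (U : Type) (D : set U) (f g : U -> R) : Prop :=
  exists2 C : R, 0 < C & forall x, D x -> f x <= C * g x.

Definition asymp (R : realType) (U : Type) (D : set U) (f g : U -> R) : Prop :=
  lesssim D f g /\ lesssim D g f.

(* Since x / 0 = 0, the case lam = 1 forces phi to be nonzero near 0. *)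
Definition regularly_varying0 (R : realType) (phi : R -> R) (theta : R) : Prop :=
  forall lam : R, 0 < lam ->
    phi (lam * r) / phi r @[r --> 0^'+] --> lam `^ theta.

Section probability_notions.
Context d (T : measurableType d) (R : realType) (P : probability T R).

(* Degenerate laws are allowed; they need a separate case because the library
   sets normal_prob m 0 to the uniform law on [0, 1]. *)
Definition gaussian_law (Y : T -> R) : Prop :=
  exists m s : R, 0 <= s /\
    forall A : set R, measurable A ->
      P (Y @^-1` A) = if s == 0 then \d_m A else normal_prob m s A.

Definition gaussian_field (U : Type) (X : U -> {RV P >-> R}) : Prop :=
  forall (n : nat) (t : 'I_n -> U) (c : 'I_n -> R),
    gaussian_law (fun w => \sum_(i < n) c i * X (t i) w).

Definition centered (U : Type) (X : U -> {RV P >-> R}) : Prop :=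
  forall t, ('E_P[X t] = 0)%E.

(* M is a version of the conditional expectation E[Y | Z]. *)
Definition is_cond_exp (Y Z M : T -> R) : Prop :=
  [/\ P.-integrable [set: T] (EFin \o Y),
      P.-integrable [set: T] (EFin \o M),
      forall B : set R, measurable B ->
        g_sigma_algebra_preimage Z (M @^-1` B)
    & forall A : set T, g_sigma_algebra_preimage Z A ->
        (\int[P]_(w in A) (M w)%:E = \int[P]_(w in A) (Y w)%:E)%E].

(* V is a version of Var(Y | Z) = E[(Y - E[Y | Z])^2 | Z]. *)
Definition is_cond_var (Y Z V : T -> R) : Prop :=
  exists2 M : T -> R, is_cond_exp Y Z M &
    is_cond_exp (fun w => (Y w - M w) ^+ 2) Z V.

(* Var(Y | Z) as a number: the constant that is a version of the conditional
   variance. It exists and is unique for jointly Gaussian Y and Z; 0 is only a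
   default for the case where there is none. *)
Definition cond_var (Y Z : T -> R) : R :=
  xget 0 [set v : R | is_cond_var Y Z (cst v)].

Definition incr_std (U : Type) (X : U -> {RV P >-> R}) (t s : U) : R :=
  Num.sqrt (fine 'E_P[(X t \- X s) ^+ 2]%E).

Definition modulus_ratio (N : nat) (X : 'rV[R]_N -> {RV P >-> R})
    (phi : R -> R) (w : T) (t s : 'rV[R]_N) : R :=
  `|X t w - X s w| / (phi (enorm (t - s)) * Num.sqrt (ln (1 / enorm (t - s)))).

Definition sup_modulus (N : nat) (X : 'rV[R]_N -> {RV P >-> R})
    (I : set 'rV[R]_N) (phi : R -> R) (w : T) (h : R) : \bar R :=
  ereal_sup [set (modulus_ratio X phi w p.1 p.2)%:E | p in
    [set p | [/\ I p.1, I p.2 & 0 < enorm (p.1 - p.2) <= h]]].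

End probability_notions.

(* Main.v *)
From HB Require Import structures.
Require Import Defs.
From mathcomp Require Import all_boot all_order all_algebra.
From mathcomp Require Import all_classical all_reals all_analysis.
From mathcomp Require Import measurable_realfun ring lra zify.
Set Implicit Arguments.
Unset Strict Implicit.
Unset Printing Implicit Defensive.
Import Order.TTheory GRing.Theory Num.Theory.
Import numFieldNormedType.Exports.
Local Open Scope classical_set_scope.
Local Open Scope ring_scope.

(** Write J(w) for the limit, as h decreases to 0, of the supremum of the
    normalized increments of the path w over pairs of points at distance at
    most h. The limit exists by monotonicity; the claim is that it is almost
    surely a constant, positive and finite.

    _The limit is constant._ If f is a variable of the Gaussian span of X, then
    X = beta f + Y where Y is uncorrelated with f and, by the Cauchy-Schwarz
    inequality, the increments of beta are at most a multiple of phi. Since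
    sqrt (ln (1 / r)) tends to infinity, beta f does not contribute to the
    limit, so the event J > c is determined by Y and is independent of f
    ([osc_zero_one]). Being independent of every f, it is independent of itself
    ([gaussian_zero_one]).

    Independence of uncorrelated Gaussian variables is obtained without joint
    laws. By the addition formulas E[cos f cos g] = E[cos f] E[cos g] follows
    from the characteristic function of one normal variable ([normal_cos],
    [uncorrelated_cos]), and an identity between expectations that holds for
    all cos f and sin f holds for everything obtained from them by linear
    combinations and bounded limits, in particular for indicators of events
    ([trig_closure], [uncorrelated_indep]).

    _The limit is finite._ This is Fernique's chaining along dyadic grids. Only
    the levels n, 2n, 4n, ... are used: with these the bound produced by the
    chain is a sum of phi (2 ^ - (n 2 ^ k)) sqrt (n 2 ^ k), which the integral
    condition controls even if theta = 0 ([chaining_sum],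
    [osc_exceeds_prob_le_half]).

    _The limit is positive._ At scale h there are about h ^ - rho increments
    whose normalizations Y_i have pairwise correlations at most
    r = sqrt (1 - C0) < 1, because a conditional variance of the form
    Var(f | g) equals Var f (1 - corr^2) ([cond_var_correlation]). Such a
    family cannot be uniformly small: translating the event max |Y_i| <= u by
    lam in the direction of Y_j gives events that are disjoint for different j,
    while the cost of a translation is only about exp (- lam^2 / 2)
    ([small_ball_packing]). With lam a small multiple of sqrt (ln (1 / h)), the
    probability that all |Y_i| stay below a multiple of sqrt (ln (1 / h)) tends
    to 0 ([not_osc_exceeds_negligible]). *)
(** * Integrals against the normal density *)
Section normal_integrals.
Context {R : realType}.
Local Notation mu := (@lebesgue_measure R).
Implicit Types m s x : R.

(** The density agrees almost everywhere with the Radon-Nikodym derivative, as both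
    have the same integral over every measurable set. *)
Lemma ge0_integral_normal_prob m s (f : R -> \bar R) :
  measurable_fun [set: R] f -> (forall x, 0 <= f x)%E ->
  (\int[normal_prob m s]_x f x = \int[mu]_x (f x * (normal_pdf m s x)%:E))%E.
Proof.
move=> mf f0.
have dom := @normal_prob_dominates R m s.
rewrite -(Radon_Nikodym_SigmaFinite.change_of_variables dom f0 measurableT mf).
have iRN := Radon_Nikodym_SigmaFinite.f_integrable dom.
have mpdf : measurable_fun [set: R] (EFin \o normal_pdf m s).
  by apply/measurable_EFinP; exact: measurable_normal_pdf.
apply: ae_eq_integral => //.
- by apply: emeasurable_funM => //; exact: (measurable_int mu).
- exact: emeasurable_funM.
- apply: ae_eqe_mul2l; apply: integral_ae_eq => //.
  by move=> A _ mA; rewrite -Radon_Nikodym_SigmaFinite.f_integral.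
Qed.

(** Integrability is not required: the two integrals are differences of the same
    positive and negative parts, because the density is nonnegative. *)
Lemma integral_normal_prob m s (f : R -> R) :
  measurable_fun [set: R] f ->
  (\int[normal_prob m s]_x (f x)%:E = \int[mu]_x (f x * normal_pdf m s x)%:E)%E.
Proof.
move=> /measurable_EFinP mf.
rewrite integralE [RHS]integralE.
have pdf0 := @normal_pdf_ge0 R m s.
rewrite !ge0_integral_normal_prob//; last 2 first.
- exact: measurable_funeneg.
- exact: measurable_funepos.
congr (_ - _)%E; apply: eq_integral => x _.
  by rewrite /= !funeposE EFinM maxe_pMl ?lee_fin// mul0e.
by rewrite /= !funenegE -!EFinN -mulNr EFinM maxe_pMl ?lee_fin// mul0e.
Qed.


(** Polynomial growth is absorbed by doubling the standard deviation, through
    1 + z <= exp z. *)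
Lemma normal_fun_domination m s x : s != 0 ->
  (1 + `|x|) ^+ 2 * normal_fun m s x <=
  (2 * (1 + `|m|) ^+ 2 * (1 + 4 * s ^+ 2)) * normal_fun m (2 * s) x.
Proof.
move=> s0; have s2 : 0 < s ^+ 2 by rewrite exprn_even_gt0.
pose y := x - m; pose z := y ^+ 2 / (4 * s ^+ 2).
have z0 : 0 <= z by rewrite divr_ge0 ?sqr_ge0// mulr_ge0// ltW.
have -> : normal_fun m s x = normal_fun m (2 * s) x * expR (- (3 / 2 * z)).
  rewrite /normal_fun -expRD; congr expR; rewrite /z /y.
  by field; rewrite s0.
have xm : 1 + `|x| <= (1 + `|m|) * (1 + `|y|).
  have : `|x| <= `|y| + `|m| by rewrite (le_trans _ (ler_normD _ _))// subrK.
  have := normr_ge0 m; have := normr_ge0 y; nra.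
have sq : (1 + `|x|) ^+ 2 <= (2 * (1 + `|m|) ^+ 2 * (1 + 4 * s ^+ 2)) * (1 + z).
  apply: (@le_trans _ _ (((1 + `|m|) * (1 + `|y|)) ^+ 2)).
    by rewrite ler_pXn2r// nnegrE ?addr_ge0 ?mulr_ge0// addr_ge0.
  have -> : 2 * (1 + `|m|) ^+ 2 * (1 + 4 * s ^+ 2) * (1 + z) =
      (1 + `|m|) ^+ 2 * (2 * ((1 + 4 * s ^+ 2) * (1 + z))) by ring.
  rewrite exprMn ler_wpM2l ?sqr_ge0//.
  have zE : 4 * s ^+ 2 * z = `|y| ^+ 2.
    by rewrite /z real_normK ?num_real// mulrC divfK// gt_eqF// mulr_gt0.
  have : (1 + 4 * s ^+ 2) * (1 + z) = 1 + 4 * s ^+ 2 + z + `|y| ^+ 2.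
    by rewrite -zE; ring.
  move=> ->; have := sqr_ge0 (`|y| - 1); nra.
(* 3 / 2 z is the gap between the exponents y^2 / (2 s^2) and y^2 / (2 (2 s)^2) *)
have ez : (1 + z) * expR (- (3 / 2 * z)) <= 1.
  have := expR_ge1Dx (3 / 2 * z) => e1.
  by rewrite expRN ler_pdivrMr ?expR_gt0// mul1r (le_trans _ e1)//; lra.
rewrite [X in _ * X <= _]mulrC mulrA ler_wpM2r ?normal_fun_ge0//.
apply: le_trans (ler_wpM2r (expR_ge0 _) sq) _.
rewrite -[leLHS]mulrA ler_piMr// !mulr_ge0 ?sqr_ge0// addr_ge0// mulr_ge0// ltW//.
Qed.

Lemma integrable_normal_growth m s (g : R -> R) A : s != 0 ->
  measurable_fun [set: R] g ->
  (forall x, `|g x| <= A * (1 + `|x|) ^+ 2) ->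
  mu.-integrable [set: R] (EFin \o (fun x => g x * normal_pdf m s x)).
Proof.
move=> s0 mg gA.
have A0 : 0 <= A.
  have := gA 0; rewrite normr0 addr0 expr1n mulr1; exact/le_trans/normr_ge0.
have ms0 : 2 * s != 0 by rewrite mulf_neq0.
pose B := A * normal_peak s * (2 * (1 + `|m|) ^+ 2 * (1 + 4 * s ^+ 2)) /
  normal_peak (2 * s).
apply: (@le_integrable _ _ _ mu _ measurableT _
  (EFin \o (fun x => B * normal_pdf m (2 * s) x))).
- apply/measurable_EFinP; apply: measurable_funM => //.
  exact: measurable_normal_pdf.
- move=> x _; rewrite /= lee_fin normrM.
  rewrite [leRHS]ger0_norm; last first.
    rewrite mulr_ge0 ?normal_pdf_ge0// divr_ge0 ?normal_peak_ge0//.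
    rewrite !mulr_ge0 ?normal_peak_ge0 ?sqr_ge0// addr_ge0// mulr_ge0//.
    exact: sqr_ge0.
  rewrite [X in _ * X]ger0_norm ?normal_pdf_ge0//.
  rewrite !normal_pdfE// /B [leRHS]mulrA divfK ?gt_eqF ?normal_peak_gt0//.
  apply: (@le_trans _ _ ((A * (1 + `|x|) ^+ 2) * (normal_peak s * normal_fun m s x))).
    by rewrite ler_wpM2r// mulr_ge0 ?normal_peak_ge0 ?normal_fun_ge0.
  have := @normal_fun_domination m s x s0 => D.
  have -> : A * (1 + `|x|) ^+ 2 * (normal_peak s * normal_fun m s x) =
    (A * normal_peak s) * ((1 + `|x|) ^+ 2 * normal_fun m s x) by ring.
  rewrite -[leRHS]mulrA ler_wpM2l// mulr_ge0// normal_peak_ge0//.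
- have -> : (EFin \o (fun x => B * normal_pdf m (2 * s) x)) =
    (fun x => B%:E * (normal_pdf m (2 * s) x)%:E)%E.
    by apply/funext => x /=; rewrite EFinM.
  by apply: integrableZl => //; exact: integrable_normal_pdf.
Qed.

Lemma is_derive_normal_pdf m s x : s != 0 ->
  is_derive x 1 (normal_pdf m s) (- ((x - m) / s ^+ 2) * normal_pdf m s x).
Proof.
move=> s0; rewrite normal_pdfE//.
have e : is_derive x 1 (fun y : R => - (y - m) ^+ 2 / (s ^+ 2 *+ 2))
   (- ((x - m) / s ^+ 2)).
  apply: is_derive_eq; rewrite /GRing.scale /=. 
  rewrite -[(s ^+ 2) *+ 2]mulr_natr; field; rewrite s0//.
have := is_derive1_comp (is_derive_expR _) e => e'.
apply: is_derive_eq; rewrite /GRing.scale /= /normal_fun; ring.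
Qed.

End normal_integrals.

Section stein.
Context {R : realType}.
Local Notation mu := (@lebesgue_measure R).
Implicit Types m s x : R.

(** The fundamental theorem of calculus on [-n, n]: the boundary terms vanish as n
    grows and the integral converges by dominated convergence. *)
Lemma integral_derive_vanishing (F f : R -> R) B :
  (forall x, is_derive x 1 F (f x)) -> continuous f ->
  (forall x, `|F x| * (1 + `|x|) <= B) ->
  mu.-integrable [set: R] (EFin \o f) ->
  \int[mu]_x f x = 0.
Proof.
move=> dF cf FB intf.
have B0 : 0 <= B by apply: le_trans (FB 0); rewrite mulr_ge0.
pose f_ n x := f x * \1_(`[- n.+1%:R, n.+1%:R]%classic : set R) x.
have mf : measurable_fun [set: R] f by exact: continuous_measurable_fun.
have mf_ n : measurable_fun [set: R] (f_ n).
  by apply: measurable_funM => //; exact: measurable_indic.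
have cvF : F n.+1%:R - F (- n.+1%:R) @[n --> \oo] --> 0.
  apply: (@squeeze_cvgr _ _ _ _ (fun n => - (2 * B * n.+1%:R^-1))
    (fun n => 2 * B * n.+1%:R^-1)).
  - apply: nearW => n; rewrite -ler_norml.
    have K x : `|x| = n.+1%:R -> `|F x| <= B * n.+1%:R^-1.
      move=> xn; rewrite ler_pdivlMr// (le_trans _ (FB x))// ler_wpM2l// xn.
      by rewrite lerDr.
    rewrite (le_trans (ler_normB _ _))//.
    have h1 : `|n.+1%:R : R| = n.+1%:R by rewrite ger0_norm.
    have h2 : `|- n.+1%:R : R| = n.+1%:R by rewrite normrN.
    by rewrite -[leRHS]mulrA mulr_natl mulr2n lerD// K.
  - rewrite -oppr0; apply: cvgN; rewrite -(mulr0 (2 * B)).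
    by apply: cvgMr; exact: cvg_harmonic.
  - by rewrite -(mulr0 (2 * B)); apply: cvgMr; exact: cvg_harmonic.
have FTC n : (\int[mu]_x (f_ n x)%:E = (F n.+1%:R - F (- n.+1%:R))%:E)%E.
  have := @continuous_FTC2 R f F (- n.+1%:R) n.+1%:R.
  rewrite EFinB => <-.
  - rewrite [RHS]integral_mkcond; apply: eq_integral => x _.
    by rewrite patchE /f_ indicE; case: ifPn; rewrite ?mulr1 ?mulr0.
  - by rewrite gtrN.
  - exact: continuous_subspaceT.
  - have cF x : {for x, continuous F}.
      by apply/differentiable_continuous/derivable1_diffP; case: (dF x).
    split.
    + by move=> x _; case: (dF x).
    + exact/cvg_at_right_filter/cF.
    + exact/cvg_at_left_filter/cF.
  - by move=> x _; rewrite derive1E; case: (dF x).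
have mEf_ n : measurable_fun [set: R] (EFin \o f_ n) by exact/measurable_EFinP.
have mEf : measurable_fun [set: R] (EFin \o f) by exact/measurable_EFinP.
have cvf : {ae mu, forall x, [set: R] x ->
    (EFin \o f_ n) x @[n --> \oo] --> (EFin \o f) x}.
  apply: aeW => x _; apply: cvg_EFin; first exact: nearW.
  apply: (@cvg_near_cst _ _ (f x)).
  near=> n; rewrite /f_ /= indicE mem_set ?mulr1//=.
  rewrite in_itv/= -ler_norml.
  apply: (@le_trans _ _ n%:R); last by rewrite ler_nat.
  by near: n; exact: nbhs_infty_ger.
have domf : {ae mu, forall x n, [set: R] x ->
    (`|(EFin \o f_ n) x| <= (abse \o (EFin \o f)) x)%E}.
  apply: aeW => x n _; rewrite /= lee_fin /f_ normrM ler_piMr//.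
  by rewrite indicE; case: (_ \in _); rewrite ?normr1 ?normr0.
have [_ _ dct] := @dominated_convergence _ _ _ mu _ measurableT _ _ _ mEf_ mEf cvf
  (integrable_abse intf) domf.
have {}dct : (F n.+1%:R - F (- n.+1%:R))%:E @[n --> \oo] --> (\int[mu]_x (f x)%:E)%E.
  by under eq_fun do rewrite -FTC.
rewrite /Rintegral.
suff -> : (\int[mu]_x (f x)%:E = 0)%E by [].
apply: cvg_unique dct _ => //.
by apply: cvg_EFin; [exact: nearW|exact: cvF].
Unshelve. all: end_near. Qed.


(** Stein's identity. The derivative of the density is - (x - m) / s^2 times the
    density, so this is an integration by parts. It gives the mean (g = 1), the
    variance (g = id) and a differential equation for the characteristic function
    (g a sine). *)
Lemma stein_normal m s (g g' : R -> R) A : s != 0 ->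
  (forall x, is_derive x 1 g (g' x)) -> continuous g' ->
  (forall x, `|g x| <= A * (1 + `|x|)) ->
  (forall x, `|g' x| <= A * (1 + `|x|) ^+ 2) ->
  \int[mu]_x ((x - m) * g x * normal_pdf m s x) =
  s ^+ 2 * \int[mu]_x (g' x * normal_pdf m s x).
Proof.
move=> s0 dg cg' gA g'A.
have s2 : 0 < s ^+ 2 by rewrite exprn_even_gt0.
have A0 : 0 <= A by have := le_trans (normr_ge0 _) (gA 0); rewrite normr0 addr0 mulr1.
have cg : continuous g.
  by move=> x; apply/differentiable_continuous/derivable1_diffP; case: (dg x).
have xmA x : `|(x - m) * g x| <= (A * (1 + `|m|)) * (1 + `|x|) ^+ 2.
  have xm : `|x - m| <= (1 + `|m|) * (1 + `|x|).
    have := ler_normB x m; have := normr_ge0 x; have := normr_ge0 m; nra.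
  rewrite normrM (le_trans (ler_pM _ _ xm (gA x)))//.
  by rewrite le_eqVlt; apply/orP; left; apply/eqP; ring.
have i1 := @integrable_normal_growth R m s (fun x => (x - m) * g x) _ s0 _ xmA.
have {}i1 := i1 (continuous_measurable_fun _).
have {}i1 : mu.-integrable [set: R]
    (EFin \o (fun x => (x - m) * g x * normal_pdf m s x)).
  apply: i1 => x; apply: cvgM; last exact: cg.
  by apply: cvgB; [exact: cvg_id|exact: cvg_cst].
have i2 := @integrable_normal_growth R m s g' _ s0 (continuous_measurable_fun cg') g'A.
pose f x := (g' x - (s ^+ 2)^-1 * ((x - m) * g x)) * normal_pdf m s x.
have fE : f = (fun x => g' x * normal_pdf m s x) \-
    (fun x => (s ^+ 2)^-1 * ((x - m) * g x * normal_pdf m s x)).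
  by apply/funext => x; rewrite /f/=; ring.
have i1' : mu.-integrable [set: R] (EFin \o
    (fun x => (s ^+ 2)^-1 * ((x - m) * g x * normal_pdf m s x))).
  by rewrite /comp; under eq_fun do rewrite EFinM; exact: integrableZl.
have : \int[mu]_x f x = 0.
  pose B := A * normal_peak s * (2 * (1 + `|m|) ^+ 2 * (1 + 4 * s ^+ 2)).
  apply: (@integral_derive_vanishing (fun x => g x * normal_pdf m s x) _ B).
  - move=> x; have := is_derive_normal_pdf m x s0 => dp.
    apply: is_derive_eq; rewrite /f /GRing.scale /=; by field.
  - move=> x; apply: cvgM; last exact: continuous_normal_pdf.
    apply: cvgB; first exact: cg'.
    apply: cvgM; first exact: cvg_cst.
    apply: cvgM; last exact: cg.
    by apply: cvgB; [exact: cvg_id|exact: cvg_cst].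
  - move=> x; rewrite normrM [X in _ * X * _]ger0_norm ?normal_pdf_ge0//.
    rewrite normal_pdfE//.
    apply: (@le_trans _ _ (A * (1 + `|x|) * (normal_peak s * normal_fun m s x) *
       (1 + `|x|))).
      by rewrite ler_wpM2r ?addr_ge0// ler_wpM2r// mulr_ge0 ?normal_peak_ge0 ?expR_ge0.
    have -> : A * (1 + `|x|) * (normal_peak s * normal_fun m s x) * (1 + `|x|) =
      (A * normal_peak s) * ((1 + `|x|) ^+ 2 * normal_fun m s x) by ring.
    rewrite /B ler_wpM2l ?mulr_ge0 ?normal_peak_ge0//.
    apply: le_trans (normal_fun_domination _ _ s0) _.
    rewrite ler_piMr//.
      by rewrite !mulr_ge0 ?sqr_ge0// addr_ge0// mulr_ge0// sqr_ge0.
    rewrite -expR0 ler_expR mulNr oppr_le0 divr_ge0 ?sqr_ge0//.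
    by rewrite mulrn_wge0 ?sqr_ge0.
  - rewrite fE; have := integrableB measurableT i2 i1'.
    by apply: eq_integrable => // x _; rewrite /= EFinB.
rewrite fE RintegralB// RintegralZl//= => /eqP; rewrite subr_eq0 => /eqP ->.
by rewrite mulrA divff ?mul1r// gt_eqF.
Qed.

End stein.

Section normal_moments.
Context {R : realType}.
Local Notation mu := (@lebesgue_measure R).
Implicit Types m s x : R.

Lemma normal_mean m s : s != 0 ->
  \int[mu]_x (x * normal_pdf m s x) = m.
Proof.
move=> s0.
have := @stein_normal R m s (cst 1) (cst 0) 1 s0 => /(_ _ _ _ _).
have -> : \int[mu]_x (cst 0 x * normal_pdf m s x) = 0 :> R.
  under eq_Rintegral do rewrite /= mul0r.
  by rewrite Rintegral_cst// mul0r.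
rewrite mulr0.
have -> : \int[mu]_x ((x - m) * cst 1 x * normal_pdf m s x) =
   \int[mu]_x (x * normal_pdf m s x) - m.
  have i1 : mu.-integrable [set: R] (EFin \o (fun x => x * normal_pdf m s x)).
    apply: (@integrable_normal_growth _ _ _ _ 1) => //= x.
    by have := normr_ge0 x; nra.
  have i2 : mu.-integrable [set: R] (EFin \o (fun x => m * normal_pdf m s x)).
    rewrite /comp; under eq_fun do rewrite EFinM.
    by apply: integrableZl => //; exact: integrable_normal_pdf.
  transitivity (\int[mu]_x (x * normal_pdf m s x - m * normal_pdf m s x)).
    by apply: eq_Rintegral => x _ /=; ring.
  rewrite RintegralB// RintegralZl//; last exact: integrable_normal_pdf.
  by rewrite [X in m * X]/Rintegral integral_normal_pdf mulr1.
move=> H; apply/eqP; rewrite -subr_eq0; apply/eqP; apply: H.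
- exact: cst_continuous.
- by move=> x; rewrite normr1 mul1r lerDl.
- by move=> x; rewrite normr0 mul1r sqr_ge0.
Qed.

Lemma normal_variance s : s != 0 ->
  \int[mu]_x (x ^+ 2 * normal_pdf 0 s x) = s ^+ 2.
Proof.
move=> s0.
have := @stein_normal R 0 s id (cst 1) 1 s0 => /(_ _ _ _ _).
have -> : \int[mu]_x (cst 1 x * normal_pdf 0 s x) = 1 :> R.
  under eq_Rintegral do rewrite /= mul1r.
  by rewrite /Rintegral integral_normal_pdf.
rewrite mulr1 => <-.
- by apply: eq_Rintegral => x _; rewrite /= subr0 expr2.
- exact: cst_continuous.
- by move=> x; rewrite mul1r lerDr.
- by move=> x; rewrite normr1 mul1r; have := normr_ge0 x; nra.
Qed.

(** The left side K(t) satisfies K' = - s^2 t K by differentiation under the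
    integral and Stein's identity, hence K(t) exp (s^2 t^2 / 2) is constant. The
    phase a treats sines and cosines together. *)
Lemma normal_cos s a t : s != 0 ->
  \int[mu]_x (cos (t * x + a) * normal_pdf 0 s x) =
  cos a * expR (- (s ^+ 2 * t ^+ 2 / 2)).
Proof.
move=> s0.
pose f (u x : R) := cos (u * x + a) * normal_pdf 0 s x.
pose K (u : R) := \int[mu]_x f u x.
have norm1 (x : R) : `|cos x| <= 1 by rewrite ler_norml cos_geN1 cos_le1.
have norm1s (x : R) : `|sin x| <= 1 by rewrite ler_norml sin_geN1 sin_le1.
have clin (u : R) : continuous (fun x : R => u * x + a).
  move=> x; apply: cvgD; last exact: cvg_cst.
  by apply: cvgM; [exact: cvg_cst|exact: cvg_id].
have ccos (u : R) : continuous (fun x : R => cos (u * x + a)).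
  by move=> x; apply: continuous_comp; [exact: clin|exact: continuous_cos].
have csin (u : R) : continuous (fun x : R => sin (u * x + a)).
  by move=> x; apply: continuous_comp; [exact: clin|exact: continuous_sin].
have intf u : mu.-integrable [set: R] (EFin \o f u).
  apply: (@integrable_normal_growth _ _ _ (fun x => cos (u * x + a)) 1) => //.
    exact: continuous_measurable_fun.
  by move=> x; rewrite (le_trans (norm1 _))//; have := normr_ge0 x; nra.
have df (u x : R) : is_derive u 1 (f ^~ x)
    (- (x * sin (u * x + a) * normal_pdf 0 s x)).
  have d1 : is_derive u 1 (fun v : R => v * x + a) x.
    by apply: is_derive_eq; rewrite /GRing.scale /=; ring.
  have d2 := is_derive1_comp (is_derive_cos _) d1.
  by apply: is_derive_eq; rewrite /GRing.scale /=; ring.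
have p1E (u x : R) : partial1of2 f u x = - (x * sin (u * x + a) * normal_pdf 0 s x).
  by rewrite partial1of2E; have [_ ->] := df u x.
have intG : mu.-integrable [set: R] (EFin \o (fun x => `|x| * normal_pdf 0 s x)).
  apply: (@integrable_normal_growth _ _ _ (fun x => `|x|) 1) => //.
  by move=> x; rewrite normr_id; have := normr_ge0 x; nra.
have dK (u : R) : is_derive u 1 K (- (s ^+ 2 * u * K u)).
  have Iu : `]u - 1, u + 1[%classic u by rewrite /= in_itv/= ltrBlDr ltrDl ltr01.
  have dfu (v x : R) : `]u - 1, u + 1[%classic v -> [set: R] x -> derivable (f^~ x) v 1.
    by move=> _ _; case: (df v x).
  have G0 (x : R) : 0 <= `|x| * normal_pdf 0 s x by rewrite mulr_ge0 ?normal_pdf_ge0.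
  have ub (v x : R) : `]u - 1, u + 1[%classic v -> [set: R] x ->
      `|partial1of2 f v x| <= `|x| * normal_pdf 0 s x.
    move=> _ _; rewrite p1E normrN !normrM (ger0_norm (normal_pdf_ge0 _ _ _)).
    by rewrite ler_wpM2r ?normal_pdf_ge0// ler_piMr.
  have D1 := derivable_under_integral measurableT Iu (fun v _ => intf v) dfu G0 intG ub.
  have D2 := differentiation_under_integral measurableT Iu (fun v _ => intf v) dfu G0 intG ub.
  apply: DeriveDef; first exact: D1.
  rewrite -derive1E D2.
  have dsin (x : R) : is_derive x 1 (fun x => sin (u * x + a)) (u * cos (u * x + a)).
    have d1 : is_derive x 1 (fun v : R => u * v + a) u.
      by apply: is_derive_eq; rewrite /GRing.scale /=; ring.
    have d2 := is_derive1_comp (is_derive_sin _) d1.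
    by apply: is_derive_eq; rewrite /GRing.scale /=; ring.
  have st := @stein_normal R 0 s (fun x => sin (u * x + a))
    (fun x => u * cos (u * x + a)) (1 + `|u|) s0 dsin.
  have intxs : mu.-integrable [set: R]
      (EFin \o (fun x => x * sin (u * x + a) * normal_pdf 0 s x)).
    apply: (@integrable_normal_growth _ _ _ (fun x => x * sin (u * x + a)) 1) => //.
      by apply: measurable_funM => //; exact: continuous_measurable_fun.
    move=> x; rewrite normrM (@le_trans _ _ `|x|)//; first by rewrite ler_piMr.
    by have := normr_ge0 x; nra.
  transitivity (- \int[mu]_x (x * sin (u * x + a) * normal_pdf 0 s x)).
    rewrite -mulN1r -RintegralZl//.
    by apply: eq_Rintegral => x _; rewrite p1E mulN1r.
  congr (- _).
  transitivity (s ^+ 2 * \int[mu]_x (u * cos (u * x + a) * normal_pdf 0 s x)).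
    rewrite -st.
    - by apply: eq_Rintegral => x _; rewrite subr0.
    - by move=> x; apply: cvgM; [exact: cvg_cst|exact: ccos].
    - move=> x; rewrite (le_trans (norm1s _))//.
      by have := normr_ge0 x; have := normr_ge0 u; nra.
    - move=> x; rewrite normrM; have := norm1 (u * x + a).
      have := normr_ge0 (cos (u * x + a)).
      have := normr_ge0 x; have := normr_ge0 u => u0 x0 c0 c1.
      apply: (@le_trans _ _ (1 + `|u|)); first by nra.
      by rewrite ler_peMr ?addr_ge0// expr_ge1 ?addr_ge0// lerDl.
  rewrite -mulrA; congr (_ * _); rewrite -RintegralZl//.
  by apply: eq_Rintegral => x _; rewrite /f mulrA.
pose L (u : R) := K u * expR (s ^+ 2 * u ^+ 2 / 2).
have dL (u : R) : is_derive u 1 L 0.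
  have d1 : is_derive u 1 (fun v : R => s ^+ 2 * v ^+ 2 / 2) (s ^+ 2 * u).
    by apply: is_derive_eq; rewrite /GRing.scale /=; field.
  have d2 := is_derive1_comp (is_derive_expR _) d1.
  by apply: is_derive_eq; rewrite /GRing.scale /=; ring.
have Lt : L t = L 0 := is_derive_0_is_cst _ _ dL.
have L0 : L 0 = cos a.
  rewrite /L expr0n/= mulr0 mul0r expR0 mulr1 /K /f.
  under eq_Rintegral do rewrite mul0r add0r.
  rewrite RintegralZl//; last exact: integrable_normal_pdf.
  by rewrite [X in _ * X]/Rintegral integral_normal_pdf mulr1.
rewrite -L0 -Lt /L -[RHS]mulrA -expRD.
by rewrite subrr expR0 mulr1.
Qed.

End normal_moments.

(** * Random variables with a normal law *)
Section gaussian_law_facts.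
Context d (T : measurableType d) (R : realType) (P : probability T R).
Local Notation mu := (@lebesgue_measure R).

Definition normal_law (Y : T -> R) (m s : R) := forall A : set R, measurable A ->
  P (Y @^-1` A) = if s == 0 then \d_m A else normal_prob m s A.

Lemma normal_law_integral (Y : T -> R) m s (g : R -> R) :
  measurable_fun [set: T] Y -> normal_law Y m s -> measurable_fun [set: R] g ->
  (\int[P]_w (g (Y w))%:E =
    if (s == 0)%R then (g m)%:E else \int[mu]_x (g x * normal_pdf m s x)%:E)%E.
Proof.
move=> mY lawY mg.
pose mYm := isMeasurableFun.Build _ _ T (measurableTypeR R) Y mY.
pose Yp : {RV P >-> measurableTypeR R} := HB.pack Y mYm.
have mEg : measurable_fun [set: R] (EFin \o g) by exact/measurable_EFinP.
have push (f : R -> \bar R) : measurable_fun [set: R] f ->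
    (forall x, 0 <= f x)%E ->
    (\int[P]_w f (Y w) = if (s == 0)%R then f m else \int[normal_prob m s]_x f x)%E.
  move=> mf f0.
  transitivity (\int[distribution P Yp]_x f x)%E.
    by rewrite ge0_integral_distribution.
  pose nu2 : {measure set (measurableTypeR R) -> \bar R} := distribution P Yp.
  case: ifPn lawY => [/eqP s0|s0] lawY.
    pose nu1 : {measure set (measurableTypeR R) -> \bar R} := \d_(m : measurableTypeR R).
    transitivity (\int[nu1]_x f x)%E; last by rewrite integral_dirac// diracT mul1e.
    apply: (@eq_measure_integral _ (measurableTypeR R) R setT nu1 nu2).
    by move=> A mA _; apply: etrans (lawY A mA) _; rewrite s0 eqxx.
  pose nu1 : {measure set (measurableTypeR R) -> \bar R} := normal_prob m s.
  apply: (@eq_measure_integral _ (measurableTypeR R) R setT nu1 nu2).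
  by move=> A mA _; apply: etrans (lawY A mA) _; rewrite (negbTE s0).
have mp : measurable_fun [set: R] (EFin \o g)^\+%E by exact: measurable_funepos.
have mn : measurable_fun [set: R] (EFin \o g)^\-%E by exact: measurable_funeneg.
have -> : (\int[P]_w (g (Y w))%:E =
    \int[P]_w (EFin \o g)^\+%E (Y w) - \int[P]_w (EFin \o g)^\-%E (Y w))%E.
  by rewrite integralE; congr (_ - _)%E; apply: eq_integral => w _; rewrite ?funeposE ?funenegE.
rewrite !push//; case: ifPn => s0.
  by have := congr1 (fun f => f m) (funeposneg (EFin \o g)) => /= <-.
by rewrite -integral_normal_prob// [RHS]integralE.
Qed.

Lemma normal_law_integrable (Y : T -> R) m s (g : R -> R) A :
  measurable_fun [set: T] Y -> normal_law Y m s -> measurable_fun [set: R] g ->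
  (forall x, `|g x| <= A * (1 + `|x|) ^+ 2) ->
  P.-integrable [set: T] (EFin \o (g \o Y)).
Proof.
move=> mY lawY mg gA; apply/integrableP; split.
  by apply/measurable_EFinP; exact: measurableT_comp.
have mag : measurable_fun [set: R] (fun x => `|g x|) by exact: measurableT_comp.
have /= -> := normal_law_integral mY lawY mag.
case: ifPn => s0; first exact: ltry.
have /integrableP[_] := integrable_normal_growth m s0 mg gA.
apply: le_lt_trans; rewrite le_eqVlt; apply/orP; left; apply/eqP.
by apply: eq_integral => x _; rewrite /= normrM [in RHS](ger0_norm (normal_pdf_ge0 _ _ _)).
Qed.

Lemma centered_gaussian_law (Y : T -> R) :
  measurable_fun [set: T] Y -> gaussian_law P Y -> \int[P]_w Y w = 0 ->
  exists2 s, 0 <= s & normal_law Y 0 s.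
Proof.
move=> mY [m [s [s0 lawY]]] EY; exists s => //.
suff -> : 0 = m by [].
rewrite -EY /Rintegral (normal_law_integral mY lawY (@measurable_id _ _ _)).
by case: ifPn => // /normal_mean; rewrite /Rintegral => ->.
Qed.

Section centered.
Variables (Y : T -> R) (s : R).
Hypotheses (mY : measurable_fun [set: T] Y) (s0 : 0 <= s) (lawY : normal_law Y 0 s).

Lemma normal_law_integrable_sqr :
  P.-integrable [set: T] (EFin \o (fun w => Y w ^+ 2)).
Proof.
have mg : measurable_fun [set: R] (fun x : R => x ^+ 2) by exact: measurable_funX.
apply: (normal_law_integrable (A := 1) mY lawY mg) => x.
by rewrite normrX; have := normr_ge0 x; nra.
Qed.

Lemma normal_law_variance : \int[P]_w (Y w ^+ 2) = s ^+ 2.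
Proof.
have mg : measurable_fun [set: R] (fun x : R => x ^+ 2) by exact: measurable_funX.
rewrite /Rintegral (normal_law_integral mY lawY mg).
case: ifPn => [/eqP ->|sn0]; first by rewrite expr0n.
exact: normal_variance.
Qed.

Lemma normal_law_cos a t : \int[P]_w cos (t * Y w + a) =
  cos a * expR (- (s ^+ 2 * t ^+ 2 / 2)).
Proof.
have mg : measurable_fun [set: R] (fun x : R => cos (t * x + a)).
  apply: continuous_measurable_fun => x.
  apply: continuous_comp; last exact: continuous_cos.
  apply: cvgD; last exact: cvg_cst.
  by apply: cvgM; [exact: cvg_cst|exact: cvg_id].
rewrite /Rintegral (normal_law_integral mY lawY mg).
case: ifPn => [/eqP ->|sn0]; last exact: normal_cos.
by rewrite expr0n/= !mul0r oppr0 expR0 mulr1 mulr0 add0r.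
Qed.

(** Where |x| > u s, the density is at most 2 exp (- 3 u^2 / 8) times the density
    of standard deviation 2 s. *)
Lemma normal_law_tail u : 0 <= u ->
  (P [set w | (u * s < `|Y w|)%R] <= (2 * expR (- (u ^+ 2 / 4)))%:E)%E.
Proof.
move=> u0.
have mabs : measurable [set x : R | u * s < `|x|].
  have -> : [set x : R | u * s < `|x|] = (@Num.norm R R) @^-1` `]u * s, +oo[.
    by apply/seteqP; split => x /=; rewrite in_itv/= andbT.
  by rewrite -[X in measurable X]setTI; apply: normr_measurable.
rewrite (lawY mabs); case: ifPn => [/eqP ->|sn0].
  rewrite /dirac indicE memNset/= ?lee_fin ?mulr_ge0 ?expR_ge0//.
  by rewrite mulr0 normr0 ltxx.
have s1 : 0 < s by rewrite lt_neqAle eq_sym sn0.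
have pk : normal_peak s = 2 * normal_peak (2 * s).
  rewrite /normal_peak.
  have -> : (2 * s) ^+ 2 * pi *+ 2 = 2 ^+ 2 * (s ^+ 2 * pi *+ 2).
    by rewrite exprMn -mulrA mulrnAr.
  rewrite [in RHS]sqrtrM ?sqr_ge0// sqrtr_sqr ger0_norm//.
  by rewrite invfM mulrA divff// mul1r.
have pdfE x : u * s < `|x| -> normal_pdf 0 s x <=
    2 * expR (- (u ^+ 2 / 4)) * normal_pdf 0 (2 * s) x.
  move=> ux; rewrite !normal_pdfE ?mulf_neq0// pk.
  have -> : 2 * expR (- (u ^+ 2 / 4)) * (normal_peak (2 * s) * normal_fun 0 (2 * s) x)
    = 2 * normal_peak (2 * s) * (expR (- (u ^+ 2 / 4)) * normal_fun 0 (2 * s) x) by ring.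
  rewrite ler_wpM2l ?mulr_ge0 ?normal_peak_ge0//.
  rewrite /normal_fun -expRD ler_expR subr0.
  have ux2 : (u * s) ^+ 2 <= x ^+ 2.
    rewrite -[leRHS]real_normK ?num_real// ler_pXn2r ?nnegrE ?mulr_ge0//.
    exact: ltW.
  have uz : u ^+ 2 <= x ^+ 2 / s ^+ 2.
    by rewrite ler_pdivlMr ?exprn_gt0// -exprMn.
  have -> : - x ^+ 2 / (s ^+ 2 *+ 2) = - (x ^+ 2 / s ^+ 2) / 2 by field.
  have -> : - x ^+ 2 / ((2 * s) ^+ 2 *+ 2) = - (x ^+ 2 / s ^+ 2) / 8.
    by field.
  by have := sqr_ge0 u; lra.
have s2n0 : 2 * s != 0 by rewrite mulf_neq0.
rewrite /normal_prob.
apply: (@le_trans _ _ (\int[mu]_(x in [set x : R | (u * s < `|x|)%R])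
    (2 * expR (- (u ^+ 2 / 4)) * normal_pdf 0 (2 * s) x)%:E)%E).
  apply: ge0_le_integral => //=.
  - by move=> x _; rewrite lee_fin normal_pdf_ge0.
  - by apply/measurable_funTS/measurable_EFinP; exact: measurable_normal_pdf.
  - apply/measurable_funTS/measurable_EFinP; apply: measurable_funM => //.
    exact: measurable_normal_pdf.
apply: (@le_trans _ _ (\int[mu]_x
    (2 * expR (- (u ^+ 2 / 4)) * normal_pdf 0 (2 * s) x)%:E)%E).
  apply: ge0_subset_integral => //.
    by apply/measurable_EFinP; apply: measurable_funM => //;
      exact: measurable_normal_pdf.
  by move=> x _; rewrite lee_fin mulr_ge0 ?normal_pdf_ge0// mulr_ge0 ?expR_ge0.
under eq_integral do rewrite EFinM.
rewrite integralZl//; last exact: integrable_normal_pdf.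
by rewrite integral_normal_pdf mule1.
Qed.

(** The length of the interval times a lower bound for the density on it. *)
Lemma normal_law_near lam del : 0 < s -> 0 <= lam -> 0 <= del ->
  ((2 * del * (expR (- ((lam + del) ^+ 2 / 2)) / Num.sqrt (pi *+ 2)))%:E <=
   P [set w | (`|Y w - lam * s| <= del * s)%R])%E.
Proof.
move=> s1 l0 d0.
pose D : set R := `[lam * s - del * s, lam * s + del * s]%classic.
have DE : [set x : R | `|x - lam * s| <= del * s] = D.
  by apply/seteqP; split => x; rewrite /D /= in_itv/= ler_distl.
have mD : measurable D by exact: measurable_itv.
have -> : [set w | (`|Y w - lam * s| <= del * s)%R] = Y @^-1` D by rewrite -DE.
rewrite (lawY mD) gt_eqF// /normal_prob.
pose c := expR (- ((lam + del) ^+ 2 / 2)) / (s * Num.sqrt (pi *+ 2)).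
apply: (@le_trans _ _ (\int[mu]_(x in D) c%:E)%E).
  rewrite integral_cst//= lebesgue_measure_itv/= lte_fin.
  have [->|dn0] := eqVneq del 0; first by rewrite mulr0 !mul0r addr0 subr0 ltxx mule0.
  rewrite ifT; last by rewrite ltrBlDr -addrA ltrDl -mulr2n pmulrn_lgt0// mulr_gt0// lt_neqAle eq_sym dn0.
  rewrite -EFinD -EFinM lee_fin le_eqVlt /c; apply/orP; left; apply/eqP.
  have sp : 0 < Num.sqrt (pi *+ 2 : R) by rewrite sqrtr_gt0 pmulrn_lgt0// pi_gt0.
  by field; rewrite !gt_eqF.
apply: ge0_le_integral => //=.
- by move=> x _; rewrite lee_fin divr_ge0 ?expR_ge0// mulr_ge0 ?sqrtr_ge0// ltW.
- by apply/measurable_funTS/measurable_EFinP; exact: measurable_normal_pdf.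
move=> x; rewrite /D /= ?in_itv /= => /andP[x1 x2].
rewrite lee_fin normal_pdfE ?gt_eqF// /c /normal_peak -mulrnAr sqrtrM ?sqr_ge0//.
rewrite sqrtr_sqr ger0_norm// mulrC ler_wpM2l ?invr_ge0 ?mulr_ge0 ?sqrtr_ge0//.
rewrite /normal_fun ler_expR subr0.
have -> : - x ^+ 2 / (s ^+ 2 *+ 2) = - (x ^+ 2 / s ^+ 2 / 2) by field; rewrite gt_eqF.
rewrite lerN2 ler_wpM2r ?invr_ge0// ler_pdivrMr ?exprn_gt0// -exprMn.
have : `|x| <= (lam + del) * s.
  rewrite ler_norml; apply/andP; split; last by rewrite mulrDl.
  have := mulr_ge0 l0 s0; nra.
rewrite -(real_normK (num_real x)) => H.
by rewrite ler_pXn2r ?nnegrE ?mulr_ge0 ?addr_ge0.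
Qed.

End centered.
End gaussian_law_facts.

(** * Functions generated by trigonometric polynomials *)
Section trigonometric_closure.
Context {T : Type} {R : realType} (V : set (T -> R)).
Implicit Types (f g F G : T -> R) (A B : set T).

(** The class plays the role of the bounded functions that are measurable for the
    sigma-algebra generated by V: an identity that is linear and stable under
    bounded convergence extends from the trigonometric generators to the whole
    class by induction. *)
Inductive trig_closure : (T -> R) -> Prop :=
| trig_cos f : V f -> trig_closure (fun w => cos (f w))
| trig_sin f : V f -> trig_closure (fun w => sin (f w))
| trig_lin c F G : trig_closure F -> trig_closure G ->
    trig_closure (fun w => c * F w + G w)
| trig_lim (F_ : nat -> T -> R) (F : T -> R) (M : R) : (forall n, trig_closure (F_ n)) ->
    (forall n w, `|F_ n w| <= M) ->
    (forall w, F_ n w @[n --> \oo] --> F w) -> trig_closure F.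

Hypotheses (V0 : V (fun=> 0))
  (VL : forall c f g, V f -> V g -> V (fun w => c * f w + g w)).

Lemma trig_eq F G : trig_closure F -> F =1 G -> trig_closure G.
Proof. by move=> tF /funext <-. Qed.

Lemma trig_closure_bounded F : trig_closure F -> exists M, forall w, `|F w| <= M.
Proof.
elim=> {F} [f _|f _|c F G _ [M FM] _ [K GK]|F_ F M _ _ FM Fl].
- by exists 1 => w; rewrite ler_norml cos_geN1 cos_le1.
- by exists 1 => w; rewrite ler_norml sin_geN1 sin_le1.
- exists (`|c| * M + K) => w; rewrite (le_trans (ler_normD _ _))//.
  by rewrite lerD// normrM ler_wpM2l.
- exists M => w; have nF : `|F_ n w| @[n --> \oo] --> `|F w| by apply: cvg_norm; exact: Fl.
  rewrite -(cvg_lim _ nF)//; apply: limr_le; first by apply/cvg_ex; exists `|F w|.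
  by apply: nearW => n; exact: FM.
Qed.

Lemma trig_cst c : trig_closure (fun=> c).
Proof.
have one : trig_closure (fun=> 1).
  by have := trig_cos V0; rewrite cos0.
have zero : trig_closure (fun=> 0).
  have := trig_lin (-1) one one.
  by under eq_fun do rewrite mulr1 addNr.
have := trig_lin c one zero.
by under eq_fun do rewrite mulr1 addr0.
Qed.

Lemma trig_scale c F : trig_closure F -> trig_closure (fun w => c * F w).
Proof.
move=> tF; have := trig_lin c tF (trig_cst 0).
by under eq_fun do rewrite addr0.
Qed.

Lemma trig_add F G : trig_closure F -> trig_closure G ->
  trig_closure (fun w => F w + G w).
Proof.
move=> tF tG; have := trig_lin 1 tF tG.
by under eq_fun do rewrite mul1r.
Qed.

Lemma trig_mul_lim (F_ : nat -> T -> R) (F G : T -> R) (M : R) : (exists K, forall w, `|G w| <= K) ->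
  (forall n, trig_closure (fun w => F_ n w * G w)) ->
  (forall n w, `|F_ n w| <= M) -> (forall w, F_ n w @[n --> \oo] --> F w) ->
  trig_closure (fun w => F w * G w).
Proof.
move=> [K GK] tFG FM Fl.
apply: (@trig_lim (fun n w => F_ n w * G w) _ (M * K)) => //.
- by move=> n w; rewrite normrM ler_pM.
- by move=> w; apply: cvgM; [exact: Fl|exact: cvg_cst].
Qed.

(** A product of two generators is a linear combination of generators; the
    identity then extends to one factor at a time. *)
Lemma trig_mul F G : trig_closure F -> trig_closure G ->
  trig_closure (fun w => F w * G w).
Proof.
have VD f g : V f -> V g -> V (fun w => f w + g w).
  by move=> Vf Vg; have := VL 1 Vf Vg; under eq_fun do rewrite mul1r.
have VB f g : V f -> V g -> V (fun w => f w - g w).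
  by move=> Vf Vg; have := VL (-1) Vg Vf; under eq_fun do rewrite mulN1r addrC.
have lin2 c F1 F2 H : trig_closure (fun w => F1 w * H w) ->
    trig_closure (fun w => F2 w * H w) ->
    trig_closure (fun w => (c * F1 w + F2 w) * H w).
  move=> t1 t2; have := trig_lin c t1 t2.
  by under eq_fun do rewrite mulrA -mulrDl.
have sym F1 F2 : trig_closure (fun w => F1 w * F2 w) ->
    trig_closure (fun w => F2 w * F1 w).
  by under eq_fun do rewrite mulrC.
have prod f g : V f -> V g ->
    [/\ trig_closure (fun w => cos (f w) * cos (g w)),
        trig_closure (fun w => sin (f w) * sin (g w)),
        trig_closure (fun w => sin (f w) * cos (g w)) &
        trig_closure (fun w => cos (f w) * sin (g w))].
  move=> Vf Vg; have fDg := VD _ _ Vf Vg; have fBg := VB _ _ Vf Vg; split.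
  - have := trig_scale 2^-1 (trig_add (trig_cos fDg) (trig_cos fBg)).
    by move=> h; apply: (trig_eq h) => w; rewrite cosB cosD; field.
  - have := trig_scale 2^-1 (trig_lin (-1) (trig_cos fDg) (trig_cos fBg)).
    by move=> h; apply: (trig_eq h) => w; rewrite cosB cosD; field.
  - have := trig_scale 2^-1 (trig_add (trig_sin fDg) (trig_sin fBg)).
    by move=> h; apply: (trig_eq h) => w; rewrite sinB sinD; field.
  - have := trig_scale 2^-1 (trig_lin (-1) (trig_sin fBg) (trig_sin fDg)).
    by move=> h; apply: (trig_eq h) => w; rewrite sinB sinD; field.
have half F1 : trig_closure F1 -> forall g, V g ->
    trig_closure (fun w => F1 w * cos (g w)) /\
    trig_closure (fun w => F1 w * sin (g w)).
  elim=> {F1} [f Vf|f Vf|c F1 F2 _ IH1 _ IH2|F_ F1 M _ IH FM Fl] g Vg.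
  - by have [] := prod _ _ Vf Vg.
  - by have [] := prod _ _ Vf Vg.
  - have [? ?] := IH1 _ Vg; have [? ?] := IH2 _ Vg; split; exact: lin2.
  - split; apply: (trig_mul_lim _ _ FM Fl).
    + by exists 1 => w; rewrite ler_norml cos_geN1 cos_le1.
    + by move=> n; have [] := IH n _ Vg.
    + by exists 1 => w; rewrite ler_norml sin_geN1 sin_le1.
    + by move=> n; have [] := IH n _ Vg.
move=> tF; elim=> {G} [g Vg|g Vg|c G1 G2 _ IH1 _ IH2|G_ G M _ IH GM Gl].
- by have [] := half _ tF _ Vg.
- by have [] := half _ tF _ Vg.
- by apply/sym/lin2; exact: sym.
- apply/sym; apply: (trig_mul_lim _ _ GM Gl).
  + exact: trig_closure_bounded.
  + by move=> n; exact: sym.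
Qed.

Definition trig_set (A : set T) := trig_closure (\1_A : T -> R).

Lemma trig_setC A : trig_set A -> trig_set (~` A).
Proof.
move=> tA; have := trig_lin (-1) tA (trig_cst 1) => h.
apply: (trig_eq h) => w; rewrite !indicE in_setC.
by case: (w \in A); rewrite /= ?mulr1 ?mulr0 ?addNr ?add0r.
Qed.

Lemma trig_setI A B : trig_set A -> trig_set B -> trig_set (A `&` B).
Proof.
move=> tA tB; have := trig_mul tA tB => h.
by apply: (trig_eq h) => w; rewrite indicI.
Qed.

Lemma trig_setT : trig_set setT.
Proof. by rewrite /trig_set indicT; exact: trig_cst. Qed.

Lemma trig_bigcap (A : nat -> set T) :
  (forall n, trig_set (A n)) -> trig_set (\bigcap_n A n).
Proof.
move=> tA; pose B n := \bigcap_(i in `I_n) A i.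
have tB n : trig_set (B n).
  elim: n => [|n IH]; first by rewrite /B II0 bigcap_set0; exact: trig_setT.
  by rewrite /B IIS bigcap_setU bigcap_set1; exact: trig_setI.
apply: (@trig_lim (fun n => \1_(B n)) _ 1) => //.
- by move=> n w; rewrite indicE; case: (_ \in _); rewrite ?normr1 ?normr0.
- move=> w; apply: (@cvg_near_cst _ _ (\1_(\bigcap_n A n) w : R)).
  have [Aw|] := pselect ((\bigcap_n A n) w).
    near=> n; rewrite !indicE !mem_set// /B => i _; exact: Aw.
  move=> nAw; have [m nm] : exists m, ~ A m w.
    by apply/existsNP => h; apply: nAw => i _; exact: h.
  near=> n; rewrite !indicE !memNset// /B => h; apply/nm/h => /=.
  by near: n; exact: nbhs_infty_gt.
Unshelve. all: end_near. Qed.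

Lemma trig_bigcup (A : nat -> set T) :
  (forall n, trig_set (A n)) -> trig_set (\bigcup_n A n).
Proof.
move=> tA; rewrite -[X in trig_set X]setCK setC_bigcup.
by apply: trig_setC; apply: trig_bigcap => n; exact: trig_setC.
Qed.

Lemma trig_set0 : trig_set set0.
Proof. by rewrite -setCT; apply/trig_setC/trig_setT. Qed.

(** A polynomial map (Newton's iteration for x^2 = 1) whose iterates converge to the
    sign on [-1, 1]; it turns polynomials into indicators. *)
Definition sign_step (x : R) := (3 * x - x ^+ 3) / 2.

Lemma sign_stepN x : sign_step (- x) = - sign_step x.
Proof. by rewrite /sign_step; field. Qed.

(** Towards 1, one step multiplies the error 1 - z by (1 - z) (2 + z) / 2, which is
    at most 1 - y / 2 along the orbit of y in ]0, 1]. *)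
Lemma cvg_sign_step x : `|x| <= 1 -> iter n sign_step x @[n --> \oo] --> Num.sg x.
Proof.
have pos y : 0 < y <= 1 -> iter n sign_step y @[n --> \oo] --> (1:R).
  move=> /andP[y0 y1].
  have H n : y <= iter n sign_step y <= 1 /\
      1 - iter n sign_step y <= (1 - y / 2) ^+ n.
    elim: n => [|n [/andP[a b] c]]; first by rewrite /= lexx y1 expr0 gerBl ltW.
    rewrite /=; set z := iter n sign_step y in a b c *.
    have e1 : 1 - sign_step z = (1 - z) * ((1 - z) * (2 + z) / 2).
      by rewrite /sign_step; field.
    have e2 : sign_step z - z = z * (1 - z) * (1 + z) / 2.
      by rewrite /sign_step; field.
    have z0 : 0 < z by lra.
    have q0 : 0 <= (1 - z) * (2 + z) / 2 by rewrite divr_ge0// mulr_ge0//; lra.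
    have s1 : 0 <= 1 - sign_step z by rewrite e1 mulr_ge0//; lra.
    have s2 : 0 <= sign_step z - z by rewrite e2 divr_ge0// !mulr_ge0//; lra.
    split; first by apply/andP; split; lra.
    rewrite e1 exprSr ler_pM//; first by lra.
    by have := sqr_ge0 z; rewrite expr2; lra.
  have yl : `|1 - y / 2| < 1 by rewrite ltr_norml; apply/andP; split; lra.
  apply: (@squeeze_cvgr _ _ _ _ (fun n => 1 - (1 - y / 2) ^+ n) (fun=> 1)).
  - by apply: nearW => n; have [/andP[_ ->] c] := H n; rewrite andbT lerBlDr -lerBlDl.
  - rewrite -[X in _ --> X]subr0; apply: cvgB; first exact: cvg_cst.
    exact: cvg_expr.
  - exact: cvg_cst.
have iterN n y : iter n sign_step (- y) = - iter n sign_step y.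
  by elim: n => [//|n IH]; rewrite /= IH sign_stepN.
move=> x1; have [x0|x0|->] := ltgtP x 0.
- rewrite ltr0_sg//.
  have -> : (fun n => iter n sign_step x) = (fun n => - iter n sign_step (- x)).
    by apply/funext => n; rewrite iterN opprK.
  by apply: cvgN; apply: pos; rewrite oppr_gt0 x0 -ltr0_norm.
- by rewrite gtr0_sg//; apply: pos; rewrite x0 -(gtr0_norm x0).
- rewrite sgr0.
  have -> : (fun n => iter n sign_step 0) = fun=> 0.
    apply/funext; elim=> [//|n IH]; rewrite /= IH /sign_step.
    by rewrite expr0n/= mulr0 subr0 mul0r.
  exact: cvg_cst.
Qed.

Lemma trig_sg F : trig_closure F -> (forall w, `|F w| <= 1) ->
  trig_closure (fun w => Num.sg (F w)).
Proof.
move=> tF F1.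
have step1 x : `|x| <= 1 -> `|sign_step x| <= 1.
  rewrite !ler_norml /sign_step => /andP[a b]; apply/andP; split.
    have : 0 <= (1 + x) ^+ 2 * (2 - x) by rewrite mulr_ge0 ?sqr_ge0//; lra.
    move=> h; have e : (1 + x) ^+ 2 * (2 - x) = 2 + (3 * x - x ^+ 3) by ring.
    by rewrite e in h; lra.
  have : 0 <= (1 - x) ^+ 2 * (2 + x) by rewrite mulr_ge0 ?sqr_ge0//; lra.
  move=> h; have e : (1 - x) ^+ 2 * (2 + x) = 2 - (3 * x - x ^+ 3) by ring.
  by rewrite e in h; lra.
apply: (@trig_lim (fun n w => iter n sign_step (F w)) _ 1).
- elim=> [//|n tn] /=.
  have t2 := trig_mul tn tn; have t3 := trig_mul t2 tn.
  have := trig_lin (3 / 2) tn (trig_scale (- (1 / 2)) t3).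
  by move=> h; apply: (trig_eq h) => w; rewrite /sign_step; field.
- by move=> n w; elim: n => [|n IH] /=; [exact: F1|exact: step1].
- by move=> w; exact: cvg_sign_step.
Qed.

(** For n large, f - c has the sign of sin ((f - c) / n), and this sine is a linear
    combination of sin (f / n) and cos (f / n). *)
Lemma trig_gt f c : V f -> trig_set [set w | c < f w].
Proof.
move=> Vf; rewrite /trig_set.
have tsg : trig_closure (fun w => Num.sg (f w - c)).
  pose x n w : R := (f w - c) / n.+1%:R.
  apply: (@trig_lim (fun n w => Num.sg (sin (x n w))) _ 1).
  - move=> n; apply: trig_sg; last by move=> w; rewrite ler_norml sin_geN1 sin_le1.
    have Vn : V (fun w => f w / n.+1%:R).
      have := VL n.+1%:R^-1 Vf V0.
      by under eq_fun do rewrite addr0 mulrC.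
    have := trig_lin (cos (c / n.+1%:R)) (trig_sin Vn)
      (trig_scale (- sin (c / n.+1%:R)) (trig_cos Vn)).
    move=> h; apply: (trig_eq h) => w; rewrite /x mulrBl sinB; ring.
  - by move=> n w; rewrite normr_sg lern1 leq_b1.
  - move=> w; apply: (@cvg_near_cst _ _ (Num.sg (f w - c))).
    have pi0 := @pi_gt0 R.
    near=> n.
    have n0 : 0 < n.+1%:R :> R by [].
    have xpi : `|x n w| < pi.
      rewrite /x normrM normfV [X in _ / X]ger0_norm// ltr_pdivrMr//.
      rewrite mulrC -ltr_pdivrMr//.
      apply: (@lt_trans _ _ n%:R); last by rewrite ltr_nat.
      by near: n; exact: nbhs_infty_gtr.
    have sgx : Num.sg (x n w) = Num.sg (f w - c).
      by rewrite /x sgrM [X in _ * X]gtr0_sg ?mulr1 ?invr_gt0.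
    rewrite -sgx; have [xn|xn|->] := ltgtP (x n w) 0.
    + rewrite [in RHS]ltr0_sg// ltr0_sg// -oppr_gt0 -sinN sin_gt0_pi//.
      by rewrite oppr_gt0 xn -(ltr0_norm xn).
    + rewrite [in RHS]gtr0_sg// gtr0_sg// sin_gt0_pi// xn.
      by rewrite -(gtr0_norm xn).
    + by rewrite sin0.
have := trig_scale 2^-1 (trig_add tsg (trig_mul tsg tsg)).
move=> hs; apply: (trig_eq hs) => w; rewrite indicE.
have [h|h] := ltP c (f w).
  by rewrite mem_set// gtr0_sg ?subr_gt0// mulr1 -[1 + 1]/(2%:R) mulVf.
rewrite memNset/=; last by apply/negP; rewrite -leNgt.
move: h; rewrite le_eqVlt => /orP[/eqP ->|h]; first by rewrite subrr sgr0 mulr0 addr0 mulr0.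
by rewrite ltr0_sg ?subr_lt0// mulrN1 opprK addNr mulr0.
Unshelve. all: end_near. Qed.

Lemma trig_lt f c : V f -> trig_set [set w | f w < c].
Proof.
move=> Vf; have := VL (-1) Vf V0; under eq_fun do rewrite mulN1r addr0.
move=> /(@trig_gt _ (- c)); congr trig_set.
by apply/seteqP; split => w /=; rewrite ltrN2.
Qed.

Lemma trig_norm_le f a u : V f -> trig_set [set w | `|f w - a| <= u].
Proof.
move=> Vf; have := trig_setI (trig_setC (trig_gt (a + u) Vf))
  (trig_setC (trig_lt (a - u) Vf)).
congr trig_set; apply/seteqP; split => w /=; rewrite ler_distl.
  by move=> [/negP + /negP]; rewrite -!leNgt => -> ->.
by move=> /andP[h1 h2]; split; apply/negP; rewrite -leNgt.
Qed.

Lemma trig_forall (I : countType) (A : I -> set T) :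
  (forall i, trig_set (A i)) -> trig_set [set w | forall i, A i w].
Proof.
move=> tA; have := @trig_bigcap (fun n => if unpickle n is Some i then A i else setT).
have -> : \bigcap_n (if unpickle n is Some i then A i else setT) =
    [set w | forall i, A i w].
  apply/seteqP; split => w /= h; first by move=> i; have := h (pickle i) Logic.I; rewrite pickleK.
  by move=> n _; case: (unpickle n).
by apply=> n; case: (unpickle n) => [i|]; [exact: tA|exact: trig_setT].
Qed.

Lemma trig_exists (I : countType) (A : I -> set T) :
  (forall i, trig_set (A i)) -> trig_set [set w | exists i, A i w].
Proof.
move=> tA; rewrite -[X in trig_set X]setCK; apply: trig_setC.
have -> : ~` [set w | exists i, A i w] = [set w | forall i, (~` A i) w].
  by apply/seteqP; split => w /=; [move=> /forallNP|move=> h [i]; exact: h].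
by apply: trig_forall => i; exact: trig_setC.
Qed.

(** The sets B that satisfy the conclusion form a sigma-algebra that contains the
    rays. *)
Lemma trig_preimage f (B : set R) : V f -> measurable B -> trig_set (f @^-1` B).
Proof.
move=> Vf; have -> : (measurable : set (set R)) = <<s @RGenOInfty.G R >>.
  exact: RGenOInfty.measurableE.
apply: (@smallest_sub _ _ _ [set B | trig_set (f @^-1` B)]).
- split.
  + by rewrite /= preimage_set0; exact: trig_set0.
  + by move=> A tA; rewrite /= setTD preimage_setC; exact: trig_setC.
  + by move=> A tA; rewrite /= preimage_bigcup; exact: trig_bigcup.
- move=> _ [x ->] /=; have := trig_gt x Vf; congr trig_set.
  by apply/seteqP; split => w /=; rewrite in_itv/= andbT.
Qed.

End trigonometric_closure.

(** * Product identities for expectations *)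
Section trig_closure_integral.
Context d (T : measurableType d) (R : realType) (P : probability T R).
Implicit Types (f g F G : T -> R).

Lemma trig_closure_measurable (V : set (T -> R)) F :
  (forall f, V f -> measurable_fun [set: T] f) ->
  trig_closure V F -> measurable_fun [set: T] F.
Proof.
move=> mV; elim=> {F} [f Vf|f Vf|c F G _ mF _ mG|F_ F M _ mF _ Fl].
- by apply: measurableT_comp; [apply: continuous_measurable_fun; exact: continuous_cos|exact: mV].
- by apply: measurableT_comp; [apply: continuous_measurable_fun; exact: continuous_sin|exact: mV].
- by apply: measurable_funD => //; exact: measurable_funM.
- by apply: (measurable_fun_cvg mF) => w _; exact: Fl.
Qed.

Lemma trig_set_measurable (V : set (T -> R)) A :
  (forall f, V f -> measurable_fun [set: T] f) -> trig_set V A -> measurable A.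
Proof.
move=> mV /(trig_closure_measurable mV) mA.
have -> : A = (\1_A : T -> R) @^-1` [set 1%R].
  apply/seteqP; split => w /=; first by move=> Aw; rewrite indicE mem_set.
  rewrite indicE; case: (boolP (w \in A)) => [/set_mem//|_ /eqP].
  by rewrite eq_sym oner_eq0.
by rewrite -[X in measurable X]setTI; apply: mA.
Qed.

Lemma integrable_bounded_mul F G M : measurable_fun [set: T] F ->
  (forall w, `|F w| <= M) -> P.-integrable [set: T] (EFin \o G) ->
  P.-integrable [set: T] (EFin \o (fun w => F w * G w)).
Proof.
move=> mF FM iG.
have iMG : P.-integrable [set: T] (fun w => M%:E * (G w)%:E)%E by exact: integrableZl.
apply: (le_integrable measurableT) iMG.
- apply/measurable_EFinP; apply: measurable_funM => //.
  by apply/measurable_EFinP; exact: measurable_int iG.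
- move=> w _; rewrite /= !lee_fin !normrM ler_wpM2r// (le_trans (FM w))//.
  exact: ler_norm.
Qed.

Lemma integrable_bounded F M : measurable_fun [set: T] F ->
  (forall w, `|F w| <= M) -> P.-integrable [set: T] (EFin \o F).
Proof.
move=> mF FM; have i1 : P.-integrable [set: T] (EFin \o cst (1:R)).
  by apply: finite_measure_integrable_cst.
have := integrable_bounded_mul mF FM i1.
by apply: eq_integrable => // w _; rewrite /= mulr1.
Qed.

Lemma cvg_Rintegral_bounded_mul (F_ : nat -> T -> R) F G M :
  (forall n, measurable_fun [set: T] (F_ n)) ->
  (forall n w, `|F_ n w| <= M) ->
  (forall w, F_ n w @[n --> \oo] --> F w) ->
  P.-integrable [set: T] (EFin \o G) ->
  \int[P]_w (F_ n w * G w) @[n --> \oo] --> \int[P]_w (F w * G w).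
Proof.
move=> mF FM Fl iG.
have mG : measurable_fun [set: T] G by apply/measurable_EFinP; exact: measurable_int iG.
have mFl : measurable_fun [set: T] F by apply: (measurable_fun_cvg mF) => w _; exact: Fl.
have mFG n : measurable_fun [set: T] (EFin \o (fun w => F_ n w * G w)).
  by apply/measurable_EFinP; exact: measurable_funM.
have mFGl : measurable_fun [set: T] (EFin \o (fun w => F w * G w)).
  by apply/measurable_EFinP; exact: measurable_funM.
have cv : {ae P, forall w, [set: T] w ->
   (EFin \o (fun w => F_ n w * G w)) w @[n --> \oo] --> (EFin \o (fun w => F w * G w)) w}.
  apply: aeW => w _; apply: cvg_EFin; first exact: nearW.
  by apply: cvgM; [exact: Fl|exact: cvg_cst].
have iMG : P.-integrable [set: T] (abse \o (fun w => M%:E * (G w)%:E))%E.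
  by apply: integrable_abse; exact: integrableZl.
have dom : {ae P, forall w n, [set: T] w ->
    (`|(EFin \o (fun w => F_ n w * G w)%R) w| <= (abse \o (fun w => M%:E * (G w)%:E)) w)%E}.
  apply: aeW => w n _; rewrite /= lee_fin !normrM ler_wpM2r// (le_trans (FM n w))//.
  exact: ler_norm.
have [iFG _ dct] := @dominated_convergence _ _ _ P _ measurableT _ _ _ mFG mFGl cv iMG dom.
apply: fine_cvg; rewrite fineK//.
exact: integrable_fin_num iFG.
Qed.

(** Both sides are linear in F and continuous under bounded convergence. *)
Lemma trig_closure_indep (V : set (T -> R)) F G :
  (forall f, V f -> measurable_fun [set: T] f) ->
  P.-integrable [set: T] (EFin \o G) ->
  (forall f, V f ->
    \int[P]_w (cos (f w) * G w) = \int[P]_w cos (f w) * \int[P]_w G w /\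
    \int[P]_w (sin (f w) * G w) = \int[P]_w sin (f w) * \int[P]_w G w) ->
  trig_closure V F ->
  \int[P]_w (F w * G w) = \int[P]_w F w * \int[P]_w G w.
Proof.
move=> mV iG base tF.
elim: tF => {F} [f Vf|f Vf|c F1 F2 tF1 IH1 tF2 IH2|F_ F M tF IH FM Fl].
- by have [] := base _ Vf.
- by have [] := base _ Vf.
- have m1 := trig_closure_measurable mV tF1; have [M1 b1] := trig_closure_bounded tF1.
  have m2 := trig_closure_measurable mV tF2; have [M2 b2] := trig_closure_bounded tF2.
  have i1 := integrable_bounded_mul m1 b1 iG; have i2 := integrable_bounded_mul m2 b2 iG.
  have j1 := integrable_bounded m1 b1; have j2 := integrable_bounded m2 b2.
  have key H1 H2 : P.-integrable [set: T] (EFin \o H1) ->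
      P.-integrable [set: T] (EFin \o H2) ->
      \int[P]_w (c * H1 w + H2 w) = c * \int[P]_w H1 w + \int[P]_w H2 w.
    move=> k1 k2; rewrite RintegralD//; first by rewrite RintegralZl.
    by have := integrableZl measurableT c k1; apply: eq_integrable.
  rewrite key// mulrDl -mulrA -IH1 -IH2 -key//.
  by apply: eq_Rintegral => w _; rewrite mulrDl mulrA.
- have mF n := trig_closure_measurable mV (tF n).
  have l1 := cvg_Rintegral_bounded_mul mF FM Fl iG.
  have i1 : P.-integrable [set: T] (EFin \o cst (1:R)).
    by apply: finite_measure_integrable_cst.
  have l2 := cvg_Rintegral_bounded_mul mF FM Fl i1.
  apply: (cvg_unique _ l1) => //.
  have -> : (fun n => \int[P]_w (F_ n w * G w)) =
      (fun n => \int[P]_w F_ n w * \int[P]_w G w).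
    by apply/funext => n; exact: IH.
  apply: cvgM; last exact: cvg_cst.
  have e H : \int[P]_w (H w * cst 1 w) = \int[P]_w H w.
    by apply: eq_Rintegral => w _; rewrite mulr1.
  have e' : (fun n => \int[P]_w (F_ n w * cst 1 w)) = (fun n => \int[P]_w F_ n w).
    by apply/funext => n; rewrite e.
  by rewrite -e -e'.
Qed.

End trig_closure_integral.

(** * Independence in the Gaussian span of a field *)
Section gaussian_span.
Context d (T : measurableType d) (R : realType) (P : probability T R).
Context (U : Type) (X : U -> {RV P >-> R}).
Hypotheses (gX : gaussian_field X) (cX : centered X).
Implicit Types (f g F G : T -> R) (a b c t : R).

Definition gspan : set (T -> R) :=
  [set f | exists s : seq (R * U), f = fun w => \sum_(p <- s) p.1 * X p.2 w].

Lemma gspan0 : gspan (fun=> 0).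
Proof. by exists [::]; apply/funext => w; rewrite big_nil. Qed.

Lemma gspan_lin c f g : gspan f -> gspan g -> gspan (fun w => c * f w + g w).
Proof.
move=> [s ->] [r ->]; exists ([seq (c * p.1, p.2) | p <- s] ++ r).
apply/funext => w; rewrite big_cat big_map/= mulr_sumr; congr (_ + _).
by apply: eq_bigr => p _; rewrite mulrA.
Qed.

Lemma gspan_scale c f : gspan f -> gspan (fun w => c * f w).
Proof.
by move=> sf; have := gspan_lin c sf gspan0; under eq_fun do rewrite addr0.
Qed.

Lemma gspan_add f g : gspan f -> gspan g -> gspan (fun w => f w + g w).
Proof. by move=> sf /(gspan_lin 1 sf); under eq_fun do rewrite mul1r. Qed.

Lemma gspan_sub f g : gspan f -> gspan g -> gspan (fun w => f w - g w).
Proof. by move=> sf sg; have := gspan_lin (-1) sg sf; under eq_fun do rewrite mulN1r addrC. Qed.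

Lemma gspan_X u : gspan (X u).
Proof. by exists [:: (1, u)]; apply/funext => w; rewrite big_seq1 mul1r. Qed.

Lemma gspan_gaussian f : gspan f -> gaussian_law P f.
Proof.
move=> [s ->]; have := gX (fun i => (tnth (in_tuple s) i).2) (fun i => (tnth (in_tuple s) i).1).
by under eq_fun do rewrite -(big_tnth _ _ s xpredT (fun p : R * U => p.1 * X p.2 _)).
Qed.

Lemma gspan_measurable f : gspan f -> measurable_fun [set: T] f.
Proof.
move=> [s ->]; elim: s => [|p s IH].
  by under eq_fun do rewrite big_nil; exact: measurable_cst.
under eq_fun do rewrite big_cons.
apply: measurable_funD => //; exact: measurable_funM.
Qed.

Lemma gspan_integrable f : gspan f -> P.-integrable [set: T] (EFin \o f).
Proof.
move=> sf; have [m [s [s0 lawf]]] := gspan_gaussian sf.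
apply: (normal_law_integrable (A := 1) (gspan_measurable sf) lawf (@measurable_id _ _ _)) => x.
by have := normr_ge0 x; nra.
Qed.

Lemma gspan_mean f : gspan f -> \int[P]_w f w = 0.
Proof.
move=> [s ->]; elim: s => [|p s IH].
  by under eq_Rintegral do rewrite big_nil; rewrite Rintegral_cst// mul0r.
under eq_Rintegral do rewrite big_cons.
have iX : P.-integrable [set: T] (EFin \o X p.2) by exact/gspan_integrable/gspan_X.
have is_ : P.-integrable [set: T] (EFin \o (fun w => \sum_(p <- s) p.1 * X p.2 w)).
  by apply: gspan_integrable; exists s.
have ipX : P.-integrable [set: T] (EFin \o (fun w => p.1 * X p.2 w)).
  by apply/gspan_integrable/gspan_scale/gspan_X.
rewrite RintegralD// IH addr0 RintegralZl//.
by have := cX p.2; rewrite expectation_def /Rintegral => ->; rewrite mulr0.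
Qed.

Lemma gspan_law f : gspan f -> exists2 s, 0 <= s & normal_law P f 0 s.
Proof.
move=> sf; apply: centered_gaussian_law; first exact: gspan_measurable.
- exact: gspan_gaussian.
- exact: gspan_mean.
Qed.

(** The elements of the Gaussian span are centered, so this is their covariance. *)
Definition gcov f g : R := \int[P]_w (f w * g w).
Definition gstd f : R := Num.sqrt (gcov f f).

Lemma gspan_integrable_sqr f : gspan f ->
  P.-integrable [set: T] (EFin \o (fun w => f w ^+ 2)).
Proof.
move=> sf; have [s s0 lawf] := gspan_law sf.
exact: normal_law_integrable_sqr (gspan_measurable sf) lawf.
Qed.

Lemma gspan_integrable_mul f g : gspan f -> gspan g ->
  P.-integrable [set: T] (EFin \o (fun w => f w * g w)).
Proof.
move=> sf sg.
have i : P.-integrable [set: T] (EFin \o (fun w => f w ^+ 2 + g w ^+ 2)).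
  have := integrableD measurableT (gspan_integrable_sqr sf) (gspan_integrable_sqr sg).
  by apply: eq_integrable.
apply: (le_integrable measurableT) i.
- by apply/measurable_EFinP; apply: measurable_funM; exact: gspan_measurable.
- move=> w _; rewrite /= lee_fin [leRHS]ger0_norm ?addr_ge0 ?sqr_ge0//.
  rewrite ler_norml; apply/andP; split.
    by have := sqr_ge0 (f w + g w); have := sqr_ge0 (f w - g w); nra.
  by have := sqr_ge0 (f w + g w); have := sqr_ge0 (f w - g w); nra.
Qed.

Lemma gcovC f g : gcov f g = gcov g f.
Proof. by apply: eq_Rintegral => w _; rewrite mulrC. Qed.

Lemma gcov_lin c f1 f2 g : gspan f1 -> gspan f2 -> gspan g ->
  gcov (fun w => c * f1 w + f2 w) g = c * gcov f1 g + gcov f2 g.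
Proof.
move=> s1 s2 sg; rewrite /gcov.
have i1 := gspan_integrable_mul s1 sg; have i2 := gspan_integrable_mul s2 sg.
rewrite -RintegralZl// -RintegralD//; last first.
  by have := integrableZl measurableT c i1; apply: eq_integrable.
by apply: eq_Rintegral => w _; ring.
Qed.

Lemma gcov0l g : gcov (fun=> 0) g = 0.
Proof.
by rewrite /gcov; under eq_Rintegral do rewrite mul0r; rewrite Rintegral_cst// mul0r.
Qed.

Lemma gcov_lin_sqr c f g : gspan f -> gspan g ->
  gcov (fun w => c * f w + g w) (fun w => c * f w + g w) =
  c ^+ 2 * gcov f f + 2 * c * gcov f g + gcov g g.
Proof.
move=> sf sg; have sL := gspan_lin c sf sg.
rewrite gcov_lin// [gcov f (fun w => _)]gcovC [gcov g (fun w => _)]gcovC.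
by rewrite !gcov_lin// (gcovC g f); ring.
Qed.

Lemma gcov_ge0 f : 0 <= gcov f f.
Proof. by apply: Rintegral_ge0 => w _; rewrite -expr2 sqr_ge0. Qed.

Lemma gstd_sqr f : gstd f ^+ 2 = gcov f f.
Proof. by rewrite sqr_sqrtr// gcov_ge0. Qed.

Lemma gspan_law_gstd f : gspan f -> normal_law P f 0 (gstd f).
Proof.
move=> sf; have [s s0 lawf] := gspan_law sf.
suff -> : gstd f = s by [].
have mf := gspan_measurable sf.
rewrite /gstd; have -> : gcov f f = s ^+ 2.
  by rewrite -(normal_law_variance mf lawf); apply: eq_Rintegral => w _; rewrite expr2.
by rewrite sqrtr_sqr ger0_norm.
Qed.

Lemma gspan_cos f a : gspan f ->
  \int[P]_w cos (f w + a) = cos a * expR (- (gcov f f / 2)).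
Proof.
move=> sf; have := normal_law_cos (gspan_measurable sf) (gspan_law_gstd sf) a 1.
rewrite expr1n mulr1 gstd_sqr => <-.
by apply: eq_Rintegral => w _; rewrite mul1r.
Qed.

(** The quadratic function t |-> Var (t f + g) is nonnegative. *)
Lemma cauchy_gcov f g : gspan f -> gspan g ->
  gcov f g ^+ 2 <= gcov f f * gcov g g.
Proof.
move=> sf sg.
have key t : 0 <= t ^+ 2 * gcov f f + 2 * t * gcov f g + gcov g g.
  have := gcov_ge0 (fun w => t * f w + g w).
  by rewrite gcov_lin_sqr.
have [f0|f0] := eqVneq (gcov f f) 0.
  have [->|k0] := eqVneq (gcov f g) 0; first by rewrite expr0n/= f0 mul0r.
  (* an affine nonnegative function is constant: this t would give the value - 1 *)
  have := key (- ((gcov g g + 1) / 2 / gcov f g)); rewrite f0 mulr0 add0r.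
  have -> : 2 * - ((gcov g g + 1) / 2 / gcov f g) * gcov f g + gcov g g = -1 by field.
  by rewrite lerNr oppr0 ler10.
have f1 : 0 < gcov f f by rewrite lt_neqAle eq_sym f0 gcov_ge0.
have := key (- (gcov f g / gcov f f)).
have -> : (- (gcov f g / gcov f f)) ^+ 2 * gcov f f +
    2 * - (gcov f g / gcov f f) * gcov f g + gcov g g =
    (gcov f f * gcov g g - gcov f g ^+ 2) / gcov f f by field.
by rewrite pmulr_lge0 ?invr_gt0// subr_ge0.
Qed.

Lemma integrable_cos_gspan f a : gspan f ->
  P.-integrable [set: T] (EFin \o (fun w => cos (f w + a))).
Proof.
move=> sf; apply: (@integrable_bounded _ _ _ _ _ 1).
  apply: measurableT_comp; first by apply: continuous_measurable_fun; exact: continuous_cos.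
  by apply: measurable_funD => //; exact: gspan_measurable.
by move=> w; rewrite ler_norml cos_geN1 cos_le1.
Qed.

(** By the addition formulas the left side is an average of cosines of f + g and
    f - g, two variables with the same variance Var f + Var g. *)
Lemma uncorrelated_cos f g a b : gspan f -> gspan g -> gcov f g = 0 ->
  \int[P]_w (cos (f w + a) * cos (g w + b)) =
  \int[P]_w cos (f w + a) * \int[P]_w cos (g w + b).
Proof.
move=> sf sg fg0.
have sD := gspan_add sf sg; have sB := gspan_sub sf sg.
transitivity (\int[P]_w (2^-1 * cos ((f w + g w) + (a + b)) +
   2^-1 * cos ((f w - g w) + (a - b)))).
  apply: eq_Rintegral => w _.
  have -> : f w + g w + (a + b) = (f w + a) + (g w + b) by ring.
  have -> : f w - g w + (a - b) = (f w + a) - (g w + b) by ring.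
  by rewrite (cosD (f w + a)) (cosB (f w + a)); field.
have iD := integrable_cos_gspan (a + b) sD; have iB := integrable_cos_gspan (a - b) sB.
have iD2 := integrableZl measurableT 2^-1 iD.
have iB2 := integrableZl measurableT 2^-1 iB.
rewrite RintegralD// !RintegralZl// !gspan_cos//.
have vD : gcov (fun w => f w + g w) (fun w => f w + g w) = gcov f f + gcov g g.
  have -> : (fun w => f w + g w) = (fun w => 1 * f w + g w).
    by apply/funext => w; rewrite mul1r.
  by rewrite gcov_lin_sqr// fg0; ring.
have vB : gcov (fun w => f w - g w) (fun w => f w - g w) = gcov f f + gcov g g.
  have -> : (fun w => f w - g w) = (fun w => -1 * g w + f w).
    by apply/funext => w; rewrite mulN1r addrC.
  by rewrite gcov_lin_sqr// (gcovC g f) fg0; ring.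
rewrite vD vB.
have -> : expR (- ((gcov f f + gcov g g) / 2)) =
    expR (- (gcov f f / 2)) * expR (- (gcov g g / 2)).
  by rewrite -expRD; congr expR; field.
by rewrite (cosD a b) (cosB a b); field.
Qed.

(** Uncorrelated families are independent: the identity holds for the generators
    by [uncorrelated_cos] and is extended to F and to G in turn. *)
Lemma uncorrelated_indep (V1 V2 : set (T -> R)) F G :
  V1 `<=` gspan -> V2 `<=` gspan ->
  (forall f g, V1 f -> V2 g -> gcov f g = 0) ->
  trig_closure V1 F -> trig_closure V2 G ->
  \int[P]_w (F w * G w) = \int[P]_w F w * \int[P]_w G w.
Proof.
move=> V1s V2s V12 tF tG.
have mG : measurable_fun [set: T] G.
  by apply: trig_closure_measurable tG => f /V2s; exact: gspan_measurable.
have [M GM] := trig_closure_bounded tG.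
have iG := integrable_bounded P mG GM.
have c1 f (H : T -> R) : \int[P]_w (cos (f w) * H w) = \int[P]_w (cos (f w + 0) * H w).
  by apply: eq_Rintegral => w _; rewrite addr0.
have c2 f : \int[P]_w cos (f w) = \int[P]_w cos (f w + 0).
  by apply: eq_Rintegral => w _; rewrite addr0.
have s1 f (H : T -> R) :
    \int[P]_w (sin (f w) * H w) = \int[P]_w (cos (f w - pi / 2) * H w).
  by apply: eq_Rintegral => w _; rewrite cosBpihalf.
have s2 f : \int[P]_w sin (f w) = \int[P]_w cos (f w - pi / 2).
  by apply: eq_Rintegral => w _; rewrite cosBpihalf.
have phase f a : V1 f -> \int[P]_w (cos (f w + a) * G w) =
    \int[P]_w cos (f w + a) * \int[P]_w G w.
  move=> Vf; transitivity (\int[P]_w (G w * cos (f w + a))).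
    by apply: eq_Rintegral => w _; rewrite mulrC.
  rewrite mulrC; apply: (trig_closure_indep _ _ _ tG).
  - by move=> g /V2s; exact: gspan_measurable.
  - exact/integrable_cos_gspan/V1s.
  - move=> g Vg; have gf0 : gcov g f = 0 by rewrite gcovC V12.
    have sf := V1s _ Vf; have sg := V2s _ Vg.
    by split; [rewrite c1 c2|rewrite s1 s2]; exact: uncorrelated_cos.
apply: (trig_closure_indep _ iG _ tF).
- by move=> g /V1s; exact: gspan_measurable.
- by move=> f Vf; split; [rewrite c1 c2|rewrite s1 s2]; exact: phase.
Qed.

End gaussian_span.

(** * The sine near the origin *)
Section sine_linearization.
Context {R : realType}.
Implicit Types x y : R.

Lemma norm_le_of_derive_le1 (f df : R -> R) : (forall x, is_derive x 1 f (df x)) ->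
  (forall x, `|df x| <= 1) -> f 0 = 0 -> forall x, `|f x| <= `|x|.
Proof.
move=> dfE df1 f0 x.
have cf (a b : R) : {within `[a, b], continuous f}.
  apply: continuous_subspaceT => z.
  by apply/differentiable_continuous/derivable1_diffP; case: (dfE z).
have [x0|x0|->] := ltgtP x 0; last by rewrite f0.
- have [c _] := MVT x0 (fun z _ => dfE z) (cf _ _).
  rewrite f0 sub0r => /(congr1 Num.norm); rewrite normrN => ->.
  by rewrite sub0r normrM normrN ler_piMl.
- have [c _] := MVT x0 (fun z _ => dfE z) (cf _ _).
  by rewrite f0 !subr0 => ->; rewrite normrM ler_piMl.
Qed.

Lemma norm_sin_le x : `|sin x| <= `|x|.
Proof.
apply: (@norm_le_of_derive_le1 sin cos) => [y|]; last exact: sin0.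
by rewrite ler_norml cos_geN1 cos_le1.
Qed.

Lemma norm_1Bcos_le x : `|1 - cos x| <= `|x|.
Proof.
apply: (@norm_le_of_derive_le1 (fun y => 1 - cos y) sin) => [y||].
- by apply: is_derive_eq; ring.
- by move=> y; rewrite ler_norml sin_geN1 sin_le1.
- by rewrite cos0 subrr.
Qed.

(** The mean value theorem for the sine between 0 and x. *)
Lemma sin_mvt x : exists2 c, `|c| <= `|x| & sin x = cos c * x.
Proof.
have cf (a b : R) : {within `[a, b], continuous (@sin R)}.
  by apply: continuous_subspaceT => z; exact: continuous_sin.
have [x0|x0|->] := ltgtP x 0; last by exists 0; rewrite ?sin0 ?mulr0.
- have [c] := MVT x0 (fun z _ => is_derive_sin z) (cf _ _).
  rewrite in_itv/= => /andP[c1 c2]; rewrite sin0 => e; exists c.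
    by rewrite !ltr0_norm ?lerN2 ?ltW.
  by move: e; rewrite !sub0r mulrN => /oppr_inj.
- have [c] := MVT x0 (fun z _ => is_derive_sin z) (cf _ _).
  rewrite in_itv/= => /andP[c1 c2]; rewrite sin0 !subr0 => e; exists c => //.
  by rewrite !gtr0_norm ?ltW.
Qed.

Lemma cvg_sin_linear x : n.+1%:R * sin (x / n.+1%:R) @[n --> \oo] --> x.
Proof.
apply/subr_cvg0.
apply: (@squeeze_cvgr _ _ _ _ (fun n => - (x ^+ 2 * n.+1%:R^-1))
  (fun n => x ^+ 2 * n.+1%:R^-1)).
- apply: nearW => n; rewrite -ler_norml.
  have [c cx ->] := sin_mvt (x / n.+1%:R).
  have -> : n.+1%:R * (cos c * (x / n.+1%:R)) - x = - (x * (1 - cos c)).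
    have : n.+1%:R != 0 :> R by [].
    by move: (n.+1%:R : R) => k k0; field.
  rewrite normrN normrM (le_trans (ler_wpM2l (normr_ge0 _) (norm_1Bcos_le c)))//.
  rewrite (le_trans (ler_wpM2l (normr_ge0 _) cx))// normrM mulrA -normrM -expr2.
  by rewrite !ger0_norm ?sqr_ge0// invr_ge0.
- by rewrite -oppr0; apply: cvgN; rewrite -(mulr0 (x ^+ 2)); apply: cvgMr; exact: cvg_harmonic.
- by rewrite -(mulr0 (x ^+ 2)); apply: cvgMr; exact: cvg_harmonic.
Qed.

End sine_linearization.

(** * A zero-one law and a small ball inequality *)
Section gaussian_consequences.
Context d (T : measurableType d) (R : realType) (P : probability T R).
Context (U : Type) (X : U -> {RV P >-> R}).
Hypotheses (gX : gaussian_field X) (cX : centered X).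
Implicit Types (f g F G : T -> R) (a b c t : R).
Local Notation gspan := (gspan X).
Local Notation gcov := (gcov P).

Lemma Rintegral_indic (A : set T) : measurable A -> \int[P]_w \1_A w = fine (P A).
Proof. by move=> mA; rewrite /Rintegral integral_indic// setIT. Qed.

(** For every f of the span, A is determined by variables orthogonal to f, so its
    indicator is uncorrelated with cos f and sin f. These generate everything that
    is determined by the span, in particular the indicator of A itself. *)
Lemma gaussian_zero_one (A : set T) : trig_set gspan A ->
  (forall f, gspan f -> trig_set [set g | gspan g /\ gcov g f = 0] A) ->
  P A = 0%E \/ P A = 1%E.
Proof.
move=> tA tperp.
have mspan f : gspan f -> measurable_fun [set: T] f by exact: gspan_measurable.
have mA : measurable A := trig_set_measurable mspan tA.
have mI := trig_closure_measurable mspan tA.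
have [M MI] := trig_closure_bounded tA.
have iA := integrable_bounded P mI MI.
have : \int[P]_w (\1_A w * \1_A w) = \int[P]_w \1_A w * \int[P]_w \1_A w.
  apply: (trig_closure_indep mspan iA _ tA) => f sf.
  have V1 : [set f] `<=` gspan by move=> _ ->.
  have V2 : [set g | gspan g /\ gcov g f = 0] `<=` gspan by move=> g [].
  have V12 g h : [set f] g -> [set h | gspan h /\ gcov h f = 0] h -> gcov g h = 0.
    by move=> -> [_]; rewrite gcovC.
  by split; apply: (uncorrelated_indep gX cX V1 V2 V12 _ (tperp _ sf));
    [exact: trig_cos|exact: trig_sin].
have -> : \int[P]_w (\1_A w * \1_A w) = \int[P]_w \1_A w.
  apply: eq_Rintegral => w _; rewrite indicE.
  by case: (_ \in _); rewrite ?mulr1 ?mulr0.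
rewrite Rintegral_indic// => /eqP; rewrite -subr_eq0 -{1}[fine _]mulr1 -mulrBr.
have PA : P A = (fine (P A))%:E by rewrite fineK// fin_num_measure.
rewrite mulf_eq0 subr_eq0 => /orP[/eqP|/eqP] e; [left|right]; rewrite PA.
  by rewrite e.
by rewrite -e.
Qed.

Lemma uncorrelated_indep_set (V1 V2 : set (T -> R)) (A B : set T) :
  V1 `<=` gspan -> V2 `<=` gspan ->
  (forall f g, V1 f -> V2 g -> gcov f g = 0) ->
  trig_set V1 A -> trig_set V2 B ->
  fine (P (A `&` B)) = fine (P A) * fine (P B).
Proof.
move=> V1s V2s V12 tA tB.
have m1 f : V1 f -> measurable_fun [set: T] f by move=> /V1s; exact: gspan_measurable.
have m2 f : V2 f -> measurable_fun [set: T] f by move=> /V2s; exact: gspan_measurable.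
have mA := trig_set_measurable m1 tA; have mB := trig_set_measurable m2 tB.
rewrite -!Rintegral_indic//; last exact: measurableI.
rewrite -(uncorrelated_indep gX cX V1s V2s V12 tA tB).
by apply: eq_Rintegral => w _; rewrite indicI.
Qed.

(** The variables Z_i = Y_i - gcov (Y_i) (Y_j) Y_j are independent of Y_j and are
    bounded by 2 u as soon as all |Y_i| <= u. Hence the event
    |Y_j - lam| <= u, |Z_i| <= 2 u for all i has at least the probability of
    |Y_j - lam| <= u times that of the small ball. For different j these events
    are disjoint: on the j-th one Y_j >= lam - u, whereas Y_i is at most
    r (lam + u) + 2 u for i != j. *)
Lemma small_ball_packing (n : nat) (Y : 'I_n -> T -> R) (r lam u : R) :
  (forall i, gspan (Y i)) -> (forall i, gcov (Y i) (Y i) = 1) ->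
  (forall i j, i != j -> `|gcov (Y i) (Y j)| <= r) ->
  0 <= r <= 1 -> 0 <= lam -> 0 <= u -> 4 * u < (1 - r) * lam ->
  n%:R * (2 * u * (expR (- ((lam + u) ^+ 2 / 2)) / Num.sqrt (pi *+ 2))) *
    fine (P [set w | forall i, `|Y i w| <= u]) <= 1.
Proof.
move=> sY vY rY /andP[r0 r1] lam0 u0 sep.
set p := 2 * u * _; pose B := [set w | forall i, `|Y i w| <= u].
pose Z j i w := Y i w - gcov (Y i) (Y j) * Y j w.
have sZ j i : gspan (Z j i).
  by have := gspan_lin (- gcov (Y i) (Y j)) (sY j) (sY i);
    congr gspan; apply/funext => w; rewrite /Z; ring.
have Zperp j i : gcov (Z j i) (Y j) = 0.
  transitivity (gcov (fun w => - gcov (Y i) (Y j) * Y j w + Y i w) (Y j)).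
    by congr gcov; apply/funext => w; rewrite /Z; ring.
  by rewrite (gcov_lin gX cX)// vY; ring.
pose A j := [set w | `|Y j w - lam| <= u].
pose D j := [set w | forall i, `|Z j i w - 0| <= 2 * u].
pose V1 j := [set f | exists c, f = fun w => c * Y j w].
pose V2 j := [set g | gspan g /\ gcov g (Y j) = 0].
have V1s j : V1 j `<=` gspan by move=> _ [c ->]; exact: gspan_scale.
have V2s j : V2 j `<=` gspan by move=> g [].
have V12 j f g : V1 j f -> V2 j g -> gcov f g = 0.
  move=> [c ->] [sg g0].
  have := gcov_lin gX cX c (sY j) (gspan0 X) sg.
  rewrite gcov0l addr0 [gcov (Y j) g]gcovC g0 mulr0 => <-.
  by congr gcov; apply/funext => w; rewrite addr0.
have V10 j : V1 j (fun=> 0) by exists 0; apply/funext => w; rewrite mul0r.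
have V20 j : V2 j (fun=> 0) by split; [exact: gspan0|exact: gcov0l].
have V1L j c f g : V1 j f -> V1 j g -> V1 j (fun w => c * f w + g w).
  by move=> [a ->] [b ->]; exists (c * a + b); apply/funext => w; ring.
have V2L j c f g : V2 j f -> V2 j g -> V2 j (fun w => c * f w + g w).
  move=> [sf f0] [sg g0]; split; first exact: gspan_lin.
  by rewrite (gcov_lin gX cX)// f0 g0 mulr0 addr0.
have tA j : trig_set (V1 j) (A j).
  apply: (trig_norm_le (V10 j) (V1L j)).
  by exists 1; apply/funext => w; rewrite mul1r.
have tD j : trig_set (V2 j) (D j).
  apply: (trig_forall (V20 j) (V2L j)) => i.
  by apply: (trig_norm_le (V20 j) (V2L j)); split; [exact: sZ|exact: Zperp].
have mspan f : gspan f -> measurable_fun [set: T] f by exact: gspan_measurable.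
have mA j : measurable (A j).
  by apply: trig_set_measurable (tA j) => f /V1s; exact: gspan_measurable.
have mD j : measurable (D j).
  by apply: trig_set_measurable (tD j) => f /V2s; exact: gspan_measurable.
have mB : measurable B.
  have t0 := gspan0 X; have tL := @gspan_lin _ _ _ P _ X.
  apply: (trig_set_measurable mspan); apply: (trig_forall t0 tL) => i.
  have := trig_norm_le t0 tL 0 u (sY i); congr trig_set.
  by apply/seteqP; split => w /=; rewrite subr0.
have PAge j : p <= fine (P (A j)).
  have std1 : gstd P (Y j) = 1 by rewrite /gstd vY sqrtr1.
  have law1 : normal_law P (Y j) 0 1 by rewrite -std1; exact: gspan_law_gstd.
  have := normal_law_near ler01 law1 ltr01 lam0 u0.
  have -> : [set w | `|Y j w - lam * 1| <= u * 1] = A j by rewrite !mulr1.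
  by rewrite -lee_fin fineK// fin_num_measure.
have BD j : B `<=` D j.
  move=> w Bw i /=; rewrite subr0 /Z.
  have cij : `|gcov (Y i) (Y j)| <= 1.
    have [->|ij] := eqVneq i j; first by rewrite vY normr1.
    by rewrite (le_trans (rY _ _ ij)).
  rewrite (le_trans (ler_normB _ _))// mulr2n mulrDl mul1r lerD//.
  by rewrite normrM (le_trans _ (Bw j))// ler_piMl.
have PBD j : fine (P B) <= fine (P (D j)).
  by rewrite fine_le ?fin_num_measure// le_measure ?inE.
have p0 : 0 <= p.
  by rewrite /p !mulr_ge0 ?invr_ge0 ?sqrtr_ge0 ?expR_ge0.
have PAD j : p * fine (P B) <= fine (P (A j `&` D j)).
  rewrite (uncorrelated_indep_set (V1s j) (V2s j) (V12 j) (tA j) (tD j)).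
  by rewrite ler_pM ?fine_ge0.
have disj : trivIset [set: 'I_n] (fun j => A j `&` D j).
  apply/trivIsetP => i j _ _ ij; apply/seteqP; split => // w /= [[Ai Di] [Aj Dj]].
  have := rY i j ij; rewrite ler_norml => /andP[c1 c2].
  move: Ai Aj (Dj i); rewrite /A /= !ler_distl /Z => /andP[i1 i2] /andP[j1 j2].
  rewrite sub0r add0r => /andP[d1 d2].
  have ru : r * u <= u by rewrite ler_piMl.
  suff : gcov (Y i) (Y j) * Y j w <= r * (lam + u) by lra.
  have rlam : 0 <= r * lam by rewrite mulr_ge0.
  have Yj0 : 0 <= Y j w by lra.
  by rewrite (le_trans (ler_wpM2r Yj0 c2))// ler_wpM2l.
have sum1 : (\sum_(j < n) P (A j `&` D j) <= 1)%E.
  rewrite -measure_bigsetU_ord//; last by move=> j; exact: measurableI.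
  by apply: probability_le1; apply: bigsetU_measurable => j _; exact: measurableI.
rewrite -mulrA; apply: (@le_trans _ _ (\sum_(j < n) fine (P (A j `&` D j)))).
  have -> : n%:R * (p * fine (P B)) = \sum_(j < n) (p * fine (P B)).
    by rewrite sumr_const card_ord mulr_natl.
  exact: ler_sum.
rewrite -lee_fin -sumEFin; apply: le_trans sum1.
by apply: lee_sum => j _; rewrite fineK// fin_num_measure//; exact: measurableI.
Qed.

End gaussian_consequences.

(** * Conditional variance and correlation *)
Section conditional_variance.
Context d (T : measurableType d) (R : realType) (P : probability T R).
Context (U : Type) (X : U -> {RV P >-> R}).
Hypotheses (gX : gaussian_field X) (cX : centered X).
Implicit Types (f g F G : T -> R) (a b c t : R).
Local Notation gspan := (gspan X).
Local Notation gcov := (gcov P).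

(** The bounded variables (n + 1) sin (f / (n + 1)) satisfy the identity by
    [uncorrelated_cos] and converge to f. *)
Lemma uncorrelated_cos_id f g b : gspan f -> gspan g -> gcov g f = 0 ->
  \int[P]_w (cos (g w + b) * f w) = 0.
Proof.
move=> sf sg gf0.
have mf := gspan_measurable sf.
have mcos : measurable_fun [set: T] (fun w => cos (g w + b)).
  apply: measurableT_comp; first by apply: continuous_measurable_fun; exact: continuous_cos.
  by apply: measurable_funD => //; exact: (gspan_measurable sg).
pose h n w := cos (g w + b) * (n.+1%:R * sin (f w / n.+1%:R)).
have cos1 x : `|cos x| <= 1 :> R by rewrite ler_norml cos_geN1 cos_le1.
have h0 n : \int[P]_w h n w = 0.
  have sfn : gspan (fun w => n.+1%:R^-1 * f w) by exact: gspan_scale.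
  have gfn0 : gcov g (fun w => n.+1%:R^-1 * f w) = 0.
    have := gcov_lin gX cX n.+1%:R^-1 sf (gspan0 X) sg.
    rewrite gcov0l addr0 [gcov f g]gcovC gf0 mulr0 => <-; rewrite gcovC.
    by congr gcov; apply/funext => w; rewrite addr0.
  have e := uncorrelated_cos gX cX b (- (pi / 2)) sg sfn gfn0.
  rewrite (gspan_cos gX cX (- (pi / 2)) sfn) cosN cos_pihalf mul0r mulr0 in e.
  transitivity (n.+1%:R * \int[P]_w (cos (g w + b) * cos (n.+1%:R^-1 * f w - pi / 2))).
    rewrite -RintegralZl//.
      apply: eq_Rintegral => w _; rewrite cosBpihalf /h mulrCA.
      by rewrite [n.+1%:R^-1 * _]mulrC.
    apply: (integrable_bounded_mul mcos (M := 1)) => //.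
    exact: (integrable_cos_gspan _ sfn).
  by rewrite e mulr0.
have mh n : measurable_fun [set: T] (EFin \o h n).
  apply/measurable_EFinP; apply: measurable_funM => //; apply: measurable_funM => //.
  apply: measurableT_comp; first by apply: continuous_measurable_fun; exact: continuous_sin.
  exact: measurable_funM.
have mcf : measurable_fun [set: T] (EFin \o (fun w => cos (g w + b) * f w)).
  by apply/measurable_EFinP; exact: measurable_funM.
have cv : {ae P, forall w, [set: T] w ->
    (EFin \o h n) w @[n --> \oo] --> (EFin \o (fun w => cos (g w + b) * f w)) w}.
  apply: aeW => w _; apply: cvg_EFin; first exact: nearW.
  by apply: cvgM; [exact: cvg_cst|exact: cvg_sin_linear].
have iaf : P.-integrable [set: T] (abse \o (EFin \o f)).
  by apply: integrable_abse; exact: (gspan_integrable gX).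
have dom : {ae P, forall w n, [set: T] w ->
    (`|(EFin \o h n) w| <= (abse \o (EFin \o f)) w)%E}.
  apply: aeW => w n _; rewrite /= lee_fin /h normrM.
  rewrite (@le_trans _ _ `|n.+1%:R * sin (f w / n.+1%:R)|)//.
    by rewrite ler_piMl.
  rewrite normrM (le_trans (ler_wpM2l (normr_ge0 _) (norm_sin_le _)))//.
  by rewrite -normrM mulrCA divff ?mulr1// pnatr_eq0.
have [_ _ dct] := @dominated_convergence _ _ _ P _ measurableT _ _ _ mh mcf cv iaf dom.
rewrite /Rintegral; suff -> : (\int[P]_w (cos (g w + b) * f w)%:E = 0)%E by [].
have hE n : (\int[P]_w (h n w)%:E = 0)%E.
  rewrite -[LHS]fineK; first by have := h0 n; rewrite /Rintegral => ->.
  apply: integrable_fin_num => //.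
  apply: (le_integrable measurableT (mh n) _ iaf) => w _.
  rewrite /= lee_fin /h normrM [leRHS]ger0_norm//.
  rewrite (@le_trans _ _ `|n.+1%:R * sin (f w / n.+1%:R)|)//.
    by rewrite ler_piMl.
  rewrite normrM (le_trans (ler_wpM2l (normr_ge0 _) (norm_sin_le _)))//.
  by rewrite -normrM mulrCA divff ?mulr1// pnatr_eq0.
apply: (cvg_unique _ dct) => //.
have -> : [sequence (\int[P]_w (EFin \o h n) w)%E]_n = (fun=> 0%E).
  by apply/funext => n; exact: hE.
exact: cvg_cst.
Qed.

Lemma uncorrelated_preimage f g (A : set T) : gspan f -> gspan g -> gcov g f = 0 ->
  g_sigma_algebra_preimage g A -> \int[P]_w (\1_A w * f w) = 0.
Proof.
move=> sf sg gf0 [B mB <-]; rewrite setTI.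
pose V := [set h : T -> R | exists c, h = fun w => c * g w].
have Vs : V `<=` gspan by move=> _ [c ->]; exact: gspan_scale.
have V0 : V (fun=> 0) by exists 0; apply/funext => w; rewrite mul0r.
have VL c h1 h2 : V h1 -> V h2 -> V (fun w => c * h1 w + h2 w).
  by move=> [a ->] [b ->]; exists (c * a + b); apply/funext => w; ring.
have Vg : V g by exists 1; apply/funext => w; rewrite mul1r.
have mV h : V h -> measurable_fun [set: T] h by move=> /Vs; exact: gspan_measurable.
rewrite (trig_closure_indep mV (gspan_integrable gX sf) _ (trig_preimage V0 VL Vg mB)).
  by rewrite (gspan_mean gX cX sf) mulr0.
move=> h Vh; have sh := Vs _ Vh; rewrite (gspan_mean gX cX sf) !mulr0.
have hf0 : gcov h f = 0.
  move: Vh => [c ->]; have := gcov_lin gX cX c sg (gspan0 X) sf.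
  rewrite gcov0l gf0 mulr0 addr0 => <-.
  by congr gcov; apply/funext => w; rewrite addr0.
split.
  rewrite -(uncorrelated_cos_id 0 sf sh hf0).
  by apply: eq_Rintegral => w _; rewrite addr0.
rewrite -(uncorrelated_cos_id (- (pi / 2)) sf sh hf0).
by apply: eq_Rintegral => w _; rewrite cosBpihalf.
Qed.

(** The residual f - b g, with b the regression coefficient, is centered and
    independent of g. So M and b g have the same integral over every event of
    sigma(g), in particular over M > b g and over M < b g. *)
Lemma cond_exp_regression f g (M : T -> R) : gspan f -> gspan g -> gcov g g != 0 ->
  is_cond_exp P f g M ->
  {ae P, forall w, M w = gcov f g / gcov g g * g w}.
Proof.
move=> sf sg g0 [_ iM mM eM].
pose b := gcov f g / gcov g g; pose r w := (- b) * g w + f w.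
have sr : gspan r by exact: gspan_lin.
have gr0 : gcov g r = 0.
  rewrite gcovC (gcov_lin gX cX)// /b; field; exact: g0.
have ig := gspan_integrable gX sg; have if_ := gspan_integrable gX sf.
have ir := gspan_integrable gX sr.
pose D w := M w - b * g w.
have iD : P.-integrable [set: T] (EFin \o D).
  have := integrableB measurableT iM (integrableZl measurableT b ig).
  by apply: eq_integrable => // w _.
pose Tg := g_sigma_algebra_preimageType g.
have mgg : measurable_fun [set: Tg] (g : Tg -> R).
  by move=> _ B mB; rewrite setTI; exists B => //; rewrite setTI.
have mMg : measurable_fun [set: Tg] (M : Tg -> R).
  by move=> _ B mB; rewrite setTI; exact: mM.
have mDg : measurable_fun [set: Tg] (D : Tg -> R).
  by apply: measurable_funB => //; exact: measurable_funM.
have D0 (B : set R) : measurable B -> \int[P]_w (\1_(D @^-1` B) w * D w) = 0.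
  move=> mB; set A := D @^-1` B.
  have sA : g_sigma_algebra_preimage g A.
    by have := mDg measurableT B mB; rewrite setTI.
  have mA : measurable A.
    case: sA => C mC <-; exact: (gspan_measurable sg).
  have indE h : \int[P]_w (\1_A w * h w) = fine (\int[P]_(w in A) (h w)%:E)%E.
    rewrite /Rintegral [in RHS]integral_mkcond; congr fine; apply: eq_integral => w _.
    by rewrite patchE indicE; case: (w \in A); rewrite /= ?mul1r ?mul0r.
  have iI h : P.-integrable [set: T] (EFin \o h) ->
      P.-integrable [set: T] (EFin \o (fun w => \1_A w * h w)).
    apply: (integrable_bounded_mul (M := 1)); first exact: measurable_indic.
    by move=> w; rewrite indicE; case: (_ \in _); rewrite ?normr1 ?normr0.
  transitivity (\int[P]_w (\1_A w * M w) - \int[P]_w (\1_A w * f w) +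
    \int[P]_w (\1_A w * r w)).
    rewrite -RintegralB//; [|exact: iI..].
    rewrite -RintegralD//; last 2 first.
    - have := integrableB measurableT (iI _ iM) (iI _ if_).
      by apply: eq_integrable.
    - exact: iI.
    by apply: eq_Rintegral => w _; rewrite /D /r; ring.
  by rewrite (uncorrelated_preimage sr sg gr0 sA) !indE eM// subrr addr0.
have absD : (\int[P]_w `|(EFin \o D) w| = 0)%E.
  pose Bp : set R := `]0, +oo[%classic; pose Bn : set R := `]-oo, 0[%classic.
  have mBp : measurable Bp by exact: measurable_itv.
  have mBn : measurable Bn by exact: measurable_itv.
  have mD : measurable_fun [set: T] D by apply/measurable_EFinP; exact: measurable_int iD.
  have iI (B : set R) : measurable B -> P.-integrable [set: T]
      (EFin \o (fun w => \1_(D @^-1` B) w * D w)).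
    move=> mB; apply: (integrable_bounded_mul (M := 1)) iD.
      by apply: measurable_indic; rewrite -[X in measurable X]setTI; exact: mD.
    by move=> w; rewrite indicE; case: (_ \in _); rewrite ?normr1 ?normr0.
  have : \int[P]_w `|D w| = 0.
    transitivity (\int[P]_w (\1_(D @^-1` Bp) w * D w) -
        \int[P]_w (\1_(D @^-1` Bn) w * D w)).
      rewrite -RintegralB//; [|exact: iI..].
      apply: eq_Rintegral => w _; rewrite !indicE /Bp /Bn.
      have [Dw|Dw|Dw] := ltgtP (D w) 0.
      + rewrite memNset; last by rewrite /= in_itv/= andbT; apply/negP; rewrite -leNgt ltW.
        by rewrite mem_set/= ?in_itv/= ?Dw// mul0r mul1r sub0r ltr0_norm.
      + rewrite mem_set/= ?in_itv/= ?Dw//.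
        rewrite memNset; last by rewrite /= in_itv/=; apply/negP; rewrite -leNgt ltW.
        by rewrite mul0r mul1r subr0 gtr0_norm.
      + by rewrite Dw !mulr0 subr0 normr0.
    by rewrite !D0// subr0.
  rewrite /Rintegral => e; rewrite -[LHS]fineK//.
    by rewrite (_ : fine _ = 0).
  by apply: integrable_fin_num => //; exact: integrable_abse iD.
have mED : measurable_fun [set: T] (EFin \o D) by exact: measurable_int iD.
have := (ae_eq_integral_abs P measurableT mED).1 absD.
apply: filterS => w /(_ Logic.I) /= [] /eqP.
by rewrite subr_eq0 => /eqP.
Qed.

(** The lower bound excludes the default value of [cond_var], so a constant version
    of the conditional variance exists; by [cond_exp_regression] it is the variance
    of the residual of the linear regression of f on g. *)
Lemma cond_var_correlation f g C0 : gspan f -> gspan g ->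
  0 < C0 -> gcov f f != 0 -> gcov g g != 0 ->
  C0 * gcov f f <= cond_var P f g ->
  gcov f g ^+ 2 <= (1 - C0) * gcov f f * gcov g g.
Proof.
move=> sf sg C00 f0 g0 h.
have f1 : 0 < gcov f f by rewrite lt_neqAle eq_sym f0 gcov_ge0.
have g1 : 0 < gcov g g by rewrite lt_neqAle eq_sym g0 gcov_ge0.
move: h; rewrite /cond_var; case: xgetP => [v _ [M ceM ceV]|_]; last first.
  by move=> h; exfalso; have := mulr_gt0 C00 f1; lra.
move=> C0v; suff vE : v = gcov f f - gcov f g ^+ 2 / gcov g g.
  move: C0v; rewrite vE lerBrDr -lerBrDl ler_pdivrMr//.
  have -> : (gcov f f - C0 * gcov f f) * gcov g g = (1 - C0) * gcov f f * gcov g g by ring.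
  by [].
have aeM := cond_exp_regression sf sg g0 ceM.
case: ceV => iY iv _ /(_ setT) eV.
have {}eV : \int[P]_w v = \int[P]_w ((f w - M w) ^+ 2).
  rewrite /Rintegral; congr fine; apply: eV.
  by exists setT => //; rewrite setTI preimage_setT.
have -> : v = \int[P]_w v.
  rewrite Rintegral_cst// (_ : fine _ = 1) ?mulr1//.
  by apply: (congr1 fine (probability_setT P)).
set b := gcov f g / gcov g g in aeM.
pose r w := (- b) * g w + f w.
have sr : gspan r by exact: gspan_lin.
have ir2 := gspan_integrable_sqr gX cX sr.
have -> : \int[P]_w v = \int[P]_w (r w ^+ 2).
  rewrite eV /Rintegral; congr fine; apply: ae_eq_integral => //.
  - exact: measurable_int iY.
  - exact: measurable_int ir2.
  - apply: filterS aeM => w Mw _; rewrite Mw /r; congr (EFin (_ ^+ 2)); ring.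
have -> : \int[P]_w (r w ^+ 2) = gcov r r.
  by apply: eq_Rintegral => w _; rewrite expr2.
rewrite /r (gcov_lin_sqr gX cX)// [gcov g f]gcovC /b; field; exact: g0.
Qed.

End conditional_variance.

(** * Euclidean norm and dyadic grids *)
Section euclidean_norm.
Context {R : realType} {N : nat}.
Implicit Types x y z : 'rV[R]_N.

Lemma enorm_ge0 x : 0 <= enorm x.
Proof. exact: sqrtr_ge0. Qed.

Lemma enorm_sqr x : enorm x ^+ 2 = \sum_(i < N) x 0 i ^+ 2.
Proof. by rewrite sqr_sqrtr// sumr_ge0// => i _; exact: sqr_ge0. Qed.

Lemma coord_le_enorm x i : `|x 0 i| <= enorm x.
Proof.
rewrite -(ler_pXn2r (ltn0Sn 1)) ?nnegrE ?enorm_ge0// enorm_sqr real_normK ?num_real//.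
by rewrite (bigD1 i)//= lerDl sumr_ge0// => j _; exact: sqr_ge0.
Qed.

Lemma norm_le_enorm x : `|x| <= enorm x.
Proof.
rewrite [leLHS]mx_normrE; apply: bigmax_le; first exact: enorm_ge0.
by move=> [i j] _ /=; rewrite (ord1 i); exact: coord_le_enorm.
Qed.

Lemma enorm_monotone x y : (forall i, `|x 0 i| <= `|y 0 i|) -> enorm x <= enorm y.
Proof.
move=> xy; rewrite ler_wsqrtr// ler_sum// => i _.
by rewrite -[leLHS]real_normK ?num_real// -[leRHS]real_normK ?num_real// ler_pXn2r ?nnegrE.
Qed.

Lemma enormZ (c : R) x : enorm (c *: x) = `|c| * enorm x.
Proof.
rewrite /enorm -sqrtr_sqr -sqrtrM ?sqr_ge0//; congr Num.sqrt.
by rewrite mulr_sumr; apply: eq_bigr => i _; rewrite mxE exprMn.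
Qed.

Lemma enormN x : enorm (- x) = enorm x.
Proof. by rewrite -scaleN1r enormZ normrN1 mul1r. Qed.

Lemma enormB x y : enorm (x - y) = enorm (y - x).
Proof. by rewrite -enormN opprB. Qed.

Lemma enormD x y : enorm (x + y) <= enorm x + enorm y.
Proof.
pose ip := \sum_(i < N) x 0 i * y 0 i.
have sqD t : enorm (t *: x + y) ^+ 2 = t ^+ 2 * enorm x ^+ 2 + 2 * t * ip + enorm y ^+ 2.
  rewrite !enorm_sqr /ip !mulr_sumr -!big_split/=; apply: eq_bigr => i _.
  by rewrite !mxE; ring.
have [x0 y0] := (enorm_ge0 x, enorm_ge0 y).
have cs : ip <= enorm x * enorm y.
  have coord0 (u : 'rV[R]_N) : enorm u = 0 -> forall i, u 0 i = 0.
    move=> u0 i; apply/eqP; rewrite -normr_le0 -u0; exact: coord_le_enorm.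
  have [xn0|xn0] := eqVneq (enorm x) 0.
    rewrite xn0 mul0r /ip big1// => i _; by rewrite (coord0 x xn0) mul0r.
  have [yn0|yn0] := eqVneq (enorm y) 0.
    rewrite yn0 mulr0 /ip big1// => i _; by rewrite (coord0 y yn0) mulr0.
  have xp : 0 < enorm x by rewrite lt_neqAle eq_sym xn0.
  have yp : 0 < enorm y by rewrite lt_neqAle eq_sym yn0.
  have := sqr_ge0 (enorm ((- (enorm y / enorm x)) *: x + y)).
  rewrite sqD.
  have -> : (- (enorm y / enorm x)) ^+ 2 * enorm x ^+ 2 +
      2 * - (enorm y / enorm x) * ip + enorm y ^+ 2 =
      2 * (enorm y / enorm x) * (enorm x * enorm y - ip) by field.
  by rewrite pmulr_rge0 ?subr_ge0// mulr_gt0// divr_gt0.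
have := sqD 1; rewrite scale1r => e.
rewrite -(ler_pXn2r (ltn0Sn 1)) ?nnegrE ?addr_ge0 ?enorm_ge0// e.
by rewrite sqrrD; lra.
Qed.

Lemma enorm_dist x y : `|enorm x - enorm y| <= enorm (x - y).
Proof.
have h (u v : 'rV[R]_N) : enorm u <= enorm (u - v) + enorm v.
  by have := enormD (u - v) v; rewrite subrK.
have := h x y; have := h y x; rewrite (enormB y x) ler_norml => h1 h2.
by apply/andP; split; lra.
Qed.

End euclidean_norm.

Section dyadic_grid.
Context {R : realType} {N : nat} (a b : 'rV[R]_N).
Hypothesis ab : forall i, a 0 i < b 0 i.

Definition grid_idx (m : nat) := {ffun 'I_N -> 'I_(2 ^ m).+1}.
Definition grid m (k : grid_idx m) : 'rV[R]_N :=
  \row_i (a 0 i + (b 0 i - a 0 i) * ((k i)%:R / (2 ^ m)%:R)).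

Definition gridpt (p : {m : nat & grid_idx m}) : 'rV[R]_N := grid (projT2 p).

Lemma grid_box m (k : grid_idx m) : box a b (grid k).
Proof.
move=> i; rewrite mxE.
have d0 : 0 <= b 0 i - a 0 i by rewrite subr_ge0 ltW.
have m0 : 0 < (2 ^ m)%:R :> R by rewrite ltr0n expn_gt0.
have q0 : 0 <= (k i)%:R / (2 ^ m)%:R :> R by rewrite divr_ge0.
have q1 : (k i)%:R / (2 ^ m)%:R <= 1 :> R.
  by rewrite ler_pdivrMr// mul1r ler_nat -ltnS ltn_ord.
apply/andP; split; first by rewrite lerDl mulr_ge0.
rewrite -lerBrDl; exact: ler_piMr.
Qed.

(** Round each coordinate down. *)
Lemma grid_near m t : box a b t ->
  exists k : grid_idx m, enorm (t - grid k) <= enorm (b - a) / (2 ^ m)%:R.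
Proof.
move=> bt.
have m0 : 0 < (2 ^ m)%:R :> R by rewrite ltr0n expn_gt0.
pose x i := (t 0 i - a 0 i) / (b 0 i - a 0 i) * (2 ^ m)%:R.
have x01 i : 0 <= x i <= (2 ^ m)%:R.
  have d0 : 0 < b 0 i - a 0 i by rewrite subr_gt0.
  have /andP[h1 h2] := bt i; apply/andP; split.
    by rewrite mulr_ge0 ?divr_ge0 ?subr_ge0// ltW.
  by rewrite ler_piMl ?ler0n// ler_pdivrMr// mul1r lerD2r.
have xt i : (Num.truncn (x i) < (2 ^ m).+1)%N.
  have /andP[h1 h2] := x01 i.
  rewrite ltnS -(ler_nat R) (le_trans _ h2)//.
  by have /andP[] := truncn_itv h1.
exists [ffun i => Ordinal (xt i)].
have -> : enorm (b - a) / (2 ^ m)%:R = enorm ((2 ^ m)%:R^-1 *: (b - a)).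
  by rewrite enormZ ger0_norm ?invr_ge0// mulrC.
apply: enorm_monotone => i; rewrite !mxE ffunE /=.
have /andP[h1 h2] := x01 i; have /andP[h3 h4] := truncn_itv h1.
have d0 : 0 < b 0 i - a 0 i by rewrite subr_gt0.
have -> : t 0 i - (a 0 i + (b 0 i - a 0 i) * ((Num.truncn (x i))%:R / (2 ^ m)%:R)) =
   (2 ^ m)%:R^-1 * (b 0 i - a 0 i) * (x i - (Num.truncn (x i))%:R).
  have xE : x i = (t 0 i - a 0 i) / (b 0 i - a 0 i) * (2 ^ m)%:R by [].
  have d1 : b 0 i - a 0 i != 0 by rewrite gt_eqF.
  have k1 : (2 ^ m)%:R != 0 :> R by rewrite gt_eqF.
  rewrite [X in _ * (X - _)]xE; move: (Num.truncn _) ((2 ^ m)%:R : R) k1 => n' k k1.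
  by field; rewrite d1.
have xb : `|x i - (Num.truncn (x i))%:R| <= 1.
  by rewrite ger0_norm ?subr_ge0// lerBlDr addrC natr1; exact: ltW.
by rewrite normrM ler_piMr.
Qed.

Lemma card_grid_idx m : #|{: grid_idx m}| = ((2 ^ m).+1 ^ N)%N.
Proof. by rewrite card_ffun !card_ord. Qed.

End dyadic_grid.

(** * The limiting modulus of a path *)
Section modulus.
Context {R : realType} (phi : R -> R) (theta : R).
Hypotheses (phi0 : forall r, 0 <= r -> 0 <= phi r)
  (phim : forall r r', 0 <= r -> r <= r' -> phi r <= phi r')
  (phic : {within `[0, +oo[, continuous phi})
  (phirv : regularly_varying0 phi theta).

Definition modulus (r : R) : R := phi r * Num.sqrt (ln (1 / r)).

(** Since phi (r) / phi (r) tends to 1, phi does not vanish near 0; then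
    monotonicity gives positivity everywhere. *)
Lemma regularly_varying_gt0 r : 0 < r -> 0 < phi r.
Proof.
move=> r0.
have := phirv ltr01; rewrite powR1 => /cvgr_norm_gt.
move=> /(_ 0); rewrite normr1 => /(_ ltr01) h.
have [e /= e0 he] := h.
pose x := Num.min (e / 2) r.
have x0 : 0 < x by rewrite lt_min r0 divr_gt0.
have xe : x < e by rewrite gt_min ltr_pdivrMr// ltr_pMr// ltr1n.
have := he x; rewrite /ball_/= sub0r normrN gtr0_norm// => /(_ xe x0).
rewrite normr_gt0 mul1r => px.
have px0 : phi x != 0 by apply: contraNneq px => ->; rewrite invr0 mulr0.
have xp : 0 < phi x by rewrite lt_neqAle eq_sym px0 phi0// ltW.
apply: (lt_le_trans xp); apply: phim; first exact: ltW.
by rewrite ge_min lexx orbT.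
Qed.

Lemma regularly_varying_doubling lam : 0 < lam ->
  exists D d, [/\ 0 < D, 0 < d & forall r, 0 < r -> r < d -> phi (lam * r) <= D * phi r].
Proof.
move=> lam0.
have := phirv lam0 => /cvgr_norm_lt.
have D0 : 0 < `|lam `^ theta| + 1 by rewrite ltr_wpDl.
move=> /(_ (`|lam `^ theta| + 1)); rewrite ltrDl => /(_ ltr01) [d /= d0 hd].
exists (`|lam `^ theta| + 1), d; split => // r r0 rd.
have := hd r; rewrite /ball_/= sub0r normrN gtr0_norm// => /(_ rd r0).
have pr := regularly_varying_gt0 r0.
move=> /ltW; rewrite normrM normfV (gtr0_norm pr) ler_pdivrMr//.
by apply: le_trans; exact: ler_norm.
Qed.

Lemma modulus_gt0 r : 0 < r < 1 -> 0 < modulus r.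
Proof.
move=> /andP[r0 r1]; rewrite mulr_gt0 ?regularly_varying_gt0// sqrtr_gt0 ln_gt0//.
by rewrite div1r invf_gt1.
Qed.

Lemma continuous_phi r : 0 < r -> {for r, continuous phi}.
Proof.
move=> r0; have := phic; rewrite continuous_within_itvcyP => -[+ _]; apply.
by rewrite in_itv/= r0.
Qed.

Lemma continuous_sqrt_ln_inv r : 0 < r ->
  {for r, continuous (fun r : R => Num.sqrt (ln (1 / r)))}.
Proof.
move=> r0.
apply: (@continuous_comp _ _ _ (fun r : R => ln (1 / r)) (@Num.sqrt R)); last first.
  exact: sqrt_continuous.
apply: (@continuous_comp _ _ _ (fun r : R => 1 / r) (@ln R)); last first.
  by apply: continuous_ln; rewrite divr_gt0.
apply: cvgM; first exact: cvg_cst.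
by apply: cvgV; [rewrite gt_eqF|exact: cvg_id].
Qed.

Lemma continuous_modulus r : 0 < r -> {for r, continuous modulus}.
Proof.
by move=> r0; apply: cvgM; [exact: continuous_phi|exact: continuous_sqrt_ln_inv].
Qed.

End modulus.

Section oscillation.
Context {R : realType} {N : nat} (a b : 'rV[R]_N) (phi : R -> R).
Hypothesis ab : forall i, a 0 i < b 0 i.
Implicit Types (x y : 'rV[R]_N -> R) (c q : R).
Local Notation modulus := (modulus phi).
Local Notation G := {m : nat & @grid_idx N m}.
Local Notation gpt := (@gridpt R N a b).

Definition grid_dist (p : G * G) : R := enorm (gpt p.1 - gpt p.2).

(** Only countably many pairs of points occur, so that for a random path this is an
    event; [osc_not_exceeds] shows that for a continuous path nothing is lost. *)
Definition osc_above x q := forall n : nat, exists p : G * G,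
  (0 < grid_dist p < ((2 ^ n)%:R)^-1) &&
  (q * modulus (grid_dist p) < `|x (gpt p.1) - x (gpt p.2)|).

(** The margin 1 / (k + 1) makes the inequality strict in the limit, which renders
    the property exactly invariant under small perturbations of x. *)
Definition osc_exceeds x c := exists k : nat, osc_above x (c + k.+1%:R^-1).

Lemma cvg_div_pow2 c : c / (2 ^ m)%:R @[m --> \oo] --> 0.
Proof.
rewrite -(mulr0 c); apply: cvgMr.
under eq_fun do rewrite natrX -exprVn.
by apply: cvg_expr; rewrite ger0_norm ?invr_ge0// invf_lt1// ltr1n.
Qed.

Lemma grid_dense t : box a b t -> exists2 g : nat -> G,
  (forall m, enorm (t - gpt (g m)) <= enorm (b - a) / (2 ^ m)%:R) &
  gpt (g m) @[m --> \oo] --> t.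
Proof.
move=> bt.
have /choice[g gP] : forall m, exists p : G,
    enorm (t - gpt p) <= enorm (b - a) / (2 ^ m)%:R.
  by move=> m; have [k kP] := grid_near ab m bt; exists (existT _ m k).
exists g => //; apply/cvgrPdist_le => e e0.
have /cvgrPdist_le/(_ _ e0) := cvg_div_pow2 (enorm (b - a)).
apply: filterS => m; rewrite sub0r normrN => h.
rewrite (le_trans (norm_le_enorm _))// (le_trans (gP m))// (le_trans _ h)//.
exact: ler_norm.
Qed.

Hypotheses (phi_gt0 : forall r, 0 < r -> 0 < phi r)
  (mod_cont : forall r : R, 0 < r -> {for r, continuous modulus}).

Lemma modulus_ge0 r : 0 < r -> 0 <= modulus r.
Proof. by move=> r0; rewrite mulr_ge0 ?sqrtr_ge0// ltW ?phi_gt0. Qed.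

(** The grid is dense and both sides are continuous in the two points. *)
Lemma osc_not_exceeds x c e : continuous x -> ~ osc_exceeds x c -> 0 < e ->
  exists2 d : R, 0 < d & forall t s, box a b t -> box a b s ->
    0 < enorm (t - s) -> enorm (t - s) < d ->
    `|x t - x s| <= (c + e) * modulus (enorm (t - s)).
Proof.
move=> cx nex e0.
pose k := Num.truncn e^-1; pose q := c + k.+1%:R^-1.
have ke : k.+1%:R^-1 <= e by rewrite invf_ple ?posrE//; exact/ltW/truncnS_gt.
have /existsNP[n nn] : ~ osc_above x q by move=> h; apply: nex; exists k.
have np p : 0 < grid_dist p < ((2 ^ n)%:R)^-1 ->
    `|x (gpt p.1) - x (gpt p.2)| <= q * modulus (grid_dist p).
  move=> hp; rewrite leNgt; apply/negP => h; apply: nn; exists p.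
  by rewrite hp.
exists ((2 ^ n)%:R)^-1; first by rewrite invr_gt0 ltr0n expn_gt0.
move=> t s bt bs ts0 tsd.
have [gt gtP cgt] := grid_dense bt; have [gs gsP cgs] := grid_dense bs.
have cdist : grid_dist (gt m, gs m) @[m --> \oo] --> enorm (t - s).
  apply/cvgrPdist_le => e' e'0.
  have /cvgrPdist_le/(_ _ e'0) := cvg_div_pow2 (enorm (b - a) + enorm (b - a)).
  apply: filterS => m; rewrite sub0r normrN => h.
  rewrite (le_trans (enorm_dist _ _))// (le_trans _ h)//.
  have -> : t - s - (gpt (gt m) - gpt (gs m)) = (t - gpt (gt m)) - (s - gpt (gs m)).
    move: (gpt (gt m)) (gpt (gs m)) => u v.
    by apply/rowP => i; rewrite !mxE; ring.
  rewrite (le_trans (enormD _ _))// enormN (le_trans (lerD (gtP m) (gsP m)))//.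
  by rewrite -mulrDl ler_norm.
have cmod : q * modulus (grid_dist (gt m, gs m)) @[m --> \oo] -->
    q * modulus (enorm (t - s)).
  by apply: cvgMr; apply: (cvg_comp _ _ cdist); exact: mod_cont.
have cdiff : `|x (gpt (gt m)) - x (gpt (gs m))| @[m --> \oo] --> `|x t - x s|.
  by apply: cvg_norm; apply: cvgB; [apply: (cvg_comp _ _ cgt)|apply: (cvg_comp _ _ cgs)]; exact: cx.
apply: (@le_trans _ _ (q * modulus (enorm (t - s)))); last first.
  by rewrite ler_wpM2r ?modulus_ge0// /q lerD2l.
apply: (ler_cvg_to cdiff cmod).
have n1 := cvgr_gt _ cdist _ ts0; have n2 := cvgr_lt _ cdist _ tsd.
near=> m; apply: (np (gt m, gs m)); apply/andP; split; near: m; [exact: n1|exact: n2].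
Unshelve. all: end_near. Qed.

Lemma osc_exceeds_large x c h : 0 < h -> osc_exceeds x c ->
  exists t s, [/\ box a b t, box a b s, 0 < enorm (t - s), enorm (t - s) <= h &
    c * modulus (enorm (t - s)) < `|x t - x s|].
Proof.
move=> h0 [k kx].
have [n _ /(_ n (leqnn n))/= nh] := near_infty_natSinv_expn_lt (PosNum h0).
have [p /andP[/andP[p0 p1] p2]] := kx n.
exists (gpt p.1), (gpt p.2); split => //; try exact: grid_box.
  by rewrite (le_trans (ltW p1))// -div1r natrX ltW.
apply: le_lt_trans p2; rewrite ler_wpM2r ?modulus_ge0// lerDl invr_ge0//.
Qed.

(** A perturbation of order phi is negligible against the modulus, because
    sqrt (ln (1 / r)) tends to infinity. *)
Lemma osc_exceeds_perturb x y c K :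
  (forall t s, box a b t -> box a b s ->
    `|(x t - x s) - (y t - y s)| <= K * phi (enorm (t - s))) ->
  osc_exceeds x c -> osc_exceeds y c.
Proof.
move=> xy [k kx]; exists k.+1 => n.
pose del : R := k.+1%:R^-1 - k.+2%:R^-1.
have del0 : 0 < del by rewrite subr_gt0 ltf_pV2 ?posrE// ltr_nat.
have ln20 : 0 < ln (2 : R) by rewrite ln_gt0// ltr1n.
(* below 2 ^ - n' one has K <= del * sqrt (ln (1 / r)) *)
pose n' := maxn n (Num.truncn ((K / del) ^+ 2 / ln 2)).+1.
have [p /andP[/andP[p0 p1] p2]] := kx n'.
exists p; set r := grid_dist p in p0 p1 p2 *.
have le2 (i j : nat) : (i <= j)%N -> ((2 ^ j)%:R)^-1 <= ((2 ^ i)%:R)^-1 :> R.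
  by move=> ij; rewrite lef_pV2 ?posrE ?ltr0n ?expn_gt0// ler_nat leq_pexp2l.
apply/andP; split.
  by rewrite p0 (lt_le_trans p1)// le2// leq_maxl.
have Kr : K <= del * Num.sqrt (ln (1 / r)).
  rewrite mulrC -ler_pdivrMr// (le_trans (ler_norm _))// -sqrtr_sqr ler_wsqrtr//.
  apply: (@le_trans _ _ (n'%:R * ln 2)).
    rewrite -ler_pdivrMr// (le_trans (ltW (truncnS_gt _)))// ler_nat.
    by rewrite /n' leq_maxr.
  rewrite mulr_natl -lnXn// ler_ln ?posrE ?exprn_gt0 ?divr_gt0//.
  by rewrite div1r -natrX -[leLHS]invrK lef_pV2 ?posrE ?invr_gt0 ?ltr0n ?expn_gt0// ltW.
have mr := modulus_ge0 p0.
have kp : K * phi r <= del * modulus r.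
  by rewrite /modulus mulrCA mulrC ler_wpM2l// ltW// phi_gt0.
have := xy (gpt p.1) (gpt p.2) (grid_box ab _) (grid_box ab _).
rewrite -/(grid_dist p) -/r => xyp.
have tri : `|x (gpt p.1) - x (gpt p.2)| <= `|y (gpt p.1) - y (gpt p.2)| +
   `|(x (gpt p.1) - x (gpt p.2)) - (y (gpt p.1) - y (gpt p.2))|.
  move: (x _ - x _) (y _ - y _) => A B.
  by have := ler_normD B (A - B); rewrite [B + _]addrC subrK.
have : (c + k.+1%:R^-1) * modulus r =
   (c + k.+2%:R^-1) * modulus r + del * modulus r by rewrite /del; ring.
move=> e; rewrite e in p2; move: p2 tri (le_trans xyp kp).
move: (_ * modulus r) (del * modulus r) => B1 B2; lra.
Qed.

End oscillation.

(** * The chaining sum *)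
Section chaining_sum.
Context {R : realType} (phi : R -> R).
Hypotheses (phi0 : forall r, 0 <= r -> 0 <= phi r)
  (phim : forall r r', 0 <= r -> r <= r' -> phi r <= phi r')
  (phic : {within `[0, +oo[, continuous phi}).
Local Notation mu := (@lebesgue_measure R).

Let integrand (r : R) := phi r / (r * Num.sqrt (ln (1 / r))).

Let sqrt_ln_gt0 (r : R) : 0 < r < 1 -> 0 < Num.sqrt (ln (1 / r)).
Proof.
by move=> /andP[r0 r1]; rewrite sqrtr_gt0 ln_gt0// div1r invf_gt1.
Qed.

Lemma measurable_dini_integrand : measurable_fun (`]0, 1[%classic : set R) integrand.
Proof.
apply: open_continuous_measurable_fun; first exact: interval_open.
move=> r; rewrite inE/= in_itv/= => /andP[r0 r1].
apply: cvgM; first exact: continuous_phi.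
apply: cvgV; first by rewrite mulf_neq0 ?gt_eqF// sqrt_ln_gt0// r0.
by apply: cvgM; [exact: cvg_id|exact: continuous_sqrt_ln_inv].
Qed.

Lemma integral_inv (x y : R) : 0 < x -> x < y ->
  (\int[mu]_(r in `[x, y]) (r^-1)%:E = (ln y - ln x)%:E)%E.
Proof.
move=> x0 xy.
have pos z : x <= z -> 0 < z by exact: lt_le_trans.
have dl z : x <= z -> is_derive z 1 (@ln R) z^-1 by move=> /pos; exact: is_derive1_ln.
have cl z : x <= z -> {for z, continuous (@ln R)} by move=> /pos; exact: continuous_ln.
rewrite EFinB -(@continuous_FTC2 _ (fun r => r^-1) (@ln R))//.
- apply: continuous_in_subspaceT => z; rewrite inE/= in_itv/= => /andP[/pos z0 _].
  by apply: cvgV; [rewrite gt_eqF|exact: cvg_id].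
- split.
  + by move=> z; rewrite in_itv/= => /andP[/ltW/dl [] ].
  + exact/cvg_at_right_filter/cl.
  + exact/cvg_at_left_filter/cl/ltW.
- by move=> z; rewrite in_itv/= => /andP[/ltW/dl [] _ <- _]; rewrite derive1E.
Qed.

(** On the block, phi is at least phi x and ln (1 / r) is at most ln (1 / x). *)
Lemma dini_integral_block_ge (x y : R) : 0 < x -> x < y -> y <= 1 ->
  ((phi x / Num.sqrt (ln (1 / x)) * (ln y - ln x))%:E <=
   \int[mu]_(r in `[x, y[) (integrand r)%:E)%E.
Proof.
move=> x0 xy y1.
have sx : 0 < Num.sqrt (ln (1 / x)) by rewrite sqrt_ln_gt0// x0 (lt_le_trans xy).
have c0 : 0 <= phi x / Num.sqrt (ln (1 / x)) by rewrite divr_ge0 ?phi0 ?ltW.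
have minv : measurable_fun (`[x, y] : set R) (fun r : R => (r^-1)%:E).
  apply/measurable_EFinP; apply: subspace_continuous_measurable_fun => //.
  apply: continuous_in_subspaceT => z; rewrite inE/= in_itv/= => /andP[xz _].
  by apply: cvgV; [rewrite gt_eqF ?(lt_le_trans x0)|exact: cvg_id].
have minv' : measurable_fun (`[x, y[ : set R) (fun r : R => (r^-1)%:E).
  by apply: measurable_funS minv => // z /=; rewrite !in_itv/= => /andP[-> /ltW].
rewrite EFinM -(integral_inv x0 xy) -integral_itv_bndo_bndc//.
rewrite -ge0_integralZl//; last first.
  by move=> r; rewrite /= in_itv/= => /andP[xr _]; rewrite lee_fin invr_ge0 (le_trans (ltW x0)).
apply: ge0_le_integral => //.
- move=> r; rewrite /= in_itv/= => /andP[xr _].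
  by rewrite -EFinM lee_fin mulr_ge0// invr_ge0 (le_trans (ltW x0)).
- exact: measurable_funeM.
- apply/measurable_EFinP; apply: measurable_funS measurable_dini_integrand => // z /=.
  by rewrite !in_itv/= => /andP[xz zy]; rewrite (lt_le_trans x0)//= (lt_le_trans zy).
move=> r; rewrite /= in_itv/= => /andP[xr ry].
have r0 : 0 < r by exact: lt_le_trans xr.
have r1 : r < 1 by exact: lt_le_trans y1.
have sr : 0 < Num.sqrt (ln (1 / r)) by rewrite sqrt_ln_gt0// r0.
rewrite -EFinM lee_fin /integrand invfM [r^-1 * _]mulrC mulrA ler_wpM2r ?invr_ge0 ?(ltW r0)//.
rewrite ler_pM ?phi0 ?invr_ge0 ?(ltW x0) ?(ltW sx)//; first by rewrite phim// ltW.
rewrite lef_pV2 ?posrE// ler_wsqrtr// ler_ln ?posrE ?divr_gt0//.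
by rewrite !div1r lef_pV2.
Qed.

Let lev n k : R := (n * 2 ^ k)%:R.
Let y n k : R := ((2 ^ (n * 2 ^ k))%:R)^-1.

Let y_gt0 n k : 0 < y n k. Proof. by rewrite invr_gt0 ltr0n expn_gt0. Qed.

Let lnyE n k : ln (1 / y n k) = lev n k * ln 2.
Proof. by rewrite div1r invrK natrX lnXn// mulr_natl. Qed.

Let lnyN n k : ln (y n k) = - (lev n k * ln 2).
Proof. by rewrite -lnyE div1r lnV ?posrE// opprK. Qed.

(** The interval is cut at the points y_k = 2 ^ - (n 2 ^ k). The logarithm varies by
    a factor 2 on each block, whose contribution is therefore comparable with
    phi (y_k) sqrt (ln (1 / y_k)). *)
Lemma dini_integral_ge_sum n J : (0 < n)%N ->
  ((\sum_(k < J) (Num.sqrt (ln 2) / 2 * (phi (y n k.+1) * Num.sqrt (lev n k.+1))))%:E <=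
  \int[mu]_(r in `[y n J, y n 0[) (integrand r)%:E)%E.
Proof.
move=> n0.
have ln20 : 0 < ln (2 : R) by rewrite ln_gt0// ltr1n.
have ylt k : y n k.+1 < y n k.
  by rewrite ltf_pV2 ?posrE ?ltr0n ?expn_gt0// ltr_nat ltn_exp2l// ltn_pmul2l// ltn_exp2l.
have y1 k : y n k <= 1.
  by rewrite invf_le1 ?ltr0n ?expn_gt0// ler1n expn_gt0.
have yle k : y n k <= y n 0.
  by elim: k => // k IH; rewrite (le_trans _ IH)// ltW.
have sub k : (`[y n k, y n 0[ : set R) `<=` `]0, 1[.
  move=> z /=; rewrite !in_itv/= => /andP[z1 z2].
  by rewrite (lt_le_trans (y_gt0 n k))//= (lt_le_trans z2).
elim: J => [|J IH].
  rewrite big_ord0; apply: integral_ge0 => r /=; rewrite in_itv/= => /andP[h1 h2].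
  by have := lt_le_trans h2 h1; rewrite ltxx.
have -> : `[y n J.+1, y n 0[%classic = `[y n J.+1, y n J[ `|` `[y n J, y n 0[.
  by apply: itv_bndbnd_setU; rewrite bnd_simp; [exact: ltW|exact: yle].
rewrite big_ord_recr/= EFinD addeC ge0_integral_setU//; first last.
- apply/disj_setPRL => z /=; rewrite !in_itv/= => /andP[z1 _] /andP[_ z2].
  by have := lt_le_trans z2 z1; rewrite ltxx.
- move=> z; have zz : (`[y n J.+1, y n J[ `|` `[y n J, y n 0[) z -> 0 < z < 1.
    move=> [|] /=; rewrite in_itv/= => /andP[h1 h2].
      by rewrite (lt_le_trans (y_gt0 n J.+1))//= (lt_le_trans h2).
    by rewrite (lt_le_trans (y_gt0 n J))//= (lt_le_trans h2).
  move=> /zz /andP[z0 z1]; rewrite lee_fin divr_ge0 ?phi0 ?ltW// mulr_gt0//.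
  by rewrite sqrt_ln_gt0// z0.
- apply/measurable_EFinP; apply: measurable_funS measurable_dini_integrand => // z.
  by rewrite -itv_bndbnd_setU ?bnd_simp ?yle// ?ltW//; exact: sub.
apply: leeD => //; apply: le_trans (dini_integral_block_ge (y_gt0 n J.+1) (ylt J) (y1 J)).
rewrite lee_fin lnyE !lnyN.
have levS : lev n J.+1 = 2 * lev n J by rewrite /lev expnS mulnCA natrM.
have l0 : 0 < lev n J by rewrite ltr0n muln_gt0 n0 expn_gt0.
rewrite levS; set l := lev n J in l0 *.
have l20 : 0 < 2 * l by rewrite mulr_gt0.
rewrite (sqrtrM (ln 2) (ltW l20)).
have s1 : Num.sqrt (2 * l) ^+ 2 = 2 * l by rewrite sqr_sqrtr// ltW.
have s2 : Num.sqrt (ln 2) ^+ 2 = ln (2 : R) by rewrite sqr_sqrtr// ltW.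
have p1 : 0 < Num.sqrt (2 * l) by rewrite sqrtr_gt0.
have p2 : 0 < Num.sqrt (ln (2 : R)) by rewrite sqrtr_gt0.
rewrite le_eqVlt; apply/orP; left; apply/eqP.
have -> : - (l * ln 2) - - (2 * l * ln 2) =
  Num.sqrt (2 * l) ^+ 2 / 2 * Num.sqrt (ln 2) ^+ 2 by rewrite s1 s2; field.
by field; rewrite !gt_eqF.
Qed.

(** The term k = 0 contributes the 1 of the constant 1 + 2 C; the others are bounded
    by the integral through [dini_integral_ge_sum]. *)
Lemma chaining_sum (C : R) : 0 < C ->
  (\forall h \near 0^'+, (\int[mu]_(r in `]0%R, h[)
     (phi r / (r * Num.sqrt (ln (1 / r))))%:E
     <= (C * (phi h * Num.sqrt (ln (1 / h))))%:E)%E) ->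
  exists2 n0, (0 < n0)%N & forall n J, (n0 <= n)%N ->
    \sum_(k < J) phi ((2 ^ (n * 2 ^ k))%:R)^-1 * Num.sqrt (n * 2 ^ k)%:R <=
    (1 + 2 * C) * (phi ((2 ^ n)%:R)^-1 * Num.sqrt n%:R).
Proof.
move=> C0 [e /= e0 he].
have [m _ hm] := near_infty_natSinv_expn_lt (PosNum e0).
exists m.+1 => // n J mn.
have n0 : (0 < n)%N by exact: leq_trans mn.
have ln20 : 0 < ln (2 : R) by rewrite ln_gt0// ltr1n.
pose h : R := ((2 ^ n)%:R)^-1.
have h0 : 0 < h by rewrite invr_gt0 ltr0n expn_gt0.
have yh : y n 0 = h by rewrite /y expn0 muln1.
have he' : h < e.
  have /= := hm n (ltnW mn); rewrite div1r -natrX; exact.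
have := he h; rewrite /ball_/= sub0r normrN gtr0_norm// => /(_ he' h0) Ih.
have h1 : h < 1 by rewrite invf_lt1 ?ltr0n ?expn_gt0// ltr1n -{1}(expn0 2) ltn_exp2l.
have {}Ih K : \sum_(k < K) (Num.sqrt (ln 2) / 2 * (phi (y n k.+1) * Num.sqrt (lev n k.+1)))
   <= C * (phi h * (Num.sqrt n%:R * Num.sqrt (ln 2))).
  rewrite -lee_fin; apply: le_trans (dini_integral_ge_sum K n0) _.
  rewrite -sqrtrM ?ler0n//.
  have -> : n%:R * ln 2 = ln (1 / h) by rewrite -yh lnyE /lev expn0 muln1.
  apply: le_trans Ih; apply: ge0_subset_integral => //.
  - apply/measurable_EFinP; apply: measurable_funS measurable_dini_integrand => // z /=.
    by rewrite !in_itv/= => /andP[-> /lt_trans->].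
  - move=> z /=; rewrite in_itv/= => /andP[z0 zh].
    rewrite lee_fin divr_ge0 ?phi0 ?ltW// mulr_gt0// sqrt_ln_gt0// z0/=.
    exact: lt_trans h1.
  - move=> z /=; rewrite yh !in_itv/= => /andP[z1 ->].
    by rewrite (lt_le_trans (y_gt0 n K)).
have sq0 : 0 <= phi h * Num.sqrt n%:R by rewrite mulr_ge0 ?sqrtr_ge0// phi0// ltW.
case: J => [|J].
  by rewrite big_ord0 mulr_ge0// addr_ge0// mulr_ge0// ltW.
rewrite big_ord_recl/= expn0 muln1 -/h mulrDl mul1r lerD2l.
have := Ih J; rewrite -mulr_sumr.
have p2 : 0 < Num.sqrt (ln (2 : R)) by rewrite sqrtr_gt0.
set S := \sum_(i < J) _ => hS.
have : Num.sqrt (ln 2) / 2 * S <= Num.sqrt (ln 2) / 2 * (2 * C * (phi h * Num.sqrt n%:R)).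
  by rewrite (le_trans hS)// le_eqVlt; apply/orP; left; apply/eqP; field.
by rewrite ler_pM2l ?divr_gt0// => SC; apply: le_trans SC.
Qed.

End chaining_sum.

(** * Chaining: the modulus is finite *)
Section upper_bound.
Context d (T : measurableType d) (R : realType) (P : probability T R).
Context (N : nat) (X : 'rV[R]_N -> {RV P >-> R}) (a b : 'rV[R]_N).
Context (phi : R -> R) (theta : R).
Hypotheses (gX : gaussian_field X) (cX : centered X)
  (Xcont : forall w, continuous (fun t : 'rV[R]_N => X t w))
  (ab : forall i, a 0 i < b 0 i)
  (phi0 : forall r, 0 <= r -> 0 <= phi r)
  (phim : forall r r', 0 <= r -> r <= r' -> phi r <= phi r')
  (phic : {within `[0, +oo[, continuous phi})
  (phirv : regularly_varying0 phi theta).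
Context (C1 : R).
Hypotheses (C10 : 0 < C1)
  (std_le : forall t s, box a b t -> box a b s ->
    gstd P (fun w => X t w - X s w) <= C1 * phi (enorm (t - s))).

Lemma finite_union_bound (I : finType) (A : I -> set T) (c : R) :
  (forall i, measurable (A i)) -> (forall i, (P (A i) <= c%:E)%E) ->
  measurable [set w | exists i, A i w] /\
  (P [set w | exists i, A i w] <= (#|I|%:R * c)%:E)%E.
Proof.
move=> mA Ac.
have key (s : seq I) : measurable [set w | exists2 i, i \in s & A i w] /\
    (P [set w | exists2 i, i \in s & A i w] <= ((size s)%:R * c)%:E)%E.
  elim: s => [|i s [ms IH]].
    have -> : [set w | exists2 i : I, i \in [::] & A i w] = set0.
      by apply/seteqP; split => // w [].
    by split; [exact: measurable0|rewrite measure0 mul0r].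
  have -> : [set w | exists2 j, j \in i :: s & A j w] =
      A i `|` [set w | exists2 i, i \in s & A i w].
    apply/seteqP; split => w /=.
      by move=> [j]; rewrite inE => /orP[/eqP ->|js] Aj; [left|right; exists j].
    by move=> [Ai|[j js Aj]]; [exists i; rewrite ?mem_head|exists j => //; rewrite inE js orbT].
  split; first exact: measurableU.
  apply: le_trans (measureU2 _ _ _) _ => //.
  by rewrite /= -natr1 mulrDl mul1r addrC EFinD leeD.
have := key (enum I).
have -> : [set w | exists2 i, i \in enum I & A i w] = [set w | exists i, A i w].
  apply/seteqP; split => w /=; first by move=> [i _ Ai]; exists i.
  by move=> [i Ai]; exists i => //; rewrite mem_enum.
by rewrite -cardE.
Qed.

Let L : R := enorm (b - a).
Let L1 : R := 2 * L + 1.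
(** With this constant exp (- kap^2 m / 4) = 2 ^ - ((5 N + 1) m), which beats the
    number of pairs of grid points in [bad_bound]. *)
Let kap : R := Num.sqrt (4 * (5 * N + 1)%:R * ln 2).
Local Notation grid := (@grid R N a b).

Let L0 : 0 <= L. Proof. exact: enorm_ge0. Qed.
Let L10 : 0 < L1. Proof. by rewrite ltr_wpDl// mulr_ge0. Qed.
Let ln20 : 0 < ln (2 : R). Proof. by rewrite ln_gt0// ltr1n. Qed.
Let pow2_gt0 m : 0 < (2 ^ m)%:R :> R. Proof. by rewrite ltr0n expn_gt0. Qed.

(** The distance allowed between the two grid points covers consecutive points of
    a chain as well as the projections of two points at distance at most 2 ^ - m. *)
Let bad_pair m m' (p : grid_idx m * grid_idx m') : set T :=
  [set w | (enorm (grid p.1 - grid p.2) <= L1 / (2 ^ m)%:R) &&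
    (kap * Num.sqrt m%:R * (C1 * phi (L1 / (2 ^ m)%:R)) <
      `|X (grid p.1) w - X (grid p.2) w|)].

Let bad m m' := [set w | exists p : @grid_idx N m * @grid_idx N m', bad_pair p w].

Lemma bad_pair_bound m m' (p : grid_idx m * grid_idx m') :
  measurable (bad_pair p) /\
  (P (bad_pair p) <= (2 * ((2 ^ ((5 * N + 1) * m))%:R)^-1)%:E)%E.
Proof.
rewrite /bad_pair; case: (leP (enorm _)) => [near|_]; last first.
  rewrite (_ : [set w | _] = set0); last by apply/seteqP; split.
  by split; [exact: measurable0|rewrite measure0 lee_fin mulr_ge0// invr_ge0].
set u := kap * Num.sqrt m%:R; set v := C1 * phi _.
have sf : gspan X (fun w => X (grid p.1) w - X (grid p.2) w).
  by apply: gspan_sub; exact: gspan_X.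
have mf := gspan_measurable sf.
have u0 : 0 <= u by rewrite mulr_ge0// sqrtr_ge0.
have msub : measurable [set w | u * v < `|X (grid p.1) w - X (grid p.2) w|].
  have -> : [set w | u * v < `|X (grid p.1) w - X (grid p.2) w|] =
     (fun w => `|X (grid p.1) w - X (grid p.2) w|) @^-1` `]u * v, +oo[.
    by apply/seteqP; split => w /=; rewrite in_itv/= andbT.
  have mn : measurable_fun [set: T] (fun w => `|X (grid p.1) w - X (grid p.2) w|).
    exact: measurableT_comp.
  by rewrite -[X in measurable X]setTI; apply: mn.
split => //=.
have := normal_law_tail (sqrtr_ge0 _) (gspan_law_gstd gX cX sf) u0.
have -> : expR (- (u ^+ 2 / 4)) = ((2 ^ ((5 * N + 1) * m))%:R)^-1 :> R.
  rewrite /u exprMn !sqr_sqrtr//; last by rewrite !mulr_ge0// ltW.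
  rewrite expRN; congr (_^-1).
  rewrite natrX -[RHS]lnK ?posrE ?exprn_gt0// lnXn//; congr expR.
  by rewrite -[RHS]mulr_natl (natrM _ _ m); field.
apply: le_trans; apply: le_measure; rewrite ?inE//.
  have -> : [set w | u * gstd P (fun w => X (grid p.1) w - X (grid p.2) w) <
      `|X (grid p.1) w - X (grid p.2) w|] =
     (fun w => `|X (grid p.1) w - X (grid p.2) w|) @^-1`
       `]u * gstd P (fun w => X (grid p.1) w - X (grid p.2) w), +oo[.
    by apply/seteqP; split => w /=; rewrite in_itv/= andbT.
  have mn : measurable_fun [set: T] (fun w => `|X (grid p.1) w - X (grid p.2) w|).
    exact: measurableT_comp.
  by rewrite -[X in measurable X]setTI; apply: mn.
move=> w /=; apply: le_lt_trans; rewrite ler_wpM2l// /v.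
rewrite (le_trans (std_le (grid_box ab _) (grid_box ab _)))// ler_wpM2l ?(ltW C10)//.
by rewrite phim// enorm_ge0.
Qed.

(** The number of pairs is at most 2 ^ (5 N m). *)
Lemma bad_bound m m' : (0 < m)%N -> (m' <= 2 * m)%N ->
  measurable (bad m m') /\ (P (bad m m') <= (2 / (2 ^ m)%:R)%:E)%E.
Proof.
move=> m0 mm'.
have [mb Pb] := finite_union_bound (fun p => (@bad_pair_bound m m' p).1)
  (fun p => (@bad_pair_bound m m' p).2).
split => //; apply: le_trans Pb _; rewrite lee_fin card_prod !card_grid_idx natrM.
have cardle k : ((2 ^ k).+1 ^ N)%:R <= (2 ^ (k.+1 * N))%:R :> R.
  rewrite expnM !natrX lerXn2r ?nnegrE ?exprn_ge0 ?ler0n//.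
  by rewrite -natrX ler_nat expnS mul2n -addnn -add1n leq_add2r expn_gt0.
rewrite mulrCA ler_wpM2l// ler_pdivrMr// [leRHS]mulrC ler_pdivlMr//.
rewrite [leLHS]mulrC (le_trans (ler_wpM2l (ltW (pow2_gt0 m)) (ler_pM _ _ (cardle m) (cardle m'))))//.
rewrite -!natrM -!expnD ler_nat leq_exp2l//.
have h : (m.+1 + m'.+1 <= 5 * m)%N by lia.
have := leq_mul h (leqnn N); lia.
Qed.

Lemma chain_step m m' t s w (k : grid_idx m) (k' : grid_idx m') :
  enorm (t - grid k) <= L / (2 ^ m)%:R -> enorm (s - grid k') <= L / (2 ^ m')%:R ->
  (m <= m')%N -> enorm (t - s) <= ((2 ^ m)%:R)^-1 -> ~ bad m m' w ->
  `|X (grid k) w - X (grid k') w| <=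
    kap * C1 * (phi (L1 / (2 ^ m)%:R) * Num.sqrt m%:R).
Proof.
move=> tk sk mm' ts nb; rewrite leNgt; apply/negP => lt; apply: nb; exists (k, k').
rewrite /bad_pair /=; apply/andP; split; last first.
  by apply: le_lt_trans lt; rewrite le_eqVlt; apply/orP; left; apply/eqP; ring.
have -> : grid k - grid k' = (t - s) - ((t - grid k) - (s - grid k')).
  by move: (grid k) (grid k') => u v; apply/rowP => i; rewrite !mxE; ring.
have sk' : enorm (s - grid k') <= L / (2 ^ m)%:R.
  apply: (le_trans sk); rewrite ler_wpM2l// lef_pV2 ?posrE// ler_nat.
  by rewrite leq_exp2l.
have tri : enorm (t - grid k - (s - grid k')) <= L / (2 ^ m)%:R + L / (2 ^ m)%:R.
  by rewrite (le_trans (enormD _ _))// enormN lerD.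
rewrite (le_trans (enormD _ _))// enormN (le_trans (lerD ts tri))//.
by rewrite /L1 le_eqVlt; apply/orP; left; apply/eqP; field; rewrite gt_eqF.
Qed.

Let lev n k := iter k (muln 2) n.

Let levE n k : lev n k = (n * 2 ^ k)%N.
Proof.
by elim: k => [|k IH]; rewrite ?expn0 ?muln1// /lev iterS -/(lev n k) IH expnS mulnCA.
Qed.

(** Telescoping along the projections of t on the grids of levels n 2 ^ k; the
    path is continuous, so the chain ends at t. *)
Lemma chaining w n t S : (0 < n)%N -> box a b t ->
  (forall m, (n <= m)%N -> ~ bad m (2 * m) w) ->
  (forall J, \sum_(k < J) phi (L1 / (2 ^ lev n k)%:R) * Num.sqrt (lev n k)%:R <= S) ->
  exists2 k : grid_idx n, enorm (t - grid k) <= L / (2 ^ n)%:R &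
    `|X t w - X (grid k) w| <= kap * C1 * S.
Proof.
move=> n0 bt nbad sumS.
pose g m := projT1 (cid (grid_near ab m bt)).
have gP m : enorm (t - grid (g m)) <= L / (2 ^ m)%:R by rewrite /g; case: cid.
exists (g n) => //.
have levn k : (n <= lev n k)%N by rewrite levE leq_pmulr// expn_gt0.
have kC : 0 <= kap * C1 by rewrite mulr_ge0 ?sqrtr_ge0// ltW.
have step J : `|X (grid (g (lev n J))) w - X (grid (g n)) w| <=
    kap * C1 * \sum_(k < J) phi (L1 / (2 ^ lev n k)%:R) * Num.sqrt (lev n k)%:R.
  elim: J => [|J IH]; first by rewrite subrr normr0 big_ord0 mulr0.
  rewrite big_ord_recr/= mulrDr.
  have -> : X (grid (g (lev n J.+1))) w - X (grid (g n)) w =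
    (X (grid (g (lev n J))) w - X (grid (g n)) w) -
    (X (grid (g (lev n J))) w - X (grid (g (lev n J.+1))) w) by ring.
  rewrite (le_trans (ler_normB _ _))// lerD//.
  apply: (chain_step (gP _) (gP _)).
  - by rewrite /= mul2n -addnn leq_addr.
  - rewrite subrr (le_trans _ (_ : 0 <= _))// ?invr_ge0//.
    by rewrite /enorm big1 ?sqrtr0// => i _; rewrite mxE expr0n.
  - exact: nbad.
have cg : grid (g (lev n J)) @[J --> \oo] --> t.
  apply/cvgrPdist_le => e e0.
  have /cvgrPdist_le/(_ _ e0) := @cvg_div_pow2 R L.
  apply: filterS => J; rewrite sub0r normrN => h.
  rewrite (le_trans (norm_le_enorm _))// (le_trans (gP _))// (le_trans _ h)//.
  rewrite ger0_norm ?divr_ge0// ler_wpM2l// lef_pV2 ?posrE// ler_nat leq_exp2l//.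
  rewrite levE (leq_trans (ltnW (ltn_expl J (ltnSn 1))))// leq_pmull//.
have cX' : `|X (grid (g (lev n J))) w - X (grid (g n)) w| @[J --> \oo] -->
    `|X t w - X (grid (g n)) w|.
  apply: cvg_norm; apply: cvgB; last exact: cvg_cst.
  apply: (@cvg_comp _ _ _ (fun J => grid (g (lev n J))) (fun u : 'rV[R]_N => X u w) _ _ _ cg).
  exact: (@Xcont w t).
apply: (cvgr_to_le cX'); apply: nearW => J.
by rewrite (le_trans (step J))// ler_wpM2l.
Qed.

(** Outside the bad events of all levels at least n1, whose total probability is at
    most 1 / 2, the chaining bounds hold at all small scales. The constant K
    collects them, with the doubling constants of phi for the factors L1 and 2. *)
Lemma osc_exceeds_prob_le_half (C : R) : 0 < C ->
  (\forall h \near 0^'+, (\int[lebesgue_measure]_(r in `]0%R, h[)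
     (phi r / (r * Num.sqrt (ln (1 / r))))%:E
     <= (C * (phi h * Num.sqrt (ln (1 / h))))%:E)%E) ->
  exists K, exists2 B : set T, measurable B /\ (P B <= (2^-1)%:E)%E &
    [set w | osc_exceeds a b phi (fun t => X t w) K] `<=` B.
Proof.
move=> C0 hint.
have [n0 n00 hsum] := chaining_sum phi0 phim phic C0 hint.
have [D [dl [D0 dl0 hD]]] := regularly_varying_doubling phi0 phim phirv L10.
have two0 : 0 < 2 :> R by [].
have [D2 [dl2 [D20 dl20 hD2]]] := regularly_varying_doubling phi0 phim phirv two0.
have [m1 _ hm1] := near_infty_natSinv_expn_lt (PosNum dl0).
have [m2 _ hm2] := near_infty_natSinv_expn_lt (PosNum dl20).
pose n1 := (maxn (maxn n0 4) (maxn m1 m2)).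
have n1n0 : (n0 <= n1)%N by rewrite !leq_max leqnn.
have n14 : (4 <= n1)%N by rewrite !leq_max leqnn orbT.
have n1m1 : (m1 <= n1)%N by rewrite !leq_max leqnn !orbT.
have n1m2 : (m2 <= n1)%N by rewrite !leq_max leqnn !orbT.
pose K := kap * C1 * D * (1 + 2 * (1 + 2 * C)) * D2 / Num.sqrt (ln 2).
pose B := \bigcup_j (bad (n1 + j) (n1 + j) `|` bad (n1 + j) (2 * (n1 + j))).
have n1_gt0 : (0 < n1)%N by exact: leq_trans n14.
have pos j : (0 < n1 + j)%N by rewrite addn_gt0 n1_gt0.
have le1 j : (n1 + j <= 2 * (n1 + j))%N by rewrite leq_pmull.
have mB1 j : measurable (bad (n1 + j) (n1 + j)) := (bad_bound (pos j) (le1 j)).1.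
have mB2 j : measurable (bad (n1 + j) (2 * (n1 + j))) :=
  (bad_bound (pos j) (leqnn _)).1.
have mBj j : measurable (bad (n1 + j) (n1 + j) `|` bad (n1 + j) (2 * (n1 + j))).
  exact: measurableU.
have mB : measurable B by exact: bigcupT_measurable.
exists K, B; first split => //.
  apply: (le_trans (measure_sigma_subadditive P mBj mB (@subset_refl _ _))).
  apply: le_trans (epsilon_trick0 xpredT (_ : 0 <= 2^-1)) => //.
  apply: lee_nneseries => // j _.
  apply: (le_trans (measureU2 _ (mB1 j) (mB2 j))).
  apply: (le_trans (leeD (bad_bound (pos j) (le1 j)).2 (bad_bound (pos j) (leqnn _)).2)).
  rewrite -EFinD lee_fin expnD natrM expnS natrM.
  (* as n1 >= 4, the bounds 4 / 2 ^ m are dominated by a geometric series of sum 1 / 2 *)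
  have h16 : 16 <= (2 ^ n1)%:R :> R.
    by rewrite (_ : 16 = (2 ^ 4)%:R)// ler_nat leq_exp2l.
  have q0 := pow2_gt0 n1; have z0 := pow2_gt0 j.
  set q := (2 ^ n1)%:R in h16 q0 *; set z := (2 ^ j)%:R in z0 *.
  have -> : 2 / (q * z) + 2 / (q * z) = (16 / q) * (2^-1 / (2 * z)).
    by field; rewrite !gt_eqF.
  by rewrite ler_piMl ?divr_ge0 ?mulr_ge0 ?(ltW z0)// ler_pdivrMr// mul1r.
move=> w /= exc; apply: contrapT => nB.
have nb1 m : (n1 <= m)%N -> ~ bad m m w.
  by move=> nm h; apply: nB; exists (m - n1)%N => //; left; rewrite subnKC.
have nb2 m : (n1 <= m)%N -> ~ bad m (2 * m) w.
  by move=> nm h; apply: nB; exists (m - n1)%N => //; right; rewrite subnKC.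
have h0 : 0 < ((2 ^ n1)%:R)^-1 :> R by rewrite invr_gt0.
have phi_gt0 := regularly_varying_gt0 phi0 phim phirv.
have [t [s [bt bs r0 rh big]]] := osc_exceeds_large ab phi_gt0 h0 exc.
move: big; apply/negP; rewrite -leNgt.
set r := enorm (t - s) in r0 rh *.
have exn : exists n, ((2 ^ n.+1)%:R)^-1 < r.
  have [n _ hn] := near_infty_natSinv_expn_lt (PosNum r0).
  by exists n; have /= := hn n.+1 (leqnSn n); rewrite div1r natrX.
pose n := ex_minn exn.
have [n_lt n_min] : ((2 ^ n.+1)%:R)^-1 < r /\ forall m, ((2 ^ m.+1)%:R)^-1 < r -> (n <= m)%N.
  by rewrite /n; case: ex_minnP.
have n1n : (n1 <= n)%N.
  rewrite leqNgt; apply/negP => nn1.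
  have : ((2 ^ n1)%:R)^-1 <= ((2 ^ n.+1)%:R)^-1 :> R.
    by rewrite lef_pV2 ?posrE// ler_nat leq_exp2l.
  by move=> h; have := le_lt_trans (le_trans rh h) n_lt; rewrite ltxx.
have n_pos : (0 < n)%N by exact: leq_trans n1n.
have r_le : r <= ((2 ^ n)%:R)^-1.
  rewrite leNgt; apply/negP => h; have := n_min n.-1; rewrite prednK// => /(_ h).
  by rewrite leqNgt ltn_predL n_pos.
have small dlt m0 : (m0 <= n1)%N ->
    (forall k, (m0 <= k)%N -> 1 / 2 ^+ k < dlt) ->
    forall m, (n <= m)%N -> ((2 ^ m)%:R)^-1 < dlt :> R.
  move=> mn h m nm; have := h m; rewrite div1r natrX; apply.
  exact: leq_trans mn (leq_trans n1n nm).
have sm1 := small dl m1 n1m1 hm1; have sm2 := small dl2 m2 n1m2 hm2.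
have dblL m : (n <= m)%N -> phi (L1 / (2 ^ m)%:R) <= D * phi ((2 ^ m)%:R)^-1.
  by move=> nm; apply: hD; rewrite ?invr_gt0//; exact: sm1.
pose S := D * ((1 + 2 * C) * (phi ((2 ^ n)%:R)^-1 * Num.sqrt n%:R)).
have sumS J : \sum_(k < J) phi (L1 / (2 ^ lev n k)%:R) * Num.sqrt (lev n k)%:R <= S.
  apply: (@le_trans _ _ (D * \sum_(k < J) phi ((2 ^ (n * 2 ^ k))%:R)^-1 *
      Num.sqrt (n * 2 ^ k)%:R)); last first.
    by rewrite ler_wpM2l ?(ltW D0)// hsum//; exact: leq_trans n1n0 n1n.
  rewrite mulr_sumr; apply: ler_sum => k _; rewrite levE mulrA ler_wpM2r ?sqrtr_ge0//.
  by apply: dblL; rewrite leq_pmulr// expn_gt0.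
have nb2' m : (n <= m)%N -> ~ bad m (2 * m) w by move=> nm; apply: nb2; exact: leq_trans n1n nm.
have [kt tk Xt] := chaining n_pos bt nb2' sumS.
have [ks sk Xs] := chaining n_pos bs nb2' sumS.
have Xts := chain_step tk sk (leqnn n) r_le (nb1 n n1n).
have kC : 0 <= kap * C1 by rewrite mulr_ge0 ?sqrtr_ge0// ltW.
pose A := phi ((2 ^ n)%:R)^-1 * Num.sqrt n%:R.
have main : `|X t w - X s w| <= kap * C1 * D * (1 + 2 * (1 + 2 * C)) * A.
  have -> : X t w - X s w = (X t w - X (grid kt) w) +
     (X (grid kt) w - X (grid ks) w) - (X s w - X (grid ks) w) by ring.
  rewrite (le_trans (ler_normB _ _))//.
  rewrite (le_trans (lerD (le_trans (ler_normD _ _) (lerD Xt Xts)) Xs))//.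
  have mid : kap * C1 * (phi (L1 / (2 ^ n)%:R) * Num.sqrt n%:R) <= kap * C1 * (D * A).
    by rewrite ler_wpM2l// /A mulrA ler_wpM2r ?sqrtr_ge0// dblL.
  have -> : kap * C1 * D * (1 + 2 * (1 + 2 * C)) * A =
     kap * C1 * S + kap * C1 * (D * A) + kap * C1 * S by rewrite /S /A; ring.
  exact: lerD (lerD (lexx _) mid) (lexx _).
apply: (le_trans main).
have s2 : 0 < Num.sqrt (ln (2 : R)) by rewrite sqrtr_gt0.
have -> : K * modulus phi r = kap * C1 * D * (1 + 2 * (1 + 2 * C)) *
    (D2 * modulus phi r / Num.sqrt (ln 2)) by rewrite /K; field; rewrite gt_eqF.
rewrite ler_wpM2l//.
  by rewrite !mulr_ge0 ?(ltW D0)// ?addr_ge0 ?mulr_ge0 ?addr_ge0 ?mulr_ge0 ?(ltW C0) ?sqrtr_ge0 ?(ltW C10).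
rewrite ler_pdivlMr// /A /modulus -[leLHS]mulrA [leRHS]mulrA.
apply: ler_pM; rewrite ?phi0 ?invr_ge0 ?mulr_ge0 ?sqrtr_ge0//.
- apply: (@le_trans _ _ (D2 * phi ((2 ^ n.+1)%:R)^-1)).
    have -> : ((2 ^ n)%:R)^-1 = 2 * ((2 ^ n.+1)%:R)^-1 :> R.
      by rewrite expnS natrM invfM mulVKf.
    by apply: hD2; rewrite ?invr_gt0//; apply: sm2.
  by rewrite ler_wpM2l ?(ltW D20)// phim ?invr_ge0// ltW.
- rewrite -sqrtrM ?ler0n// ler_wsqrtr// mulr_natl -lnXn//.
  rewrite ler_ln ?posrE ?exprn_gt0 ?divr_gt0// div1r -[leLHS]invrK lef_pV2 ?posrE ?invr_gt0 ?exprn_gt0//.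
  by rewrite -natrX.
Qed.

End upper_bound.

(** * Packing: the modulus is positive *)
Section lower_bound.
Context d (T : measurableType d) (R : realType) (P : probability T R).
Context (N : nat) (X : 'rV[R]_N -> {RV P >-> R}) (a b : 'rV[R]_N).
Context (phi : R -> R) (C0 rho a0 h0 C2 : R).
Local Notation inc t s := (fun w => X t w - X s w).
Local Notation gcov := (gcov P).
Hypotheses (N0 : (0 < N)%N) (gX : gaussian_field X) (cX : centered X)
  (Xcont : forall w, continuous (fun t : 'rV[R]_N => X t w))
  (ab : forall i, a 0 i < b 0 i)
  (phi_gt0 : forall r, 0 < r -> 0 < phi r)
  (mod_cont : forall r : R, 0 < r -> {for r, continuous (modulus phi)})
  (C00 : 0 < C0) (rho0 : 0 < rho) (a00 : 0 < a0) (h00 : 0 < h0) (C20 : 0 < C2)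
  (std_ge : forall t s, box a b t -> box a b s ->
    phi (enorm (t - s)) <= C2 * gstd P (inc t s))
  (corr : forall (h : R) (t s t' s' : 'rV[R]_N), 0 < h <= h0 ->
    box a b t -> box a b s -> box a b t' -> box a b s' ->
    enorm (t - s) <= h -> enorm (t' - s') <= h ->
    a0 * h `^ rho <= enorm (s - s') ->
    gcov (inc t s) (inc t s) != 0 -> gcov (inc t' s') (inc t' s') != 0 ->
    gcov (inc t s) (inc t' s') ^+ 2 <=
      (1 - C0) * gcov (inc t s) (inc t s) * gcov (inc t' s') (inc t' s')).

Let i0 : 'I_N := Ordinal N0.
Let W : R := b 0 i0 - a 0 i0.
Let W0 : 0 < W. Proof. by rewrite subr_gt0. Qed.

Let pt (x : R) : 'rV[R]_N := a + x *: delta_mx 0 i0.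

Let box_pt x : 0 <= x <= W -> box a b (pt x).
Proof.
move=> /andP[x0 xW] i; rewrite !mxE eqxx/=.
have [->|_] := eqVneq i i0; last by rewrite mulr0 addr0 lexx ltW.
by rewrite mulr1 lerDl x0/= -lerBrDl.
Qed.

Let enorm_pt x y : enorm (pt x - pt y) = `|x - y|.
Proof.
rewrite /enorm (bigD1 i0)//= big1 ?addr0 => [|i ii0].
  by rewrite !mxE !eqxx/= !mulr1 opprD addrACA subrr add0r sqrtr_sqr.
by rewrite !mxE (negbTE ii0) andbF !mulr0 !addr0 subrr expr0n.
Qed.

Let r : R := Num.sqrt (1 - C0).
Let r0 : 0 <= r. Proof. exact: sqrtr_ge0. Qed.
Let r1 : r < 1.
Proof. by rewrite -[ltRHS]sqrtr1 ltr_sqrt// ltrBlDr ltrDl. Qed.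

(** The factor 8 makes 4 u < (1 - r) lam hold in [small_ball_packing], for u the
    multiple eps of lam. *)
Let eps : R := (1 - r) / 8.
(** With this constant a translation by 2 lam costs z, at every scale, while the
    number of increments is of order z ^ - 2. *)
Let kap : R := Num.sqrt rho / 2.
Let kap0 : 0 < kap. Proof. by rewrite divr_gt0// sqrtr_gt0. Qed.
Let eps0 : 0 < eps. Proof. by rewrite divr_gt0// subr_gt0. Qed.
Let ln20 : 0 < ln (2 : R). Proof. by rewrite ln_gt0// ltr1n. Qed.

(** At scale h_ m the increments are taken over segments of length h_ m in the
    first direction, whose origins are at mutual distance at least
    a0 * h_ m `^ rho, the separation under which correlations are bounded. *)
Let h_ (m : nat) : R := ((2 ^ m)%:R)^-1.
Let h_gt0 m : 0 < h_ m. Proof. by rewrite invr_gt0 ltr0n expn_gt0. Qed.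
Let l_ (m : nat) : R := m%:R * ln 2.
Let z_ (m : nat) : R := expR (- (rho * l_ m / 2)).
Let lam_ m : R := kap * Num.sqrt (l_ m).
Let u_ m : R := eps * lam_ m.
Let n_ m : nat := Num.truncn (W / (2 * (a0 * z_ m ^+ 2))).
Let s_ m (i : nat) : 'rV[R]_N := pt (i%:R * (a0 * z_ m ^+ 2)).
Let t_ m (i : nat) : 'rV[R]_N := pt (i%:R * (a0 * z_ m ^+ 2) + h_ m).
Let f_ m i : T -> R := inc (t_ m i) (s_ m i).
Let Y_ m (i : 'I_(n_ m)) : T -> R := fun w => (gstd P (f_ m i))^-1 * f_ m i w.
Let B_ m : set T := [set w | forall i, `|@Y_ m i w| <= u_ m].

Let h_powR m : h_ m `^ rho = z_ m ^+ 2.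
Proof.
rewrite /powR gt_eqF// /z_ -expRM_natl; congr expR.
rewrite /h_ lnV ?posrE ?ltr0n ?expn_gt0// natrX lnXn// -[ln 2 *+ m]mulr_natl /l_ //; by field.
Qed.

Let ln_h m : ln (1 / h_ m) = l_ m.
Proof. by rewrite div1r invrK natrX lnXn// /l_ mulr_natl. Qed.

Let good m := [/\ (0 < m)%N, h_ m <= h0, h_ m <= W / 2 & z_ m ^+ 2 <= W / (4 * a0)].

Let sp_gt0 m : 0 < a0 * z_ m ^+ 2. Proof. by rewrite mulr_gt0// exprn_gt0// expR_gt0. Qed.

Let n_le m : (n_ m)%:R * (a0 * z_ m ^+ 2) <= W / 2.
Proof.
have x0 : 0 <= W / (2 * (a0 * z_ m ^+ 2)) by rewrite divr_ge0 ?(ltW W0)// mulr_ge0// (ltW (sp_gt0 m)).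
have /andP[h _] := truncn_itv x0.
rewrite -ler_pdivlMr//; apply: le_trans h _.
by rewrite invfM mulrA.
Qed.

Let box_st m (i : 'I_(n_ m)) : good m -> box a b (s_ m i) /\ box a b (t_ m i).
Proof.
move=> [_ _ hW _].
have iW : i%:R * (a0 * z_ m ^+ 2) <= W / 2.
  by rewrite (le_trans _ (n_le m))// ler_wpM2r ?ltW// ltr_nat.
have i00 : 0 <= i%:R * (a0 * z_ m ^+ 2) by rewrite mulr_ge0// ltW.
have hm := h_gt0 m.
split; apply: box_pt; apply/andP; split => //; last 2 first.
- by rewrite addr_ge0// ltW.
- by lra.
by have := W0; lra.
Qed.

Let f_std m (i : 'I_(n_ m)) : good m -> phi (h_ m) <= C2 * gstd P (f_ m i).
Proof.
move=> gm; have [bs bt] := box_st i gm.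
have := std_ge bt bs; rewrite enorm_pt addrAC subrr add0r.
by rewrite ger0_norm ?(ltW (h_gt0 m)).
Qed.

Let f_std_gt0 m (i : 'I_(n_ m)) : good m -> 0 < gstd P (f_ m i).
Proof.
move=> gm; have := lt_le_trans (phi_gt0 (h_gt0 m)) (f_std i gm).
by rewrite pmulr_rgt0.
Qed.

Let gspan_f m i : gspan X (f_ m i).
Proof. by apply: gspan_sub; exact: gspan_X. Qed.

Let gcovZ c e f g : gspan X f -> gspan X g ->
  gcov (fun w => c * f w) (fun w => e * g w) = c * e * gcov f g.
Proof.
move=> sf sg.
have half c' f' g' : gspan X f' -> gspan X g' ->
    gcov (fun w => c' * f' w) g' = c' * gcov f' g'.
  move=> sf' sg'; have := gcov_lin gX cX c' sf' (gspan0 X) sg'.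
  rewrite gcov0l addr0 => <-; congr gcov.
  by apply/funext => w; rewrite addr0.
rewrite half//; last exact: gspan_scale.
by rewrite gcovC half// gcovC mulrA.
Qed.

Let B_bound m : good m -> measurable (B_ m) /\
  fine (P (B_ m)) <= Num.sqrt (pi *+ 2) * (2 * a0) / (W * (eps * kap * Num.sqrt (ln 2))) * z_ m.
Proof.
move=> gm; have [m0 hh0 hW zW] := gm.
have l0 : 0 < l_ m by rewrite mulr_gt0// ltr0n.
have lam0 : 0 < lam_ m by rewrite mulr_gt0// sqrtr_gt0.
have u0 : 0 < u_ m by rewrite mulr_gt0.
have sY i : gspan X (@Y_ m i) by apply: gspan_scale; exact: gspan_f.
have vY i : gcov (@Y_ m i) (@Y_ m i) = 1.
  rewrite gcovZ// -gstd_sqr; field; rewrite gt_eqF//; exact: f_std_gt0.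
have cY (i j : 'I_(n_ m)) : i != j -> `|gcov (@Y_ m i) (@Y_ m j)| <= r.
  move=> ij.
  have [bsi bti] := box_st i gm; have [bsj btj] := box_st j gm.
  have si := f_std_gt0 i gm; have sj := f_std_gt0 j gm.
  have h0h : 0 < h_ m <= h0 by rewrite h_gt0.
  have eh k : enorm (t_ m k - s_ m k) <= h_ m.
    by rewrite enorm_pt addrAC subrr add0r ger0_norm// ltW.
  have dist : a0 * h_ m `^ rho <= enorm (s_ m i - s_ m j).
    rewrite enorm_pt -mulrBl normrM (ger0_norm (ltW (sp_gt0 m))) h_powR.
    rewrite ler_peMl ?(ltW (sp_gt0 m))//.
    have [ij1|ij1|ij1] := ltngtP i j; last by move/eqP : ij; case; exact: val_inj.
      by rewrite distrC -natrB ?(ltnW ij1)// normr_nat ler1n subn_gt0.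
    by rewrite -natrB ?(ltnW ij1)// normr_nat ler1n subn_gt0.
  have ni : gcov (f_ m i) (f_ m i) != 0 by rewrite -gstd_sqr expf_neq0 ?gt_eqF.
  have nj : gcov (f_ m j) (f_ m j) != 0 by rewrite -gstd_sqr expf_neq0 ?gt_eqF.
  have := corr h0h bti bsi btj bsj (eh i) (eh j) dist ni nj.
  rewrite -/(f_ m i) -/(f_ m j) -!gstd_sqr gcovZ// => cij.
  rewrite -sqrtr_sqr /r ler_wsqrtr// exprMn -invfM exprVn mulrC ler_pdivrMr.
    by apply: (le_trans cij); rewrite exprMn [leRHS]mulrA lexx.
  by rewrite exprn_gt0// mulr_gt0.
have sep : 4 * u_ m < (1 - r) * lam_ m.
  rewrite /u_ mulrA ltr_pM2r// /eps; have := r1; lra.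
have r01 : 0 <= r <= 1 by rewrite r0 ltW.
have mB : measurable (B_ m).
  have t0 := gspan0 X; have tL := @gspan_lin _ _ _ P _ X.
  have mspan f : gspan X f -> measurable_fun [set: T] f by exact: gspan_measurable.
  apply: (trig_set_measurable mspan); apply: (trig_forall t0 tL) => i.
  have := trig_norm_le t0 tL 0 (u_ m) (sY i); congr trig_set.
  by apply/seteqP; split => w /=; rewrite subr0.
split => //.
have := small_ball_packing gX cX sY vY cY r01 (ltW lam0) (ltW u0) sep.
rewrite -/(B_ m); set PB := fine _; set e := expR _; set s := Num.sqrt (pi *+ 2).
have PB0 : 0 <= PB by rewrite fine_ge0.
have s0 : 0 < s by rewrite sqrtr_gt0 pmulrn_lgt0// pi_gt0.
have z0 : 0 < z_ m by exact: expR_gt0.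
have ze : z_ m <= e.
  rewrite ler_expR lerN2 ler_wpM2r ?invr_ge0//.
  have ul : u_ m <= lam_ m by rewrite ler_piMl ?(ltW lam0)// /eps; have := r0; lra.
  apply: (@le_trans _ _ ((2 * lam_ m) ^+ 2)).
    by rewrite lerXn2r ?nnegrE ?addr_ge0 ?mulr_ge0 ?(ltW lam0) ?(ltW u0)//; lra.
  rewrite /lam_ /kap le_eqVlt; apply/orP; left; apply/eqP.
  have s1 : Num.sqrt rho ^+ 2 = rho by rewrite sqr_sqrtr// ltW.
  have s2 : Num.sqrt (l_ m) ^+ 2 = l_ m by rewrite sqr_sqrtr// ltW.
  by rewrite -[in RHS]s1 -[in RHS]s2; field.
pose u1 := eps * kap * Num.sqrt (ln 2).
have sl0 : 0 < Num.sqrt (ln (2 : R)) by rewrite sqrtr_gt0.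
have u10 : 0 < u1 by exact: mulr_gt0 (mulr_gt0 eps0 kap0) sl0.
have u1u : u1 <= u_ m.
  rewrite /u1 /u_ /lam_ -mulrA !ler_wpM2l ?(ltW eps0) ?(ltW kap0)// ler_wsqrtr//.
  by rewrite /l_ ler_peMl ?(ltW ln20)// ler1n.
have z20 : 0 < z_ m ^+ 2 by rewrite exprn_gt0.
have q40 : 0 < 4 * a0 * z_ m ^+ 2 by apply: mulr_gt0 => //; exact: mulr_gt0.
(* the quotient truncated in n_ is at least 2, so truncation loses at most one half *)
have nW : W / (4 * a0 * z_ m ^+ 2) <= (n_ m)%:R.
  have := truncnS_gt (W / (2 * (a0 * z_ m ^+ 2))); rewrite -/(n_ m) -natr1.
  have -> : W / (2 * (a0 * z_ m ^+ 2)) = 2 * (W / (4 * a0 * z_ m ^+ 2)).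
    by field; rewrite !gt_eqF.
  have : 1 <= W / (4 * a0 * z_ m ^+ 2).
    by rewrite ler_pdivlMr// mul1r mulrC -ler_pdivlMr ?mulr_gt0.
  lra.
have A1 : 0 <= W / (4 * a0 * z_ m ^+ 2) by rewrite ltW// divr_gt0.
have A2 : 0 <= 2 * u1 by rewrite ltW// mulr_gt0.
have A3 : 0 <= z_ m / s by rewrite ltW// divr_gt0.
have low : W / (4 * a0 * z_ m ^+ 2) * (2 * u1 * (z_ m / s)) <=
    (n_ m)%:R * (2 * u_ m * (e / s)).
  apply: ler_pM => //; first exact: mulr_ge0.
  apply: ler_pM => //; first by rewrite ler_wpM2l.
  by rewrite ler_wpM2r ?invr_ge0 ?(ltW s0).
move=> pk; have := le_trans (ler_wpM2r PB0 low) pk.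
have Q0 : 0 < s * (2 * a0) / (W * u1) * z_ m.
  apply: mulr_gt0 => //; apply: divr_gt0; apply: mulr_gt0 => //; exact: mulr_gt0.
have alg (x1 x2 x3 x4 x5 p : R) : x1 != 0 -> x2 != 0 -> x3 != 0 -> x4 != 0 ->
    x5 != 0 -> x1 / (4 * x5 * x3 ^+ 2) * (2 * x2 * (x3 / x4)) * p =
    p / (x4 * (2 * x5) / (x1 * x2) * x3).
  by move=> n1 n2 n3 n4 n5; field; rewrite n1 n2 n3 n4 n5.
rewrite alg ?(gt_eqF W0) ?(gt_eqF u10) ?(gt_eqF z0) ?(gt_eqF s0) ?(gt_eqF a00)//.
by rewrite ler_pdivrMr// mul1r.
Qed.

Let z_cvg0 (K : R) : K * z_ m @[m --> \oo] --> 0.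
Proof.
rewrite -(mulr0 K); apply: cvgMr.
have -> : z_ = (fun m => expR (- (rho * ln 2 / 2)) ^+ m).
  by apply/funext => m; rewrite /z_ -expRM_natl /l_; congr expR; ring.
apply: cvg_expr; rewrite ger0_norm ?expR_ge0// expR_lt1 oppr_lt0.
by apply: divr_gt0 => //; exact: mulr_gt0.
Qed.

Let eventually_good : exists m0, forall m, (m0 <= m)%N -> good m.
Proof.
have c1 : 0 < Num.min h0 (W / 2) by rewrite lt_min h00 divr_gt0.
have c2 : 0 < Num.min 1 (W / (4 * a0)) by rewrite lt_min ltr01 divr_gt0// mulr_gt0.
have [m1 _ hm1] := near_infty_natSinv_expn_lt (PosNum c1).
have /cvgrPdist_le/(_ _ c2) [m2 _ hm2] := z_cvg0 1.
exists (maxn 1 (maxn m1 m2)) => m; rewrite !geq_max => /and3P[m10 mm1 mm2].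
have := hm1 m mm1; rewrite /= div1r -natrX lt_min -/(h_ m) => /andP[/ltW ? /ltW ?].
have := hm2 m mm2; rewrite /= sub0r mul1r normrN ger0_norm ?expR_ge0//.
rewrite le_min => /andP[z1 zW]; split => //.
by rewrite expr2 (le_trans _ zW)// ler_piMl ?expR_ge0.
Qed.

(** If the modulus of the path is at most c then, at every small scale, all the
    normalized increments Y_ lie in the small ball B_, whose probability tends to 0
    with the scale. *)
Lemma not_osc_exceeds_negligible : exists2 c, 0 < c & forall A : set T, measurable A ->
  A `<=` [set w | ~ osc_exceeds a b phi (fun t => X t w) c] -> P A = 0%E.
Proof.
pose c := eps * kap / (2 * C2).
have c0 : 0 < c by apply: divr_gt0; apply: mulr_gt0.
exists c => // A mA Ac.
have [m0 gm0] := eventually_good.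
pose Wn n := \bigcap_j B_ (m0 + n + j)%N.
have gm n j : good (m0 + n + j)%N by apply: gm0; rewrite -addnA leq_addr.
have mBn n j := (B_bound (gm n j)).1.
have mW n : measurable (Wn n) by exact: bigcapT_measurable.
have W0' n : P (Wn n) = 0%E.
  rewrite -[LHS]fineK ?fin_num_measure//; congr EFin.
  apply/eqP; rewrite eq_le fine_ge0// andbT.
  set K := Num.sqrt (pi *+ 2) * (2 * a0) / (W * (eps * kap * Num.sqrt (ln 2))).
  have := z_cvg0 K; rewrite -(cvg_shiftn (m0 + n)) => cz.
  apply: (cvgr_to_ge cz); apply: nearW => j /=.
  apply: le_trans (_ : fine (P (B_ (m0 + n + j)%N)) <= _).
    rewrite fine_le ?fin_num_measure// le_measure ?inE//.
    by apply: bigcap_inf.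
  by rewrite [(j + _)%N]addnC; exact: (B_bound (gm n j)).2.
have sub : A `<=` \bigcup_n Wn n.
  move=> w /Ac /= nexc.
  have [dl dl0 hd] := osc_not_exceeds ab phi_gt0 mod_cont (@Xcont w) nexc c0.
  have [n _ hn] := near_infty_natSinv_expn_lt (PosNum dl0).
  exists n => // j _ i.
  set m := (m0 + n + j)%N in i *.
  have g := gm n j; rewrite -/m in g.
  have [bs bt] := box_st i g.
  have est : enorm (t_ m i - s_ m i) = h_ m.
    by rewrite enorm_pt addrAC subrr add0r ger0_norm// ltW.
  have hdl : h_ m < dl.
    by have := hn m; rewrite /= div1r -natrX; apply; rewrite /m addnAC leq_addl.
  have := hd _ _ bt bs; rewrite est => /(_ (h_gt0 m) hdl).
  rewrite /modulus ln_h => Xle.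
  have sg := f_std_gt0 i g.
  rewrite /Y_ normrM normfV (gtr0_norm sg) mulrC ler_pdivrMr//.
  apply: (le_trans Xle).
  have -> : u_ m * gstd P (f_ m i) = (c + c) * (C2 * gstd P (f_ m i) * Num.sqrt (l_ m)).
    by rewrite /u_ /lam_ /c; field; rewrite gt_eqF.
  rewrite ler_wpM2l ?addr_ge0 ?(ltW c0)// ler_wpM2r ?sqrtr_ge0//.
  exact: f_std.
apply/eqP; rewrite eq_le measure_ge0 andbT.
apply: (le_trans (measure_sigma_subadditive P mW mA sub)).
by rewrite eseries0// => n _ _; exact: W0'.
Qed.

End lower_bound.

(** * The modulus is not random *)
Section zero_one_modulus.
Context d (T : measurableType d) (R : realType) (P : probability T R).
Context (N : nat) (X : 'rV[R]_N -> {RV P >-> R}) (a b : 'rV[R]_N).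
Context (phi : R -> R) (C1 : R).
Hypotheses (gX : gaussian_field X) (cX : centered X)
  (ab : forall i, a 0 i < b 0 i) (phi_gt0 : forall r, 0 < r -> 0 < phi r)
  (std_le : forall t s, box a b t -> box a b s ->
    gstd P (fun w => X t w - X s w) <= C1 * phi (enorm (t - s))).
Local Notation gcov := (gcov P).
Local Notation osc := (osc_exceeds a b phi).

Lemma trig_set_osc (V : set (T -> R)) (Z : 'rV[R]_N -> T -> R) c :
  V (fun=> 0) ->
  (forall e f g, V f -> V g -> V (fun w => e * f w + g w)) ->
  (forall t s, V (fun w => Z t w - Z s w)) ->
  trig_set V [set w | osc (fun t => Z t w) c].
Proof.
move=> V0 VL VZ; apply: (trig_exists V0 VL) => k.
apply: (trig_forall V0 VL) => n; apply: (trig_exists V0 VL) => p.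
case: (boolP (0 < grid_dist a b p < ((2 ^ n)%:R)^-1)) => _; last first.
  by have := trig_set0 V0; congr trig_set; apply/seteqP; split.
have := trig_setC V0 (trig_norm_le V0 VL 0
  ((c + k.+1%:R^-1) * modulus phi (grid_dist a b p))
  (VZ (gridpt a b p.1) (gridpt a b p.2))).
congr trig_set; apply/seteqP; split => w /=; rewrite subr0 ltNge.
  by move/negP.
by move=> /negP.
Qed.

(** The component of X along a variable f of the span changes the increments by at
    most a multiple of phi, so the event is determined by the variables orthogonal
    to f. *)
Lemma osc_zero_one c : 
  let A := [set w | osc (fun t => X t w) c] in
  measurable A /\ (P A = 0%E \/ P A = 1%E).
Proof.
move=> A.
have t0 := gspan0 X; have tL := @gspan_lin _ _ _ P _ X.
have tA : trig_set (gspan X) A.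
  by apply: trig_set_osc => // t s; apply: gspan_sub; exact: gspan_X.
split.
  by apply: trig_set_measurable tA => f; exact: gspan_measurable.
apply: (gaussian_zero_one gX cX tA) => f sf.
pose be t := gcov (X t) f / gcov f f.
pose Y t w := X t w - be t * f w.
have incb t s : gcov (fun w => X t w - X s w) f / gcov f f = be t - be s.
  rewrite /be -mulrBl; congr (_ / _).
  have := gcov_lin gX cX (-1) (gspan_X X s) (gspan_X X t) sf.
  rewrite mulN1r addrC => <-; congr gcov.
  by apply/funext => w; rewrite mulN1r addrC.
have key w : exists K, forall t s, box a b t -> box a b s ->
    `|(X t w - X s w) - (Y t w - Y s w)| <= K * phi (enorm (t - s)).
  exists (C1 * gstd P f / gcov f f * `|f w|) => t s bt bs.
  have -> : X t w - X s w - (Y t w - Y s w) = (be t - be s) * f w by rewrite /Y; ring.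
  rewrite -incb normrM [leRHS]mulrAC ler_wpM2r// normrM normfV.
  rewrite [X in _ / X]ger0_norm ?gcov_ge0// [leRHS]mulrAC ler_wpM2r ?invr_ge0 ?gcov_ge0//.
  rewrite [leRHS]mulrAC -[leLHS]sqrtr_sqr.
  have si : gspan X (fun w => X t w - X s w) by apply: gspan_sub; exact: gspan_X.
  apply: (@le_trans _ _ (gstd P (fun w => X t w - X s w) * gstd P f)).
    rewrite /gstd -sqrtrM ?gcov_ge0// ler_wsqrtr//.
    exact: (cauchy_gcov gX cX).
  by rewrite ler_wpM2r ?sqrtr_ge0// std_le.
have -> : A = [set w | osc (fun t => Y t w) c].
  apply/seteqP; split => w /=; have [K hK] := key w.
    exact: (osc_exceeds_perturb ab phi_gt0 hK).
  apply: (@osc_exceeds_perturb _ _ a b phi ab phi_gt0 (fun t => Y t w) (fun t => X t w) c K).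
  by move=> t s bt bs; rewrite -normrN opprB; exact: hK.
apply: trig_set_osc.
- by split; [exact: gspan0|exact: gcov0l].
- move=> e g h [sg g0] [sh h0]; split; first exact: gspan_lin.
  by rewrite (gcov_lin gX cX)// g0 h0 mulr0 addr0.
- move=> t s; have si : gspan X (fun w => X t w - X s w).
    by apply: gspan_sub; exact: gspan_X.
  have YE : (fun w => Y t w - Y s w) =
      (fun w => (- (be t - be s)) * f w + (X t w - X s w)).
    by apply/funext => w; rewrite /Y; ring.
  rewrite YE; split; first exact: gspan_lin.
  rewrite (gcov_lin gX cX)// -incb.
  have [f0|f0] := eqVneq (gcov f f) 0; last by rewrite mulNr divfK// addNr.
  have := cauchy_gcov gX cX si sf; rewrite f0 mulr0 => h.
  have : gcov (fun w => X t w - X s w) f ^+ 2 == 0 by rewrite eq_le h sqr_ge0.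
  by rewrite sqrf_eq0 => /eqP ->; rewrite mulr0 add0r.
Qed.

Lemma osc_anti x c c' : c <= c' -> osc x c' -> osc x c.
Proof.
move=> cc' [k kx]; exists k => n; have [p /andP[/andP[p0 p1] p2]] := kx n.
exists p; rewrite p0 p1 (le_lt_trans _ p2)// ler_wpM2r ?lerD2r//.
exact: (modulus_ge0 phi_gt0).
Qed.

(** The probability that the modulus exceeds c is a nonincreasing function of c
    with values 0 and 1; the constant is the point where it jumps. *)
Lemma osc_level_as_constant (c0 K : R) :
  P [set w | osc (fun t => X t w) c0] = 1%E ->
  P [set w | osc (fun t => X t w) K] = 0%E ->
  exists2 K1, c0 <= K1 & {ae P, forall w, forall e, 0 < e ->
     osc (fun t => X t w) (K1 - e) /\ ~ osc (fun t => X t w) (K1 + e)}.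
Proof.
move=> P1 P0.
pose A c := [set w | osc (fun t => X t w) c].
have mA c : measurable (A c) := (osc_zero_one c).1.
have zo c : P (A c) = 0%E \/ P (A c) = 1%E := (osc_zero_one c).2.
have Ale c c' : c <= c' -> (P (A c') <= P (A c))%E.
  by move=> cc'; rewrite le_measure ?inE// => w; exact: osc_anti.
pose S := [set c | P (A c) = 1%E].
have Sub : ubound S K.
  move=> c Sc; rewrite leNgt; apply/negP => /ltW /Ale.
  by rewrite Sc P0 lee_fin ler10.
have hS : has_sup S by split; [exists c0|exists K].
exists (sup S); first by apply: sup_ubound => //; case: hS.
have above c : sup S < c -> P (A c) = 0%E.
  move=> Sc; have [//|h] := zo c.
  have := sup_ubound hS.2 (h : S c); move=> /(lt_le_trans Sc); by rewrite ltxx.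
have below c : c < sup S -> P (~` A c) = 0%E.
  move=> cS; have [c' Sc' cc'] := sup_gt hS.1 cS.
  have : P (A c) = 1%E.
    apply/eqP; rewrite eq_le probability_le1//= -(Sc' : P (A c') = 1%E).
    exact/Ale/ltW.
  by move=> h; rewrite probability_setC// h subee.
pose N1 := \bigcup_k (A (sup S + k.+1%:R^-1)).
pose N2 := \bigcup_k (~` A (sup S - k.+1%:R^-1)).
have neg1 : P.-negligible N1.
  apply: negligible_bigcup => k.
  by apply/negligibleP; [exact: mA|apply: above; rewrite ltrDl invr_gt0].
have neg2 : P.-negligible N2.
  apply: negligible_bigcup => k.
  apply/negligibleP; first by apply: measurableC; exact: mA.
  by apply: below; rewrite gtrBl invr_gt0.
apply: negligibleS (negligibleU neg1 neg2) => w /= nw.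
apply: contrapT => nN; apply: nw => e e0.
pose k := Num.truncn e^-1.
have ke : k.+1%:R^-1 <= e by rewrite invf_ple ?posrE//; exact/ltW/truncnS_gt.
split.
  apply: contrapT => h; apply: nN; right; exists k => // h'; apply: h.
  by apply: osc_anti h'; rewrite lerD2l lerN2.
move=> h; apply: nN; left; exists k => //.
by apply: osc_anti h; rewrite lerD2l.
Qed.

End zero_one_modulus.

(** * The theorem *)
Section increments.
Context d (T : measurableType d) (R : realType) (P : probability T R).
Context (U : Type) (X : U -> {RV P >-> R}).
Hypotheses (gX : gaussian_field X) (cX : centered X).

Lemma incr_std_gstd t s : incr_std X t s = gstd P (fun w => X t w - X s w).
Proof.
rewrite /incr_std /gstd /gcov /Rintegral unlock; congr (Num.sqrt (fine _)).
Qed.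

Lemma variance_incr t s :
  ('V_P[(X t \- X s)%R] = (gcov P (fun w => X t w - X s w) (fun w => X t w - X s w))%:E)%E.
Proof.
have si : gspan X (fun w => X t w - X s w) by apply: gspan_sub; exact: gspan_X.
have Ei : ('E_P[(X t \- X s)%R] = 0)%E.
  rewrite unlock -[LHS]fineK; first by have := gspan_mean gX cX si; rewrite /Rintegral => ->.
  by apply: integrable_fin_num => //; exact: (gspan_integrable gX si).
rewrite /variance unlock Ei /= unlock.
have i2 := gspan_integrable_mul gX cX si si.
rewrite /gcov /Rintegral fineK; last exact: integrable_fin_num.
by apply: eq_integral => w _; rewrite /= /GRing.mul /= subr0.
Qed.

End increments.

Theorem theorem1p1 (R : realType) (d : measure_display) (T : measurableType d)
    (P : probability T R) (N : nat) (X : 'rV[R]_N -> {RV P >-> R})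
    (a b : 'rV[R]_N) (phi : R -> R) (theta : R) (C0 rho a0 h0 : R) :
  (0 < N)%N ->
  measure_is_complete P ->
  gaussian_field X ->
  centered X ->
  (forall w, continuous (fun t : 'rV[R]_N => X t w)) ->
  (forall i, a 0 i < b 0 i) ->
  asymp [set p | box a b p.1 /\ box a b p.2]
    (fun p => incr_std X p.1 p.2) (fun p => phi (enorm (p.1 - p.2))) ->
  (forall r, 0 <= r -> 0 <= phi r) ->
  (forall r r', 0 <= r -> r <= r' -> phi r <= phi r') ->
  {within `[0, +oo[, continuous phi} ->
  0 <= theta <= 1 ->
  regularly_varying0 phi theta ->
  (exists2 C : R, 0 < C & \forall h \near 0^'+,
    (\int[lebesgue_measure]_(r in `]0%R, h[)
       (phi r / (r * Num.sqrt (ln (1 / r))))%:E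
     <= (C * (phi h * Num.sqrt (ln (1 / h))))%:E)%E) ->
  phi h * Num.sqrt (ln (1 / h)) @[h --> 0^'+] --> 0 ->
  0 < C0 -> 0 < rho -> 0 < a0 -> 0 < h0 <= 1 ->
  (forall (h : R) (t s t' s' : 'rV[R]_N), 0 < h <= h0 ->
    box a b t -> box a b s -> box a b t' -> box a b s' ->
    enorm (t - s) <= h -> enorm (t' - s') <= h ->
    a0 * h `^ rho <= enorm (s - s') ->
    (C0%:E * 'V_P[(X t \- X s)%R]
       <= (cond_var P (X t \- X s)%R (X t' \- X s')%R)%:E)%E) ->
  exists2 K1 : R, 0 < K1 &
    {ae P, forall w,
      sup_modulus X (box a b) phi w h @[h --> 0^'+] --> K1%:E}.
Proof.
move=> N0 _ gX cX Xcont ab [[C1 C10 le1] [C2 C20 le2]] phi0 phim phic _ phirv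
  [C Cp dini] _ C00 rho0 a00 /andP[h00 _] condvar.
have phi_gt0 := regularly_varying_gt0 phi0 phim phirv.
have mod_cont : forall r : R, 0 < r -> {for r, continuous (modulus phi)}.
  by move=> r; exact: continuous_modulus.
have std_le t s : box a b t -> box a b s ->
    gstd P (fun w => X t w - X s w) <= C1 * phi (enorm (t - s)).
  by move=> bt bs; rewrite -incr_std_gstd; exact: (le1 (t, s)).
have std_ge t s : box a b t -> box a b s ->
    phi (enorm (t - s)) <= C2 * gstd P (fun w => X t w - X s w).
  by move=> bt bs; rewrite -incr_std_gstd; exact: (le2 (t, s)).
have si t s : gspan X (fun w => X t w - X s w) by apply: gspan_sub; exact: gspan_X.
have corr : forall (h : R) (t s t' s' : 'rV[R]_N), 0 < h <= h0 ->
    box a b t -> box a b s -> box a b t' -> box a b s' ->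
    enorm (t - s) <= h -> enorm (t' - s') <= h ->
    a0 * h `^ rho <= enorm (s - s') ->
    gcov P (fun w => X t w - X s w) (fun w => X t w - X s w) != 0 ->
    gcov P (fun w => X t' w - X s' w) (fun w => X t' w - X s' w) != 0 ->
    gcov P (fun w => X t w - X s w) (fun w => X t' w - X s' w) ^+ 2 <=
      (1 - C0) * gcov P (fun w => X t w - X s w) (fun w => X t w - X s w) *
      gcov P (fun w => X t' w - X s' w) (fun w => X t' w - X s' w).
  move=> h t s t' s' hh bt bs bt' bs' ts ts' ss' f0 g0.
  apply: (cond_var_correlation gX cX (si t s) (si t' s') C00 f0 g0).
  have := condvar h t s t' s' hh bt bs bt' bs' ts ts' ss'.
  by rewrite variance_incr// -EFinM lee_fin.
have zo c := osc_zero_one gX cX ab phi_gt0 std_le c.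
have [c0 c0p low] := not_osc_exceeds_negligible N0 gX cX Xcont ab phi_gt0 mod_cont C00 rho0
  a00 h00 C20 std_ge corr.
have [K [B [mB PB] AB]] := osc_exceeds_prob_le_half gX cX Xcont ab phi0 phim phic phirv C10 std_le Cp dini.
have P1 : P [set w | osc_exceeds a b phi (fun t => X t w) c0] = 1%E.
  have [mA [PA|//]] := zo c0.
  have := low _ (measurableC mA) (fun w h => h).
  by rewrite probability_setC// PA sube0 => /eqP; rewrite onee_eq0.
have P0 : P [set w | osc_exceeds a b phi (fun t => X t w) K] = 0%E.
  have [mA [//|PA]] := zo K.
  have : (P [set w | osc_exceeds a b phi (fun t => X t w) K] <= (2^-1)%:E)%E.
    by apply: le_trans PB; rewrite le_measure ?inE.
  have half1 : (2^-1 : R) < 1 by rewrite invf_lt1// ltr1n.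
  by rewrite PA lee_fin leNgt half1.
have [K1 cK aeK] := osc_level_as_constant gX cX ab phi_gt0 std_le P1 P0.
exists K1; first exact: lt_le_trans cK.
apply: filterS aeK => w oscw.
have ratioE t s : modulus_ratio X phi w t s = `|X t w - X s w| / modulus phi (enorm (t - s)).
  by [].
have upper e : 0 < e -> \forall h \near 0^'+,
    (sup_modulus X (box a b) phi w h <= (K1 + e)%:E)%E.
  move=> e0; have e20 : 0 < e / 2 by rewrite divr_gt0.
  have [_ nexc] := oscw _ e20.
  have [dl dl0 hd] := osc_not_exceeds ab phi_gt0 mod_cont (@Xcont w) nexc e20.
  have m0 : 0 < Num.min dl 1 by rewrite lt_min dl0 ltr01.
  near=> h.
  have hm : h < Num.min dl 1 by near: h; exact: nbhs_right_lt.
  apply: ub_ereal_sup => _ [[t s] /= [bt bs /andP[r0 rh]] <-].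
  rewrite lee_fin ratioE.
  have := le_lt_trans rh hm; rewrite lt_min => /andP[rd r1].
  have := @modulus_gt0 _ phi theta phi0 phim phirv (enorm (t - s)).
  rewrite r0 r1 => /(_ isT) mp.
  rewrite ler_pdivrMr//; have := hd _ _ bt bs r0 rd.
  by rewrite -addrA -splitr.
have lower e : 0 < e -> \forall h \near 0^'+,
    ((K1 - e)%:E <= sup_modulus X (box a b) phi w h)%E.
  move=> e0; have [exc _] := oscw _ e0.
  near=> h.
  have hp : 0 < h by near: h; exact: nbhs_right_gt.
  have h1 : h < 1 by near: h; exact: nbhs_right_lt.
  have [t [s [bt bs r0 rh big]]] := osc_exceeds_large ab phi_gt0 hp exc.
  apply: (@le_trans _ _ (modulus_ratio X phi w t s)%:E).
    have := @modulus_gt0 _ phi theta phi0 phim phirv (enorm (t - s)).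
    rewrite r0 (le_lt_trans rh h1) => /(_ isT) mp.
    by rewrite lee_fin ratioE ler_pdivlMr// ltW.
  by apply: ereal_sup_ubound; exists (t, s) => //=; split => //; rewrite r0.
apply/fine_cvgP; split.
  have u1 := upper _ ltr01; have l1 := lower _ ltr01.
  near=> h.
  have hu : (sup_modulus X (box a b) phi w h <= (K1 + 1)%:E)%E by near: h.
  have hl : ((K1 - 1)%:E <= sup_modulus X (box a b) phi w h)%E by near: h.
  by rewrite fin_numElt (lt_le_trans _ hl) ?ltNyr// (le_lt_trans hu)// ltry.
apply/cvgrPdist_le => e e0.
have u1 := upper _ e0; have l1 := lower _ e0.
near=> h.
have hu : (sup_modulus X (box a b) phi w h <= (K1 + e)%:E)%E by near: h.
have hl : ((K1 - e)%:E <= sup_modulus X (box a b) phi w h)%E by near: h.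
have hfin : sup_modulus X (box a b) phi w h \is a fin_num.
  by rewrite fin_numElt (lt_le_trans _ hl) ?ltNyr// (le_lt_trans hu)// ltry.
move: hu hl; rewrite -(fineK hfin) !lee_fin distrC ler_distl => -> ->.
by [].
Unshelve. all: end_near. Qed.
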